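(* Let $T$ be a minimal Tate resolution and $BW=\mathbf{BW}(T)$ its Beilinson window. Let $P(BW)\subset BW$ be the subcomplex $$P(BW)=\langle f\in BW\text{ homogeneous}\mid\deg f\not\ge1^t\rangle\subset BW.$$ If $BW/P(BW)\to I$ is a minimal injective resolution and $F\to P(BW)$ is a minimal projective resolution, then the shifted corner complex $T_{\Rsh 1^t}[t]$ is isomorphic to $[\,[F\to BW]\to I\,]$, and $cT:=T_{\Rsh1^t}[t-1]$ has $BW$ as a subquotient complex.
   Context: Setting: $K$ is a field, $V_1,\dots,V_t$ are $K$-vector spaces with $\dim V_i=n_i+1$, $n=(n_1,\dots,n_t)$, and $E=\bigwedge(\bigoplus_iV_i)$ is $\mathbb Z^t$-graded with $V_i$ in degree $(0,\dots,-1,\dots,0)$ ($-1$ in place $i$). $E$-modules are graded right modules with degree-preserving maps, $N(a)_b=N_{a+b}$, $\omega_E=\operatorname{Hom}_K(E,K)$, free of rank 1 with socle in degree $0$. $\mathbb Z^t$ has the termwise partial order and $1^t=(1,\dots,1)$. Complexes are cohomological, $C[k]^d=C^{k+d}$. The mapping cone of $\phi:A\to B$ is written $[A\to B]$, with exact sequence $0\to B\to[A\to B]\to A[1]\to0$. Here $F\to BW$ is the composite $F\to P(BW)\subset BW$, and $[F\to BW]\to I$ is induced by $BW\to BW/P(BW)\to I$ (and zero on the $F$-part). A projective (injective) resolution of a complex $C$ is a complex of projectives (injectives) with a quasi-isomorphism to (from) $C$. A complex of $E$-modules is locally finite if for each multidegree the sum over all terms of the graded components in that multidegree is finite dimensional;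 a free complex $T$ is minimal if $T\otimes_EK$ has zero differential. Write $T^d=\bigoplus_aB_a^d\otimes_K\omega_E(-a)$ with $B_a^d$ vector spaces in degree $0$. For $c\in\mathbb Z^t$ and pairwise disjoint $I',J,L\subset\{1,\dots,t\}$ let $T_c(I',J,L)$ be the subquotient complex of $T$ consisting of the summands $B_a^d\otimes\omega_E(-a)$ with $a_i<c_i$ for $i\in I'$, $a_i=c_i$ for $i\in J$, $a_i\ge c_i$ for $i\in L$. The strands of $T$ are the $T_c(\emptyset,J,\emptyset)$ with $J\subsetneq\{1,\dots,t\}$. A Tate resolution is a locally finite $\mathbb Z^t$-graded complex of free $E$-modules all of whose strands are exact. The Beilinson window $\mathbf{BW}(T)$ is the subquotient complex of $T$ with terms $\bigoplus_{-n\le a\le0}B_a^d\otimes\omega_E(-a)$. Corner complexes: put $qT_{c,I'}=T_c(I',\emptyset,\{1,\dots,t\}\setminus I')$, $T_{<c}=qT_{c,\{1,\dots,t\}}$, $T_{\ge c}=qT_{c,\emptyset}$. For $k=1,\dots,t$ the termwise split exact sequence $0\to qT_{c,\{1,\dots,k-1\}}\to T_c(\{1,\dots,k-1\},\emptyset,\{k+1,\dots,t\})\to qT_{c,\{1,\dots,k\}}\to0$ yields, via the differential of the middle complex, a morphism $qT_{c,\{1,\dots,k\}}[-1]\to qT_{c,\{1,\dots,k-1\}}$. The corner map $\varphi_c:T_{<c}[-t]\to T_{\ge c}$ is the composition of these $t$ (suitably shifted) morphisms, and the corner complex $T_{\Rsh c}$ is the mapping cone of $\varphi_c$.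
   Formalization: The projective resolution F is assumed bounded above and the injective resolution I bounded below; otherwise an exact minimal free complex (e.g. a Tate resolution for t = 1) could be added to F or I and the isomorphism would fail. *)

(* Defs.v *)
From HB Require Import structures.
From mathcomp Require Import all_boot all_order all_algebra.
From mathcomp Require Import boolp ring.

Set Implicit Arguments.
Unset Strict Implicit.
Unset Printing Implicit Defensive.

Import Order.TTheory GRing.Theory Num.Theory.
Local Open Scope ring_scope.
Local Open Scope quotient_scope.

(* Complexes and graded modules below are families indexed by int or Z^t, and
   degrees such as (k + d) + 1 and k + (d + 1) are only provably equal: recast
   identifies B i with B j when i = j (and is 0 when i <> j). *)
Definition recast (K : fieldType) (I : eqType) (B : I -> lmodType K) (i j : I)
    (x : B i) : B j :=
  match i =P j with
  | ReflectT e => eq_rect i (fun k => B k : Type) x j e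
  | ReflectF _ => 0
  end.
Arguments recast {K I} B i j x.

Section Recast.
Variables (K : fieldType) (I : eqType) (B : I -> lmodType K).

Lemma recast_id i (x : B i) : recast B i i x = x.
Proof. by rewrite /recast; case: eqP => // e; rewrite (eq_axiomK e). Qed.

Lemma recast_neq i j (x : B i) : i != j -> recast B i j x = 0.
Proof. by rewrite /recast; case: eqP. Qed.

Lemma recast_linear i j : linear (recast B i j).
Proof.
move=> c x y; have [e|ne] := eqVneq i j; last first.
  by rewrite !recast_neq // scaler0 addr0.
by case: _ / e; rewrite !recast_id.
Qed.

HB.instance Definition _ i j :=
  GRing.isLinear.Build K (B i) (B j) _ (recast B i j) (@recast_linear i j).

Lemma recast_recast i j k (x : B i) :
  i = j -> recast B j k (recast B i j x) = recast B i k x.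
Proof. by move=> e; case: _ / e; rewrite recast_id. Qed.

Lemma recast_recastr i j k (x : B i) :
  j = k -> recast B j k (recast B i j x) = recast B i k x.
Proof. by move=> e; case: _ / e; rewrite recast_id. Qed.

Lemma recast_dep (J : Type) (u : J -> I) (f : forall s, B (u s)) s s' k :
  s = s' -> recast B (u s) k (f s) = recast B (u s') k (f s').
Proof. by move=> ->. Qed.

End Recast.

Lemma recast_map (K : fieldType) (I : eqType) (B B' : I -> lmodType K)
    (g : forall i, {linear B i -> B' i}) i j x :
  recast B' i j (g i x) = g j (recast B i j x).
Proof.
have [e|ne] := eqVneq i j; last by rewrite !recast_neq // linear0.
by case: _ / e; rewrite !recast_id.
Qed.


Section DependentProduct.
Variables (K : fieldType) (I : finType) (U : I -> lmodType K).

Definition dprod : Type := {dffun forall i, U i}.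
HB.instance Definition _ := Choice.on dprod.
Implicit Types f g : dprod.

Definition dprod0 : dprod := finfun (fun i => 0 : U i).
Definition dprodN f : dprod := finfun (fun i => - f i).
Definition dprodD f g : dprod := finfun (fun i => f i + g i).
Definition dprodZ (c : K) f : dprod := finfun (fun i => c *: f i).

Fact dprodA : associative dprodD.
Proof. by move=> f g h; apply/ffunP=> i; rewrite !ffunE addrA. Qed.
Fact dprodC : commutative dprodD.
Proof. by move=> f g; apply/ffunP=> i; rewrite !ffunE addrC. Qed.
Fact dprod_add0 : left_id dprod0 dprodD.
Proof. by move=> f; apply/ffunP=> i; rewrite !ffunE add0r. Qed.
Fact dprod_addN : left_inverse dprod0 dprodN dprodD.
Proof. by move=> f; apply/ffunP=> i; rewrite !ffunE addNr. Qed.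
HB.instance Definition _ :=
  GRing.isZmodule.Build dprod dprodA dprodC dprod_add0 dprod_addN.

Fact dprod_scaleA c d f : dprodZ c (dprodZ d f) = dprodZ (c * d) f.
Proof. by apply/ffunP=> i; rewrite !ffunE scalerA. Qed.
Fact dprod_scale1 : left_id 1 dprodZ.
Proof. by move=> f; apply/ffunP=> i; rewrite !ffunE scale1r. Qed.
Fact dprod_scaleDr : right_distributive dprodZ +%R.
Proof. by move=> c f g; apply/ffunP=> i; rewrite !ffunE scalerDr. Qed.
Fact dprod_scaleDl f : {morph dprodZ^~ f : c d / c + d}.
Proof. by move=> c d; apply/ffunP=> i; rewrite !ffunE scalerDl. Qed.
HB.instance Definition _ := GRing.Zmodule_isLmodule.Build K dprod
  dprod_scaleA dprod_scale1 dprod_scaleDr dprod_scaleDl.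

Lemma dprodP f g : (forall i, f i = g i) -> f = g.
Proof. by move=> e; apply/ffunP. Qed.
Lemma dprod0E i : (0 : dprod) i = 0. Proof. by rewrite ffunE. Qed.
Lemma dprodDE f g i : (f + g) i = f i + g i. Proof. by rewrite ffunE. Qed.
Lemma dprodZE c f i : (c *: f) i = c *: f i. Proof. by rewrite ffunE. Qed.
Lemma dprod_sumE (J : Type) (r : seq J) (P : pred J) (F : J -> dprod) i :
  (\sum_(j <- r | P j) F j) i = \sum_(j <- r | P j) F j i.
Proof.
by elim/big_rec2: _ => [|j x y _ <-]; rewrite ?dprod0E ?dprodDE.
Qed.

End DependentProduct.

Section LmoduleQuotient.
Variables (K : fieldType) (U : lmodType K) (W : submodClosed U).

(* The library's quotient asks for an additive subgroup. *)
Definition subgroup_of : {pred U} := fun x => x \in W.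
Fact subgroup_of_closed : zmod_closed subgroup_of.
Proof.
split; first exact: rpred0.
by move=> x y hx hy; rewrite -scaleN1r; apply: rpredD => //; apply: rpredZ.
Qed.
HB.instance Definition _ :=
  GRing.isZmodClosed.Build U subgroup_of subgroup_of_closed.

Definition lquot : Type := Quotient.quot subgroup_of.
HB.instance Definition _ := GRing.Zmodule.on lquot.

Definition lpi (x : U) : lquot := \pi_(Quotient.quot subgroup_of) x.
Definition lscale (c : K) (x : lquot) : lquot := lpi (c *: repr (x : Quotient.quot subgroup_of)).

Lemma lpi_eq x y : (lpi x = lpi y) <-> (x - y \in W).
Proof.
have <- : Quotient.equiv subgroup_of x y = (x - y \in W) by [].
by split=> [/eqmodP|h] //; apply/eqmodP.
Qed.
Lemma lpi_repr (x : lquot) : lpi (repr (x : Quotient.quot subgroup_of)) = x.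
Proof. by rewrite /lpi reprK. Qed.
Lemma lpiD : {morph lpi : x y / x + y}.
Proof. by move=> x y; rewrite /lpi raddfD. Qed.
Lemma lpiZ c x : lpi (c *: x) = lscale c (lpi x).
Proof.
by apply/lpi_eq; rewrite -scalerBr rpredZ //; apply/lpi_eq; rewrite lpi_repr.
Qed.
Fact lscaleA c d x : lscale c (lscale d x) = lscale (c * d) x.
Proof. by rewrite -[x]lpi_repr -!lpiZ scalerA. Qed.
Fact lscale1 : left_id 1 lscale.
Proof. by move=> x; rewrite -[x]lpi_repr -!lpiZ scale1r. Qed.
Fact lscaleDr : right_distributive lscale +%R.
Proof.
by move=> c x y; rewrite -[x]lpi_repr -[y]lpi_repr -!lpiZ -!lpiD -lpiZ scalerDr.
Qed.
Fact lscaleDl x : {morph lscale^~ x : c d / c + d}.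
Proof. by move=> c d; rewrite -[x]lpi_repr -!lpiZ -!lpiD scalerDl. Qed.
HB.instance Definition _ := GRing.Zmodule_isLmodule.Build K lquot
  lscaleA lscale1 lscaleDr lscaleDl.

Fact lpi_linear : linear lpi.
Proof. by move=> c x y; rewrite lpiD lpiZ. Qed.
HB.instance Definition _ := GRing.isLinear.Build K U lquot _ lpi lpi_linear.

Definition lsub : Type := {x : U | x \in W}.
HB.instance Definition _ := SubChoice.on lsub.
HB.instance Definition _ := [SubChoice_isSubLmodule of lsub by <:].

End LmoduleQuotient.

Section PropSubspace.
Variables (K : fieldType) (U : lmodType K) (P : U -> Prop).

Definition prop_pred of P 0 & (forall c x y, P x -> P y -> P (c *: x + y)) :
  {pred U} := fun x => `[<P x>].
Fact prop_pred_closed P0 PZD : submod_closed (@prop_pred P0 PZD).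
Proof.
split; first exact/asboolP.
by move=> c x y /asboolP hx /asboolP hy; apply/asboolP; apply: PZD.
Qed.
HB.instance Definition _ P0 PZD :=
  GRing.isSubmodClosed.Build K U (@prop_pred P0 PZD) (prop_pred_closed P0 PZD).
Definition prop_sub P0 PZD : submodClosed U := @prop_pred P0 PZD.
Lemma prop_subP P0 PZD x : reflect (P x) (x \in prop_sub P0 PZD).
Proof. exact/asboolP. Qed.
End PropSubspace.

Definition mdeg (t : nat) := {ffun 'I_t -> int}.
Definition mle t (a b : mdeg t) := [forall i, a i <= b i].

Section ExteriorAlgebra.
Variables (K : fieldType) (t : nat) (n : 'I_t -> nat).

(* The basis of the sum of the V_i: the variable (i, j), j = 0, ..., n_i, lies
   in V_i = K^(n_i + 1). *)
Definition evar : finType := {i : 'I_t & 'I_(n i).+1}.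
Implicit Types (R S Q U : {set evar}).

(* e_R * e_S = (-1)^(swaps R S) e_(R :|: S) if R and S are disjoint, and 0
   otherwise, where e_S is the product of the variables in S in increasing
   order (for enum_rank). *)
Definition swaps R S := (\sum_(r in R) \sum_(s in S) (enum_rank s < enum_rank r))%N.
Definition esign R S : K := (-1) ^+ swaps R S *+ [disjoint R & S].

(* An element is the family of its coordinates on the e_S. *)
Definition ext : Type := {ffun {set evar} -> K^o}.
HB.instance Definition _ := GRing.Lmodule.on ext.
Implicit Types x y z : ext.

Definition ebasis S : ext := [ffun U => (U == S)%:R].
Definition ext_mul x y : ext :=
  [ffun U => \sum_(R : {set evar}) \sum_(S : {set evar} | R :|: S == U)
               esign R S * ((x R : K) * (y S : K))].

(* V_i sits in degree (0, ..., -1, ..., 0). *)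
Definition edeg S : mdeg t := [ffun i => - #|[set v in S | tag v == i]|%:Z].
Definition ehomog (c : mdeg t) x := forall S, x S != 0 -> edeg S = c.

Lemma swaps0l S : swaps set0 S = 0%N.
Proof. by rewrite /swaps big_set0. Qed.
Lemma swaps0r S : swaps S set0 = 0%N.
Proof. by rewrite /swaps big1 // => r _; rewrite big_set0. Qed.
Lemma swapsUl R S U : [disjoint R & S] ->
  swaps (R :|: S) U = (swaps R U + swaps S U)%N.
Proof.
move=> d; rewrite /swaps -bigU //=; apply: eq_bigl => v; by rewrite !inE.
Qed.
Lemma swapsUr R S U : [disjoint S & U] ->
  swaps R (S :|: U) = (swaps R S + swaps R U)%N.
Proof.
move=> d; rewrite /swaps -big_split /=; apply: eq_bigr => r _.
by rewrite -bigU //=; apply: eq_bigl => v; rewrite !inE.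
Qed.

Lemma esign0l S : esign set0 S = 1.
Proof. by rewrite /esign swaps0l disjoints_subset sub0set. Qed.
Lemma esign0r S : esign S set0 = 1.
Proof. by rewrite /esign swaps0r disjoint_sym disjoints_subset sub0set. Qed.
Lemma esign_neq0 R S : (esign R S != 0) = [disjoint R & S].
Proof.
by rewrite /esign; case: [disjoint _ & _]; rewrite ?mulr1n ?signr_eq0 ?mulr0n ?eqxx.
Qed.
Lemma esignA R S U :
  esign R S * esign (R :|: S) U = esign S U * esign R (S :|: U).
Proof.
have dU (A B C : {set evar}) : [disjoint A :|: B & C] = [disjoint A & C] && [disjoint B & C].
  by rewrite -!setI_eq0 setIUl setU_eq0.
have dUr (A B C : {set evar}) : [disjoint A & B :|: C] = [disjoint A & B] && [disjoint A & C].
  by rewrite disjoint_sym dU ![[disjoint _ & A]]disjoint_sym.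
rewrite /esign dU dUr.
have [dRS|_] := boolP [disjoint R & S]; last by rewrite mul0r mulr0.
have [dRU|_] := boolP [disjoint R & U]; last by rewrite !mulr0.
have [dSU|_] := boolP [disjoint S & U]; last by rewrite mul0r mulr0.
rewrite !mulr1n -!exprD swapsUl // swapsUr //; congr (_ ^+ _).
by rewrite addnA addnC.
Qed.

Lemma edegU R S : [disjoint R & S] -> edeg (R :|: S) = edeg R + edeg S.
Proof.
move=> d; apply/ffunP=> i; rewrite !ffunE -opprD -PoszD; congr (- Posz _).
rewrite -cardsUI [X in (_ + X)%N](_ : _ = 0%N) ?addn0.
  by apply: eq_card => v; rewrite !inE andb_orl.
apply: eq_card0 => v; rewrite !inE; apply/negbTE.
by case: (boolP (v \in R)) => //= vR; rewrite (disjointFr d vR) andbF.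
Qed.

Lemma sum_pick (V : nmodType) (A : {set evar}) (F : {set evar} -> V) :
  \sum_Q F Q *+ (A == Q) = F A.
Proof.
rewrite (bigD1 A) //= eqxx mulr1n big1 ?addr0 // => Q.
by rewrite eq_sym => /negbTE ->.
Qed.

Lemma ext_mulE x y U :
  ext_mul x y U = \sum_R \sum_S esign R S * ((x R : K) * (y S : K)) *+ (R :|: S == U).
Proof.
rewrite ffunE; apply: eq_bigr => R _; rewrite big_mkcond; apply: eq_bigr => S _.
by case: (_ == _).
Qed.

Fact ext_mulA : associative ext_mul.
Proof.
move=> x y z; apply/ffunP=> U; rewrite !ext_mulE.
transitivity (\sum_R \sum_S \sum_T
   esign R (S :|: T) * ((x R : K) * (esign S T * ((y S : K) * (z T : K)))) *+ (R :|: (S :|: T) == U)).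
  apply: eq_bigr => R _; transitivity (\sum_Q \sum_S \sum_T
     esign R Q * ((x R : K) * (esign S T * ((y S : K) * (z T : K)))) *+ (R :|: Q == U) *+ (S :|: T == Q)).
    apply: eq_bigr => Q _; rewrite ext_mulE !mulr_sumr -sumrMnl; apply: eq_bigr => S _.
    rewrite !mulr_sumr -sumrMnl; apply: eq_bigr => T _.
    by rewrite !mulrnAr mulrnAC.
  rewrite exchange_big; apply: eq_bigr => S _; rewrite exchange_big.
  by apply: eq_bigr => T _; rewrite sum_pick.
transitivity (\sum_R \sum_S \sum_T
   esign (R :|: S) T * (esign R S * ((x R : K) * (y S : K)) * (z T : K)) *+ (R :|: S :|: T == U)).
  apply: eq_bigr => R _; apply: eq_bigr => S _; apply: eq_bigr => T _.
  rewrite setUA; congr (_ *+ _).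
  have e1 (a b u v w : K) : a * (u * (b * (v * w))) = b * a * (u * v * w) by ring.
  have e2 (a b u v w : K) : a * (b * (u * v) * w) = b * a * (u * v * w) by ring.
  by rewrite e1 e2 esignA.
symmetry; transitivity (\sum_Q \sum_T \sum_R \sum_S
  esign Q T * (esign R S * ((x R : K) * (y S : K)) * (z T : K)) *+ (Q :|: T == U) *+ (R :|: S == Q)).
  apply: eq_bigr => Q _; apply: eq_bigr => T _; rewrite ext_mulE.
  rewrite mulr_suml mulr_sumr -sumrMnl; apply: eq_bigr => R _.
  rewrite mulr_suml mulr_sumr -sumrMnl; apply: eq_bigr => S _.
  by rewrite mulrnAl mulrnAr mulrnAC.
rewrite exchange_big /=; under eq_bigr => T _ do rewrite exchange_big /=.
rewrite exchange_big /=; apply: eq_bigr => R _.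
under eq_bigr => T _ do rewrite exchange_big /=.
rewrite exchange_big /=; apply: eq_bigr => S _; apply: eq_bigr => T _.
by rewrite sum_pick.
Qed.

Fact ext_mul1l : left_id (ebasis set0) ext_mul.
Proof.
move=> x; apply/ffunP=> U; rewrite ext_mulE (bigD1 set0) //= [X in _ + X]big1.
  rewrite addr0 -[RHS](sum_pick U x); apply: eq_bigr => S _.
  by rewrite set0U eq_sym esign0l ffunE eqxx !mul1r.
move=> R nR; apply: big1 => S _.
by rewrite ffunE (negbTE nR) mul0r mulr0 mul0rn.
Qed.

Fact ext_mul1r : right_id (ebasis set0) ext_mul.
Proof.
move=> x; apply/ffunP=> U; rewrite ext_mulE -[RHS](sum_pick U x).
apply: eq_bigr => R _; rewrite (bigD1 set0) //= [X in _ + X]big1.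
  by rewrite addr0 setU0 eq_sym esign0r ffunE eqxx mulr1 mul1r.
by move=> S nS; rewrite ffunE (negbTE nS) mulr0 mulr0 mul0rn.
Qed.

Fact ext_mulDl : left_distributive ext_mul +%R.
Proof.
move=> x y z; apply/ffunP=> U; rewrite [RHS]ffunE !ext_mulE -big_split.
apply: eq_bigr => R _; rewrite -big_split; apply: eq_bigr => S _ /=.
by rewrite ffunE mulrDl mulrDr mulrnDl.
Qed.

Fact ext_mulDr : right_distributive ext_mul +%R.
Proof.
move=> x y z; apply/ffunP=> U; rewrite [RHS]ffunE !ext_mulE -big_split.
apply: eq_bigr => R _; rewrite -big_split; apply: eq_bigr => S _ /=.
by rewrite ffunE mulrDr mulrDr mulrnDl.
Qed.

Fact ext_one_neq0 : ebasis set0 != 0.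
Proof.
by apply/eqP=> /ffunP /(_ set0) /eqP; rewrite !ffunE eqxx oner_eq0.
Qed.

HB.instance Definition _ := GRing.Zmodule_isNzRing.Build ext
  ext_mulA ext_mul1l ext_mul1r ext_mulDl ext_mulDr ext_one_neq0.

Fact ext_scaleAl (c : K) x y : c *: (x * y) = (c *: x) * y.
Proof.
apply/ffunP=> U; rewrite [LHS]ffunE !ext_mulE scaler_sumr.
apply: eq_bigr => R _; rewrite scaler_sumr; apply: eq_bigr => S _.
rewrite -scalerMnr ffunE; congr (_ *+ _).
rewrite -[c *: _]/(c * _ : K) -[c *: x R]/(c * x R : K); ring.
Qed.
Fact ext_scaleAr (c : K) x y : c *: (x * y) = x * (c *: y).
Proof.
apply/ffunP=> U; rewrite [LHS]ffunE !ext_mulE scaler_sumr.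
apply: eq_bigr => R _; rewrite scaler_sumr; apply: eq_bigr => S _.
rewrite -scalerMnr ffunE; congr (_ *+ _).
rewrite -[c *: (_ * _)]/(c * _ : K) -[c *: y S]/(c * y S : K); ring.
Qed.
HB.instance Definition _ := GRing.Lmodule_isLalgebra.Build K ext ext_scaleAl.
HB.instance Definition _ := GRing.Lalgebra_isAlgebra.Build K ext ext_scaleAr.

Lemma ext_oneE R : (1 : ext) R = (R == set0)%:R.
Proof. by rewrite ffunE. Qed.

End ExteriorAlgebra.

Section GradedModules.
Variables (K : fieldType) (t : nat) (n : 'I_t -> nat).
Local Notation E := (ext K n).

(* A Z^t-graded right E-module M, given by its graded components M_b and, for
   b, b' in Z^t, the degree-b' component act M b b' m x of m x, for m in M_b. *)
Record gmod := GMod {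
  gcomp :> mdeg t -> lmodType K;
  act : forall b b', gcomp b -> E -> gcomp b';
  act_linearl : forall b b' x, linear (fun m : gcomp b => act b' m x);
  act_linearr : forall b b' (m : gcomp b), linear (fun x => act b' m x);
  act_degree : forall b b' c (m : gcomp b) x, ehomog c x -> b' != b + c -> act b' m x = 0;
  act_one : forall b (m : gcomp b), act b m 1 = m;
  act_mul : forall b b' b'' (m : gcomp b) x y, ehomog (b' - b) x ->
    act b'' (act b' m x) y = act b'' m (x * y)
}.
Arguments act : clear implicits.

Section ActTheory.
Variables (M : gmod) (b b' : mdeg t).
Lemma act0l x : act M b b' 0 x = 0.
Proof.
have /= h := @act_linearl M b b' x.
by have := h (-1) 0 0; rewrite scaler0 addr0 scaleN1r addNr.
Qed.
Lemma act0r m : act M b b' m 0 = 0.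
Proof.
have /= h := @act_linearr M b b' m.
by have := h (-1) 0 0; rewrite scaler0 addr0 scaleN1r addNr.
Qed.
Lemma actZl c m x : act M b b' (c *: m) x = c *: act M b b' m x.
Proof. by have := @act_linearl M b b' x c m 0; rewrite act0l !addr0. Qed.
Lemma actZr c m x : act M b b' m (c *: x) = c *: act M b b' m x.
Proof. by have := @act_linearr M b b' m c x 0; rewrite act0r !addr0. Qed.
Lemma actDl m m' x : act M b b' (m + m') x = act M b b' m x + act M b b' m' x.
Proof. by have := @act_linearl M b b' x 1 m m'; rewrite !scale1r. Qed.
Lemma actDr m x x' : act M b b' m (x + x') = act M b b' m x + act M b b' m x'.
Proof. by have := @act_linearr M b b' m 1 x x'; rewrite !scale1r. Qed.
End ActTheory.

Record ghom (M N : gmod) := GHom {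
  happ :> forall b, M b -> N b;
  happ_linear : forall b, linear (@happ b);
  happ_act : forall b b' m x, happ (act M b b' m x) = act N b b' (happ m) x
}.
Arguments happ {M N} g b m : rename.
HB.instance Definition _ M N (f : ghom M N) b :=
  GRing.isLinear.Build K (M b) (N b) _ (f b) (@happ_linear M N f b).

Section GhomTheory.
Variables (M N : gmod) (f : ghom M N) (b : mdeg t).
Lemma happ0 : f b 0 = 0. Proof. exact: linear0. Qed.
Lemma happD x y : f b (x + y) = f b x + f b y. Proof. exact: linearD. Qed.
Lemma happB x y : f b (x - y) = f b x - f b y. Proof. exact: linearB. Qed.
Lemma happN x : f b (- x) = - f b x. Proof. exact: linearN. Qed.
Lemma happZ c x : f b (c *: x) = c *: f b x. Proof. exact: linearZ. Qed.
Lemma happ_sum (J : Type) (r : seq J) (P : pred J) (F : J -> M b) :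
  f b (\sum_(j <- r | P j) F j) = \sum_(j <- r | P j) f b (F j).
Proof. exact: linear_sum. Qed.
End GhomTheory.

Definition ghom_comp M N P (g : ghom N P) (f : ghom M N) : ghom M P.
Proof.
exists (fun b m => g b (f b m)).
- by move=> b c x y; rewrite !linearP.
- by move=> b b' m x; rewrite !happ_act.
Defined.

Definition ghomZ M N (c : K) (f : ghom M N) : ghom M N.
Proof.
exists (fun b m => c *: f b m).
- by move=> b d x y; rewrite linearP scalerDr !scalerA mulrC.
- by move=> b b' m x; rewrite happ_act actZl.
Defined.

Definition gprod (M N : gmod) : gmod.
Proof.
exists (fun b => (M b * N b)%type : lmodType K)
  (fun b b' m x => (act M b b' m.1 x, act N b b' m.2 x)).
- by move=> b b' x c m m'; congr pair; rewrite /= actDl actZl.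
- by move=> b b' m c x x'; congr pair; rewrite /= actDr actZr.
- by move=> b b' c m x hx ne; rewrite !(act_degree _ hx).
- by move=> b [m m']; rewrite !act_one.
- by move=> b b' b'' [m m'] x y hx; rewrite /= !act_mul.
Defined.

Definition projective (P : gmod) : Prop :=
  forall (M N : gmod) (f : ghom M N) (g : ghom P N),
    (forall b y, exists x, f b x = y) ->
    exists h : ghom P M, forall b x, f b (h b x) = g b x.

Definition injective_mod (I : gmod) : Prop :=
  forall (M N : gmod) (f : ghom M N) (g : ghom M I),
    (forall b, injective (f b)) ->
    exists h : ghom N I, forall b x, h b (f b x) = g b x.

(* m lies in M E_+, where E_+ is the ideal generated by the V_i. *)
Definition in_radical (M : gmod) (b : mdeg t) (m : M b) : Prop :=
  exists (r : nat) (c : 'I_r -> mdeg t) (u : forall k, M (c k)) (x : 'I_r -> E),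
    (forall k, x k set0 = 0) /\ m = \sum_k act M (c k) b (u k) (x k).

(* The free module sum_a B_a (x) omega_E(-a), with omega_E = Hom_K(E, K). As
   B (x) Hom_K(E, K) = Hom_K(E, B), an element f of degree b amounts to a linear
   map on E, whose value f S on e_S, of degree edeg S, lies in B_(b + edeg S);
   that is, f S is the coefficient in B_a of the dual basis vector e_S^*, which
   has degree b in omega_E(-a) exactly for a = b + edeg S. The action of E is
   (f x)(y) = f(x y). *)
Section FreeModule.
Variable (B : mdeg t -> lmodType K).

Definition free_comp (b : mdeg t) : lmodType K :=
  dprod (fun S : {set evar n} => B (b + edeg S)).
Definition free_act b b' (f : free_comp b) (x : E) : free_comp b' :=
  finfun (fun S : {set evar n} =>
    \sum_(R : {set evar n}) (esign K R S * x R) *: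
      recast B (b + edeg (R :|: S)) (b' + edeg S) (f (R :|: S))).

Lemma free_actE b b' (f : free_comp b) x S : free_act b' f x S =
  \sum_(R : {set evar n}) (esign K R S * x R) *:
      recast B (b + edeg (R :|: S)) (b' + edeg S) (f (R :|: S)).
Proof. by rewrite ffunE. Qed.

Fact free_act_linearl b b' x : linear (fun f : free_comp b => free_act b' f x).
Proof.
move=> c f g; apply: dprodP => S.
rewrite dprodDE dprodZE !free_actE scaler_sumr -big_split; apply: eq_bigr => R _ /=.
by rewrite dprodDE dprodZE linearP scalerDr !scalerA mulrC.
Qed.
Fact free_act_linearr b b' (f : free_comp b) : linear (fun x : E => free_act b' f x).
Proof.
move=> c x y; apply: dprodP => S.
rewrite dprodDE dprodZE !free_actE scaler_sumr -big_split; apply: eq_bigr => R _ /=.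
rewrite !ffunE mulrDr scalerDl !scalerA; congr (_ *: _ + _).
by rewrite -[c *: x R]/(c * x R : K) mulrCA.
Qed.
Fact free_act_degree b b' c (f : free_comp b) x :
  ehomog c x -> b' != b + c -> free_act b' f x = 0.
Proof.
move=> hx ne; apply: dprodP => S; rewrite free_actE dprod0E big1 // => R _.
have [->|nx] := eqVneq (x R) 0; first by rewrite mulr0 scale0r.
have [d|nd] := boolP [disjoint R & S]; last first.
  by rewrite /esign (negbTE nd) mulr0n mul0r scale0r.
rewrite recast_neq ?scaler0 // edegU // (hx _ nx) addrA.
by apply: contra ne => /eqP /addIr ->.
Qed.
Fact free_act_one b (f : free_comp b) : free_act b f 1 = f.
Proof.
apply: dprodP => S; rewrite free_actE (bigD1 set0) //= big1 ?addr0.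
  rewrite ext_oneE eqxx mulr1 esign0l scale1r.
  rewrite (recast_dep (u := fun S => b + edeg S) f _ (set0U S)).
  exact: recast_id.
by move=> R nR; rewrite ext_oneE (negbTE nR) mulr0 scale0r.
Qed.
Fact free_act_mul b b' b'' (f : free_comp b) x y : ehomog (b' - b) x ->
  free_act b'' (free_act b' f x) y = free_act b'' f (x * y).
Proof.
move=> hx; apply: dprodP => S; rewrite !free_actE.
transitivity (\sum_T \sum_R (esign K T S * y T * (esign K R (T :|: S) * x R)) *:
   recast B (b + edeg (R :|: (T :|: S))) (b'' + edeg S) (f (R :|: (T :|: S)))).
  apply: eq_bigr => T _; rewrite free_actE linear_sum scaler_sumr.
  apply: eq_bigr => R _; rewrite linearZ scalerA /=.
  have [->|nx] := eqVneq (x R) 0; first by rewrite !mulr0 !scale0r.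
  have [d|nd] := boolP [disjoint R & T :|: S]; last first.
    by rewrite /esign (negbTE nd) mulr0n mul0r mulr0 !scale0r.
  rewrite recast_recast // edegU // (hx _ nx).
  by rewrite addrCA addrA subrK addrC.
symmetry; transitivity (\sum_U \sum_R \sum_T
    ((esign K U S * (esign K R T * (x R * y T))) *:
      recast B (b + edeg (U :|: S)) (b'' + edeg S) (f (U :|: S))) *+ (R :|: T == U)).
  apply: eq_bigr => U _; rewrite ext_mulE mulr_sumr scaler_suml.
  apply: eq_bigr => R _; rewrite mulr_sumr scaler_suml.
  by apply: eq_bigr => T _; rewrite mulrnAr scalerMnl.
rewrite exchange_big exchange_big /= [RHS]exchange_big /=.
rewrite exchange_big /=; apply: eq_bigr => R _.
rewrite exchange_big /=; apply: eq_bigr => T _; rewrite sum_pick.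
rewrite (recast_dep (u := fun S => b + edeg S) f _ (setUA R T S)).
congr (_ *: _).
have e1 (a c u v : K) : a * (c * (u * v)) = c * a * (u * v) by ring.
have e2 (a c u v : K) : a * v * (c * u) = a * c * (u * v) by ring.
by rewrite e1 [RHS]e2 esignA.
Qed.

Definition freemod : gmod :=
  GMod free_act_linearl free_act_linearr free_act_degree free_act_one free_act_mul.
End FreeModule.

Section FreeMap.
Variables (B B' : mdeg t -> lmodType K) (u : forall a, {linear B a -> B' a}).
Definition free_map : ghom (freemod B) (freemod B').
Proof.
exists (fun b (f : free_comp B b) => finfun (fun S => u _ (f S)) : free_comp B' b).
- by move=> b c f g; apply: dprodP => S; rewrite dprodDE dprodZE !ffunE linearP.
- move=> b b' f x; apply: dprodP => S.
  rewrite [LHS]ffunE /= !free_actE linear_sum; apply: eq_bigr => R _.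
  by rewrite linearZ -recast_map ffunE.
Defined.
Lemma free_mapE b (f : free_comp B b) S : free_map b f S = u _ (f S).
Proof. by rewrite /= ffunE. Qed.
End FreeMap.

Section Support.
Variable B : mdeg t -> lmodType K.

Definition free_single b (S : {set evar n}) (v : B (b + edeg S)) : freemod B b :=
  finfun (fun U => recast (fun V => B (b + edeg V)) S U v).

Lemma free_sum_single b (f : freemod B b) : f = \sum_S free_single (f S).
Proof.
apply: dprodP => U; rewrite dprod_sumE (bigD1 U) //= big1 ?addr0.
  by rewrite ffunE recast_id.
by move=> S nS; rewrite ffunE recast_neq.
Qed.

Lemma act_ebasis b b' (f : freemod B b) (c : K) (R S : {set evar n}) :
  (act (freemod B) b b' f (c *: ebasis K R) : freemod B b') S =
  (esign K R S * c) *: recast B (b + edeg (R :|: S)) (b' + edeg S) (f (R :|: S)).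
Proof.
rewrite free_actE (bigD1 R) //= big1 ?addr0 => [|Q nQ].
  by rewrite !ffunE eqxx -[c *: _]/(c * 1 : K) mulr1.
by rewrite !ffunE (negbTE nQ) -[c *: _]/(c * 0 : K) !mulr0 scale0r.
Qed.

Lemma free_single_act b (S : {set evar n}) (v : B (b + edeg S)) :
  exists b' (g : freemod B b') (c : K),
    free_single v = act (freemod B) b' b g (c *: ebasis K (~: S)).
Proof.
set b' : mdeg t := b - edeg (~: S).
have dS : [disjoint ~: S & S] by rewrite disjoint_sym disjoints_subset setCK.
have eb : b + edeg S = b' + edeg [set: evar n].
  by rewrite -(setUCr S) setUC edegU // /b' addrA subrK.
exists b', (@free_single b' [set: evar n] (recast B _ _ v)), (esign K (~: S) S).
apply: dprodP => U; rewrite act_ebasis !ffunE.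
have [<-|nU] := eqVneq S U.
  rewrite recast_id (recast_dep (u := fun V => b' + edeg V)
    (fun V => recast (fun V => B (b' + edeg V)) [set: evar n] V _) _
    (etrans (setUC _ _) (setUCr S))).
  rewrite recast_id recast_recast // recast_id.
  by rewrite /esign dS mulr1n -expr2 sqrr_sign scale1r.
rewrite recast_neq //; have [d|nd] := boolP [disjoint ~: S & U]; last first.
  by rewrite /esign (negbTE nd) mulr0n mul0r scale0r.
have ne : [set: evar n] != ~: S :|: U.
  apply: contra nU => /eqP e; rewrite eqEsubset; apply/andP; split.
    apply/subsetP => w hw; have : w \in [set: evar n] by [].
    by rewrite e !inE hw.
  by rewrite disjoint_sym disjoints_subset setCK in d.
by rewrite (recast_neq (B := fun V => B (b' + edeg V)) _ ne) linear0 scaler0.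
Qed.
End Support.

(* A morphism of free modules maps the summand B_a (x) omega_E(-a) into the sum
   of the B'_a' (x) omega_E(-a') with a' >= a. *)
Lemma free_hom_support B B' (phi : ghom (freemod B) (freemod B')) b
    (f : freemod B b) (S' : {set evar n}) :
  (forall S : {set evar n}, S' \subset S -> f S = 0) ->
  (phi b f : freemod B' b) S' = 0.
Proof.
move=> hf; rewrite [f]free_sum_single happ_sum dprod_sumE big1 // => S _.
have [sS|nsS] := boolP (S' \subset S).
  rewrite hf //; have -> : free_single (0 : B (b + edeg S)) = 0.
    by apply: dprodP => U; rewrite ffunE dprod0E linear0.
  by rewrite happ0 dprod0E.
have [b' [g [c ->]]] := free_single_act (f S).
rewrite happ_act act_ebasis /esign.
have -> : [disjoint ~: S & S'] = false.
  by rewrite disjoint_sym disjoints_subset setCK (negbTE nsS).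
by rewrite mulr0n mul0r scale0r.
Qed.

End GradedModules.
Arguments act {K t n} M b b' m x : rename.

Section SubQuotientModules.
Variables (K : fieldType) (t : nat) (n : 'I_t -> nat).
Variables (M : gmod K n) (W : forall b, submodClosed (M b)).
Hypothesis W_act : forall b b' m x, m \in W b -> act M b b' m x \in W b'.

Definition gsub : gmod K n.
Proof.
exists (fun b => lsub (W b))
  (fun b b' m x => Sub (act M b b' (val m) x) (W_act b' x (valP m))).
- by move=> b b' x c m m'; apply: val_inj; rewrite /= actDl actZl.
- by move=> b b' m c x x'; apply: val_inj; rewrite /= actDr actZr.
- by move=> b b' c m x hx ne; apply: val_inj; rewrite /= (act_degree _ hx).
- by move=> b m; apply: val_inj; rewrite /= act_one.
- by move=> b b' b'' m x y hx; apply: val_inj; rewrite /= act_mul.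
Defined.

Definition gquo_act b b' (m : lquot (W b)) (x : ext K n) : lquot (W b') :=
  lpi (W b') (act M b b' (repr m) x).
Lemma gquo_actE b b' m x :
  gquo_act b' (lpi (W b) m) x = lpi (W b') (act M b b' m x).
Proof.
apply/lpi_eq; rewrite -scaleN1r -actZl -actDl W_act // scaleN1r.
by apply/lpi_eq; rewrite lpi_repr.
Qed.
Definition gquo : gmod K n.
Proof.
exists (fun b => lquot (W b)) gquo_act.
- move=> b b' x c m m'; rewrite -[m]lpi_repr -[m']lpi_repr -linearP !gquo_actE.
  by rewrite actDl actZl linearP.
- by move=> b b' m c x x'; rewrite /gquo_act actDr actZr linearP.
- by move=> b b' c m x hx ne; rewrite /gquo_act (act_degree _ hx) // linear0.
- by move=> b m; rewrite /gquo_act act_one lpi_repr.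
- by move=> b b' b'' m x y hx; rewrite -[m]lpi_repr !gquo_actE act_mul.
Defined.

Definition gsub_incl : ghom gsub M.
Proof. by exists (fun b (m : lsub (W b)) => val m). Defined.
Definition gquo_proj : ghom M gquo.
Proof.
exists (fun b => lpi (W b)); first by move=> b c x y; rewrite linearP.
by move=> b b' m x; rewrite /= gquo_actE.
Defined.
End SubQuotientModules.

Section Complexes.
Variables (K : fieldType) (t : nat) (n : 'I_t -> nat).

(* The differential is indexed by pairs of degrees, and only its components
   from degree d to degree d + 1 are nonzero. *)
Record cpx := Cpx {
  cterm :> int -> gmod K n;
  cdiff : forall d d', ghom (cterm d) (cterm d');
  cdiff_shape : forall d d' b (x : cterm d b), d' != d + 1 -> cdiff d d' b x = 0;
  cdiff_sq : forall d d' d'' b (x : cterm d b),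
    cdiff d' d'' b (cdiff d d' b x) = 0
}.
Arguments cdiff : clear implicits.

Record cmap (A B : cpx) := CMap {
  cmap_at :> forall d, ghom (A d) (B d);
  cmap_comm : forall d d' b (x : A d b),
    cmap_at d' b (cdiff A d d' b x) = cdiff B d d' b (cmap_at d b x)
}.

Lemma recast_act (A : int -> gmod K n) i j b b' (m : A i b) x :
  recast (fun d => A d b') i j (act (A i) b b' m x) =
  act (A j) b b' (recast (fun d => A d b) i j m) x.
Proof.
have [e|ne] := eqVneq i j; first by case: _ / e; rewrite !recast_id.
by rewrite !recast_neq // act0l.
Qed.

Definition recast_hom (A : int -> gmod K n) i j : ghom (A i) (A j).
Proof.
exists (fun b => recast (fun d => A d b) i j).
- by move=> b c x y; rewrite linearP.
- by move=> b b' m x; rewrite recast_act.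
Defined.

Definition cmap_id A : cmap A A.
Proof.
by exists (fun d => @GHom _ _ _ (A d) (A d) (fun b x => x) (fun _ _ _ _ => erefl)
  (fun _ _ _ _ => erefl)).
Defined.
Definition cmap_comp A B C (g : cmap B C) (f : cmap A B) : cmap A C.
Proof.
exists (fun d => ghom_comp (g d) (f d)).
by move=> d d' b x; rewrite /= !cmap_comm.
Defined.

Definition cpx_iso (A B : cpx) : Prop :=
  exists (f : cmap A B) (g : cmap B A),
    (forall d b x, g d b (f d b x) = x) /\ (forall d b y, f d b (g d b y) = y).

Definition is_cycle (C : cpx) d b (x : C d b) : Prop := cdiff C d (d + 1) b x = 0.
Definition is_boundary (C : cpx) d b (x : C d b) : Prop :=
  exists y : C (d - 1) b, cdiff C (d - 1) d b y = x.
Definition exact_cpx (C : cpx) : Prop :=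
  forall d b (x : C d b), is_cycle x -> is_boundary x.

Definition quasi_iso A B (f : cmap A B) : Prop :=
  forall d b,
    (forall x : A d b, is_cycle x -> is_boundary (f d b x) -> is_boundary x) /\
    (forall y : B d b, is_cycle y ->
       exists x : A d b, is_cycle x /\ is_boundary (y - f d b x)).

Definition bounded_above (C : cpx) : Prop :=
  exists N : int, forall d b (x : C d b), N < d -> x = 0.
Definition bounded_below (C : cpx) : Prop :=
  exists N : int, forall d b (x : C d b), d < N -> x = 0.

Definition finite_dim (U : lmodType K) : Prop :=
  exists s : seq U, forall u, exists c : nat -> K, u = \sum_(i < size s) c i *: s`_i.
Definition locally_finite (C : cpx) : Prop :=
  forall b, (forall d, finite_dim (C d b)) /\
    exists s : seq int, forall d (x : C d b), d \notin s -> x = 0.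

(* C (x)_E K = C / C E_+ has zero differential. *)
Definition minimal (C : cpx) : Prop :=
  forall d d' b (x : C d b), in_radical (cdiff C d d' b x).

(* A resolution of a bounded complex is understood to be bounded on the
   appropriate side: otherwise an exact minimal complex of free modules could
   be added to it. Injective E-modules are free, so that minimality means the
   same for complexes of projectives and of injectives. *)
Definition min_projective_resolution (F C : cpx) (f : cmap F C) : Prop :=
  [/\ forall d, projective (F d), bounded_above F, quasi_iso f & minimal F].
Definition min_injective_resolution (C I : cpx) (f : cmap C I) : Prop :=
  [/\ forall d, injective_mod (I d), bounded_below I, quasi_iso f & minimal I].

Definition is_subquotient (D C : cpx) : Prop :=
  exists (S : cpx) (i : cmap S C) (p : cmap S D),
    (forall d b, injective (i d b)) /\ (forall d b y, exists x, p d b x = y).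

Definition shift (k : int) (C : cpx) : cpx.
Proof.
exists (fun d => C (k + d))
  (fun d d' => ghomZ ((-1) ^+ `|k|) (cdiff C (k + d) (k + d'))).
- move=> d d' b x ne; rewrite /= cdiff_shape ?scaler0 //.
  by apply: contra ne => /eqP; rewrite -addrA => /addrI ->.
- by move=> d d' d'' b x; rewrite /= happZ cdiff_sq !scaler0.
Defined.

Definition shift0 (C : cpx) : cmap (shift 0 C) C.
Proof.
exists (fun d => recast_hom C (0 + d) d) => d d' b x /=.
rewrite expr0 scale1r; have [e|ne] := eqVneq d' (d + 1).
  have h i j (ei : i = d) (ej : j = d') (y : C i b) :
      recast (fun e => C e b) j d' (cdiff C i j b y) =
      cdiff C d d' b (recast (fun e => C e b) i d y).
    by case: _ / (esym ei) y => y; case: _ / (esym ej); rewrite !recast_id.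
  by apply: h; rewrite add0r.
by rewrite !cdiff_shape ?linear0 ?add0r.
Defined.

(* The terms are B^d (+) A^(d + 1), with A^(d + 1) = A[1]^d. *)
Section Cone.
Variables (A B : cpx) (f : cmap A B).
Definition cone_diff d d' :
  ghom (gprod (B d) (shift 1 A d)) (gprod (B d') (shift 1 A d')).
Proof.
exists (fun b x => (cdiff B d d' b x.1 +
                      recast (fun e => B e b) (1 + d) d' (f (1 + d) b x.2),
                    cdiff (shift 1 A) d d' b x.2)).
- move=> b c x y; congr pair; last by rewrite [LHS]linearP.
  by rewrite !linearP /= scalerDr addrACA.
- move=> b b' m x; congr pair; last by rewrite [LHS]happ_act.
  by rewrite actDl !happ_act recast_act.
Defined.

Definition cone : cpx.
Proof.
exists (fun d => gprod (B d) (shift 1 A d)) cone_diff.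
- move=> d d' b [y x] ne; congr pair; rewrite /= ?cdiff_shape ?scaler0 //.
    by rewrite add0r recast_neq // addrC eq_sym.
  by apply: contra ne => /eqP; rewrite -addrA => /addrI ->.
- move=> d d' d'' b [y x]; congr pair; last first.
    by rewrite /= happZ cdiff_sq !scaler0.
  rewrite /= happD cdiff_sq add0r expr1 !scaleN1r !happN linearN /=.
  apply/eqP; rewrite subr_eq0; apply/eqP; rewrite cmap_comm.
  have [e|ne] := eqVneq (1 + d) d'; last first.
    rewrite (recast_neq _ ne) happ0 (@cdiff_shape B) ?linear0 //.
    by rewrite -addrA (inj_eq (addrI _)) addrC eq_sym.
  case: _ / e; rewrite recast_id.
  have [e|ne] := eqVneq (1 + (1 + d)) d''; first by case: _ / e; rewrite recast_id.
  by rewrite (recast_neq _ ne) cdiff_shape // addrC eq_sym.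
Defined.
End Cone.

(* The map from the cone of f to C induced by g, zero on the A-part. *)
Definition cone_desc (A B C : cpx) (f : cmap A B) (g : cmap B C)
    (gf0 : forall d b (x : A d b), g d b (f d b x) = 0) : cmap (cone f) C.
Proof.
unshelve eexists.
  move=> d; exists (fun b (x : cone f d b) => g d b x.1).
  - by move=> b c x y; rewrite linearP.
  - by move=> b b' m x; rewrite happ_act.
move=> d d' b [y x] /=; rewrite happD cmap_comm -(recast_map (fun e => g e b)).
by rewrite /= gf0 linear0 addr0.
Defined.

Section Subcomplexes.
Variable C : cpx.

Record subcpx := SubCpx {
  subcpx_at :> forall d b, submodClosed (C d b);
  subcpx_act : forall d b b' (m : C d b) x,
    m \in subcpx_at d b -> act (C d) b b' m x \in subcpx_at d b';
  subcpx_diff : forall d d' b (m : C d b),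
    m \in subcpx_at d b -> cdiff C d d' b m \in subcpx_at d' b
}.

Variable W : subcpx.

Definition sub_diff d d' :
  ghom (gsub (@subcpx_act W d)) (gsub (@subcpx_act W d')).
Proof.
exists (fun b (m : lsub (W d b)) =>
  (Sub (cdiff C d d' b (val m)) (subcpx_diff d' (valP m)) : lsub (W d' b))).
- by move=> b c x y; apply: val_inj; rewrite /= linearP.
- by move=> b b' m x; apply: val_inj; rewrite /= happ_act.
Defined.
Definition sub_cpx : cpx.
Proof.
exists (fun d => gsub (@subcpx_act W d)) sub_diff.
- by move=> d d' b x ne; apply: val_inj; rewrite /= cdiff_shape.
- by move=> d d' d'' b x; apply: val_inj; rewrite /= cdiff_sq.
Defined.
Definition sub_incl : cmap sub_cpx C.
Proof. by exists (fun d => gsub_incl (@subcpx_act W d)). Defined.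

Definition quo_diff_at d d' b (m : lquot (W d b)) : lquot (W d' b) :=
  lpi (W d' b) (cdiff C d d' b (repr m)).
Lemma quo_diffE d d' b m :
  quo_diff_at d' (lpi (W d b) m) = lpi (W d' b) (cdiff C d d' b m).
Proof.
apply/lpi_eq; rewrite -happB subcpx_diff //.
by apply/lpi_eq; rewrite lpi_repr.
Qed.
Definition quo_diff d d' :
  ghom (gquo (@subcpx_act W d)) (gquo (@subcpx_act W d')).
Proof.
exists (@quo_diff_at d d').
- move=> b c x y; rewrite -[x]lpi_repr -[y]lpi_repr -linearP /= !quo_diffE.
  by rewrite happD happZ linearP.
- move=> b b' m x; rewrite -[m]lpi_repr; move: (repr _) => u /=.
  rewrite quo_diffE (gquo_actE (@subcpx_act W d)) quo_diffE.
  by rewrite (gquo_actE (@subcpx_act W d')) happ_act.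
Defined.
Definition quo_cpx : cpx.
Proof.
exists (fun d => gquo (@subcpx_act W d)) quo_diff.
- by move=> d d' b x ne; rewrite /= /quo_diff_at cdiff_shape // linear0.
- by move=> d d' d'' b x; rewrite -[x]lpi_repr /= !quo_diffE cdiff_sq linear0.
Defined.
Definition quo_proj : cmap C quo_cpx.
Proof.
exists (fun d => gquo_proj (@subcpx_act W d)).
by move=> d d' b x; rewrite /= quo_diffE.
Defined.
Lemma quo_proj_incl d b (x : sub_cpx d b) : quo_proj d b (sub_incl d b x) = 0.
Proof.
rewrite /= -(linear0 (lpi (W d b))); apply/lpi_eq.
by rewrite subr0; apply: valP.
Qed.
End Subcomplexes.

(* The smallest subcomplex containing the elements satisfying G. *)
Section Generated.
Variables (C : cpx) (G : forall d b, C d b -> Prop).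
Definition in_generated d b (y : C d b) : Prop :=
  forall W : subcpx C, (forall d b (x : C d b), G x -> x \in W d b) -> y \in W d b.
Fact in_generated0 d b : in_generated (0 : C d b).
Proof. by move=> W _; rewrite rpred0. Qed.
Fact in_generatedP d b (c : K) (x y : C d b) :
  in_generated x -> in_generated y -> in_generated (c *: x + y).
Proof. by move=> hx hy W hW; rewrite rpredD ?rpredZ ?hx ?hy. Qed.
Definition generated : subcpx C.
Proof.
exists (fun d b => prop_sub (@in_generated0 d b) (@in_generatedP d b)).
- move=> d b b' m x /asboolP hm; apply/asboolP => W hW.
  by apply: subcpx_act; apply: hm.
- move=> d d' b m /asboolP hm; apply/asboolP => W hW.
  by apply: subcpx_diff; apply: hm.
Defined.
End Generated.

End Complexes.
Arguments cdiff {K t n} c d d' : rename.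
Arguments generated {K t n} C G.

Section FreeComplexes.
Variables (K : fieldType) (t : nat) (n : 'I_t -> nat).

(* A complex T with T^d = sum_a B_a^d (x) omega_E(-a), where B_a^d = fgen d a. *)
Record fcpx := FCpx {
  fgen : int -> mdeg t -> lmodType K;
  fdiff : forall d d', ghom (freemod n (fgen d)) (freemod n (fgen d'));
  fdiff_shape : forall d d' b (x : freemod n (fgen d) b),
    d' != d + 1 -> fdiff d d' b x = 0;
  fdiff_sq : forall d d' d'' b (x : freemod n (fgen d) b),
    fdiff d' d'' b (fdiff d d' b x) = 0
}.
Definition cpx_of_fcpx (T : fcpx) : cpx K n := Cpx (@fdiff_shape T) (@fdiff_sq T).
Coercion cpx_of_fcpx : fcpx >-> cpx.

(* Keeping only the generators of degree in R: 'I_(R a) has one element if R a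
   holds and none otherwise, so that B_a is kept or replaced by 0. *)
Section Restriction.
Variables (B : mdeg t -> lmodType K) (R : pred (mdeg t)).
Definition restr (a : mdeg t) : lmodType K := {ffun 'I_(R a) -> B a}.

Definition to_restr a (v : B a) : restr a := [ffun=> v].
Definition of_restr a (w : restr a) : B a := \sum_i w i.

Fact to_restr_linear a : linear (@to_restr a).
Proof. by move=> c u v; apply/ffunP=> i; rewrite !ffunE. Qed.
Fact of_restr_linear a : linear (@of_restr a).
Proof.
move=> c u v; rewrite /of_restr scaler_sumr -big_split.
by apply: eq_bigr => i _; rewrite !ffunE.
Qed.
HB.instance Definition _ a :=
  GRing.isLinear.Build K (B a) (restr a) _ (@to_restr a) (@to_restr_linear a).
HB.instance Definition _ a :=
  GRing.isLinear.Build K (restr a) (B a) _ (@of_restr a) (@of_restr_linear a).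

Lemma of_to_restr a (v : B a) : of_restr (to_restr v) = v *+ R a.
Proof.
rewrite /of_restr; under eq_bigr do rewrite ffunE.
by rewrite sumr_const card_ord.
Qed.
Lemma to_of_restr a (w : restr a) : to_restr (of_restr w) = w.
Proof.
apply/ffunP=> i; rewrite ffunE /of_restr (bigD1 i) //= big1 ?addr0 // => j.
suff -> : j = i by rewrite eqxx.
by apply: val_inj; case: i j => i hi [j hj] /=; case: (R a) hi hj; case: i => //; case: j.
Qed.
Lemma restr_eq0 a (w : restr a) : ~~ R a -> w = 0.
Proof.
move=> nR; apply/ffunP=> -[i hi].
by exfalso; move: hi; rewrite (negbTE nR).
Qed.

Definition restr_proj : ghom (freemod n B) (freemod n restr) :=
  free_map n (fun a => @to_restr a).
Definition restr_incl : ghom (freemod n restr) (freemod n B) :=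
  free_map n (fun a => @of_restr a).
End Restriction.

Definition convex (R : pred (mdeg t)) : Prop :=
  forall a e c, mle a e -> mle e c -> R a -> R c -> R e.

Lemma edeg_mle (b : mdeg t) (S S' : {set evar n}) :
  S' \subset S -> mle (b + edeg S) (b + edeg S').
Proof.
move=> sS; apply/forallP => i; rewrite !ffunE lerD2l lerN2 lez_nat.
apply: subset_leq_card; apply/subsetP => v; rewrite !inE => /andP[vS ->].
by rewrite (subsetP sS).
Qed.

Lemma ghom_compE (M N P : gmod K n) (g : ghom N P) (f : ghom M N) b m :
  ghom_comp g f b m = g b (f b m).
Proof. by []. Qed.

(* The summands with degree in a convex set R form a subquotient of T. *)
Section Subquotient.
Variable T : fcpx.

Definition subq_diff (R R' : pred (mdeg t)) d d' :
    ghom (freemod n (restr (fgen T d) R)) (freemod n (restr (fgen T d') R')) :=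
  ghom_comp (restr_proj _ R') (ghom_comp (fdiff T d d') (restr_incl _ R)).

Lemma subq_diff_shape R R' d d' b x : d' != d + 1 -> subq_diff R R' d d' b x = 0.
Proof. by move=> ne; rewrite /subq_diff !ghom_compE fdiff_shape // happ0. Qed.

Lemma restr_incl_proj (B : mdeg t -> lmodType K) R b (f : freemod n B b) S :
  (restr_incl B R b (restr_proj B R b f) : freemod n B b) S =
  (f : freemod n B b) S *+ R (b + edeg S).
Proof. by rewrite !free_mapE /= of_to_restr. Qed.

Lemma restr_incl_proj_add (B : mdeg t -> lmodType K) (R R1 R2 : pred (mdeg t)) b
    (f : freemod n B b) : (forall a, R a = R1 a + R2 a :> nat)%N ->
  restr_incl B R b (restr_proj B R b f) =
  restr_incl B R1 b (restr_proj B R1 b f) + restr_incl B R2 b (restr_proj B R2 b f).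
Proof.
move=> hR; apply: dprodP => S; rewrite dprodDE !restr_incl_proj.
by rewrite hR mulrnDr.
Qed.

Lemma restr_incl_eq0 (B : mdeg t -> lmodType K) R b (f : freemod n (restr B R) b) S :
  ~~ R (b + edeg S) -> (restr_incl B R b f : freemod n B b) S = 0.
Proof.
move=> nR; rewrite free_mapE; have -> : f S = 0 by exact: restr_eq0.
by rewrite linear0.
Qed.

Lemma subq_diff_sq (R R1 R2 : pred (mdeg t)) d d' d'' b x : convex R ->
  (forall a, R1 a -> R a) -> (forall a, R2 a -> R a) ->
  subq_diff R R2 d' d'' b (subq_diff R1 R d d' b x) = 0.
Proof.
move=> cR s1 s2; rewrite /subq_diff !ghom_compE.
set f := restr_incl _ _ _ x; set g := fdiff T d d' b f.
apply: dprodP => S'; rewrite dprod0E.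
have [R2S'|nR] := boolP (R2 (b + edeg S')); last exact: restr_eq0.
rewrite free_mapE -[X in fdiff T d' d'' b X](subrK g) happD fdiff_sq addr0.
rewrite free_hom_support ?linear0 // => S sS'.
rewrite dprodDE restr_incl_proj -[- g]scaleN1r dprodZE scaleN1r.
have [_|nRS] := boolP (R _); first by rewrite mulr1n subrr.
rewrite mulr0n sub0r; apply/eqP; rewrite oppr_eq0; apply/eqP.
apply: free_hom_support => S'' sS; apply: restr_incl_eq0.
apply: contra nRS => R1S''; apply: cR (s1 _ R1S'') (s2 _ R2S'); exact: edeg_mle.
Qed.

Definition subq (R : pred (mdeg t)) (cR : convex R) : fcpx.
Proof.
exists (fun d => restr (fgen T d) R) (subq_diff R R).
- exact: subq_diff_shape.
- by move=> d d' d'' b x; apply: subq_diff_sq cR _ _.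
Defined.
End Subquotient.

Definition region (c : mdeg t) (I' J L : {set 'I_t}) : pred (mdeg t) :=
  fun a => [forall i, [&& (i \in I') ==> (a i < c i), (i \in J) ==> (a i == c i)
                        & (i \in L) ==> (c i <= a i)]].
Lemma region_convex c I' J L : convex (region c I' J L).
Proof.
move=> a e c' /forallP ae /forallP ec /forallP ha /forallP hc; apply/forallP => i.
move: (ae i) (ec i) (ha i) (hc i) => aei eci /and3P[a1 a2 a3] /and3P[c1 c2 c3].
apply/and3P; split; apply/implyP => hi; move: hi.
- by move=> /(implyP c1); apply: le_lt_trans.
- move=> hi; rewrite eq_le -{1}(eqP (implyP c2 hi)) -{1}(eqP (implyP a2 hi)).
  by rewrite eci aei.
- by move=> /(implyP a3) h; apply: le_trans aei.
Qed.
Definition Tc (T : fcpx) c I' J L : fcpx := subq T (@region_convex c I' J L).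

Definition strand (T : fcpx) (c : mdeg t) (J : {set 'I_t}) : fcpx :=
  Tc T c set0 J set0.

Definition tate_resolution (T : fcpx) : Prop :=
  locally_finite T /\
  forall (c : mdeg t) (J : {set 'I_t}), J \proper [set: 'I_t] -> exact_cpx (strand T c J).

Definition window : pred (mdeg t) :=
  fun a => [forall i, (- (n i)%:Z <= a i) && (a i <= 0)].
Lemma window_convex : convex window.
Proof.
move=> a e c /forallP ae /forallP ec /forallP ha /forallP hc; apply/forallP => i.
have /andP[h1 _] := ha i; have /andP[_ h2] := hc i.
by rewrite (le_trans h1 (ae i)) (le_trans (ec i) h2).
Qed.
Definition BW (T : fcpx) : fcpx := subq T window_convex.

Definition ones : mdeg t := [ffun=> 1].

(* P(BW): every element of BW^d_b is homogeneous of degree b. *)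
Definition PBW (T : fcpx) : subcpx (BW T) :=
  generated (BW T) (fun d b (_ : BW T d b) => ~~ mle ones b).

Section BeilinsonCone.
Variables (T : fcpx) (F I : cpx K n).
Variables (f : cmap F (sub_cpx (PBW T))) (j : cmap (quo_cpx (PBW T)) I).
Definition F_to_BW : cmap F (BW T) := cmap_comp (sub_incl (PBW T)) f.
Definition BW_to_I : cmap (BW T) I := cmap_comp j (quo_proj (PBW T)).
Lemma BW_to_I_F d b (x : F d b) : BW_to_I d b (F_to_BW d b x) = 0.
Proof.
rewrite -[LHS]/(j d b (quo_proj (PBW T) d b (sub_incl (PBW T) d b (f d b x)))).
by rewrite quo_proj_incl happ0.
Qed.
(* [[F -> BW] -> I] *)
Definition beilinson_cone : cpx K n := cone (cone_desc BW_to_I_F).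
End BeilinsonCone.

Section Corner.
Variables (T : fcpx) (c : mdeg t).

Definition below (k : nat) : {set 'I_t} := [set i : 'I_t | (i < k)%N].

(* qT_(c, {1, ..., k}), which is T_(< c) for k = t and T_(>= c) for k = 0. *)
Definition qT (k : nat) : fcpx := Tc T c (below k) set0 (~: below k).

(* qT_(c, {1, ..., k + 1})[- (k + 1)] -> qT_(c, {1, ..., k})[- k], given by the
   differential of T_c({1, ..., k}, 0, {k + 2, ..., t}), that is, by the
   component of the differential of T between the two sets of summands. *)
Definition corner_step_at (k : nat) (d : int) :
    ghom (shift (- k.+1%:Z) (qT k.+1) d) (shift (- k%:Z) (qT k) d) :=
  subq_diff T (region c (below k.+1) set0 (~: below k.+1))
    (region c (below k) set0 (~: below k)) (- k.+1%:Z + d) (- k%:Z + d).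

Lemma region_step (k : nat) a : (k < t)%N ->
  (region c (below k) set0 (~: below k.+1) a =
   region c (below k.+1) set0 (~: below k.+1) a +
   region c (below k) set0 (~: below k) a :> nat)%N.
Proof.
move=> hk; pose i0 := Ordinal hk.
have splitL (I' L : {set 'I_t}) i :
    region c (i |: I') set0 L a = (a i < c i) && region c I' set0 L a.
  apply/forallP/andP=> [h|[h0 /forallP h] j].
    split; first by have := h i; rewrite !inE eqxx => /and3P[].
    apply/forallP => j; have /and3P[/implyP h1 h2 h3] := h j.
    by apply/and3P; split=> //; apply/implyP => hj; apply: h1; rewrite !inE hj orbT.
  have /and3P[/implyP h1 h2 h3] := h j; apply/and3P; split=> //; apply/implyP.
  by rewrite !inE => /orP[/eqP -> //|]; apply: h1.
have splitR (I' L : {set 'I_t}) i :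
    region c I' set0 (i |: L) a = (c i <= a i) && region c I' set0 L a.
  apply/forallP/andP=> [h|[h0 /forallP h] j].
    split; first by have := h i; rewrite !inE eqxx => /and3P[].
    apply/forallP => j; have /and3P[h1 h2 /implyP h3] := h j.
    by apply/and3P; split=> //; apply/implyP => hj; apply: h3; rewrite !inE hj orbT.
  have /and3P[h1 h2 /implyP h3] := h j; apply/and3P; split=> //; apply/implyP.
  by rewrite !inE => /orP[/eqP -> //|]; apply: h3.
have -> : below k.+1 = i0 |: below k.
  by apply/setP => i; rewrite !inE ltnS leq_eqVlt -val_eqE.
have -> : ~: below k = i0 |: ~: (i0 |: below k).
  apply/setP => i; rewrite !inE -val_eqE negb_or /=.
  by case: (ltngtP i k).
rewrite splitL splitR ltNge.
by case: (_ <= _) => /=; rewrite ?addn0.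
Qed.

Lemma region_stepl k a : region c (below k.+1) set0 (~: below k.+1) a ->
  region c (below k) set0 (~: below k.+1) a.
Proof.
move=> /forallP h; apply/forallP => i; have /and3P[h1 h2 h3] := h i.
apply/and3P; split=> //; apply/implyP => hi; apply: (implyP h1).
by move: hi; rewrite !inE => /ltnW.
Qed.
Lemma region_stepr k a : region c (below k) set0 (~: below k) a ->
  region c (below k) set0 (~: below k.+1) a.
Proof.
move=> /forallP h; apply/forallP => i; have /and3P[h1 h2 h3] := h i.
apply/and3P; split=> //; apply/implyP => hi; apply: (implyP h3).
by move: hi; rewrite !inE -!leqNgt => /ltnW.
Qed.

Lemma corner_step_sq k d d' d'' b x : (k < t)%N ->
  let R := region c (below k) set0 (~: below k) in
  let R' := region c (below k.+1) set0 (~: below k.+1) in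
  subq_diff T R' R d' d'' b (subq_diff T R' R' d d' b x) =
  - subq_diff T R R d' d'' b (subq_diff T R' R d d' b x).
Proof.
move=> hk R R'; apply/eqP; rewrite -addr_eq0; apply/eqP.
have := subq_diff_sq d' d'' x (@region_convex c (below k) set0 (~: below k.+1))
  (@region_stepl k) (@region_stepr k).
rewrite /subq_diff !ghom_compE => <-.
by rewrite (restr_incl_proj_add _ (fun a => region_step a hk)) !happD.
Qed.

Definition corner_step (k : nat) (hk : (k < t)%N) :
  cmap (shift (- k.+1%:Z) (qT k.+1)) (shift (- k%:Z) (qT k)).
Proof.
exists (corner_step_at k) => d d' b x.
pose R j := region c (below j) set0 (~: below j).
rewrite -[LHS]/(subq_diff T (R k.+1) (R k) (- k.+1%:Z + d') (- k%:Z + d') b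
  ((-1) ^+ `|- k.+1%:Z|%N *:
     subq_diff T (R k.+1) (R k.+1) (- k.+1%:Z + d) (- k.+1%:Z + d') b x)).
rewrite -[RHS]/((-1) ^+ `|- k%:Z|%N *:
  subq_diff T (R k) (R k) (- k%:Z + d) (- k%:Z + d') b
     (subq_diff T (R k.+1) (R k) (- k.+1%:Z + d) (- k%:Z + d) b x)).
rewrite !abszN !absz_nat happZ exprS -scalerA scaleN1r.
have [e|ne] := eqVneq d' (d + 1).
  have -> : - k.+1%:Z + d' = - k%:Z + d by rewrite e intS opprD; ring.
  by rewrite corner_step_sq // scalerN opprK.
rewrite [subq_diff T (R k.+1) (R k.+1) _ _ _ _]subq_diff_shape; last first.
  by apply: contra ne; rewrite -addrA => /eqP /addrI ->.
rewrite [subq_diff T (R k) (R k) _ _ _ _]subq_diff_shape; last first.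
  by apply: contra ne; rewrite -addrA => /eqP /addrI ->.
by rewrite happ0 !scaler0 oppr0.
Defined.

Fixpoint corner_comp (k : nat) : (k <= t)%N -> cmap (shift (- k%:Z) (qT k)) (qT 0) :=
  match k with
  | 0 => fun _ => shift0 (qT 0)
  | k'.+1 => fun hk => cmap_comp (corner_comp (ltnW hk)) (corner_step hk)
  end.

Definition corner_map : cmap (shift (- t%:Z) (qT t)) (qT 0) := corner_comp (leqnn t).

Definition corner_cpx : cpx K n := cone corner_map.
End Corner.
End FreeComplexes.

(* Main.v *)
(* Write X for the part of T in degrees a < 1^t and Y for the part in degrees
   a >= 1^t.  Each step of the corner map is the connecting morphism of a split
   exact sequence whose middle term leaves one coordinate free; exactness of the
   strands makes that middle term exact, so the corner map X -> Y[t] is a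
   quasi-isomorphism.

   The multidegree of an element separates the pieces.  P(BW) is the part of BW
   in degrees not >= 1^t; Y lives in degrees >= 1^t; and X is BW together with
   the summands of degree not >= -n, which live in degrees not >= 1^t.  In the
   degrees not >= 1^t the quasi-isomorphism says that X is exact, so the summands
   outside the window, shifted by -1, are a projective resolution of P(BW); in the
   degrees >= 1^t it says that Y[t] is an injective resolution of BW/P(BW).  Both
   are minimal because T is, and minimality also bounds them: a generator too far
   out in cohomological degree would start an infinite chain of generators whose
   degrees are strictly monotone but bounded.

   A minimal resolution is unique up to an isomorphism that is compatible with
   the augmentation up to homotopy, and such homotopies are absorbed in the
   iterated cone. *)
Require Import Defs.
From HB Require Import structures.
From mathcomp Require Import all_boot all_order all_algebra.
From mathcomp Require Import boolp ring zify.
From mathcomp Require classical_sets.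

Set Implicit Arguments.
Unset Strict Implicit.
Unset Printing Implicit Defensive.

Import Order.TTheory GRing.Theory Num.Theory.
Local Open Scope ring_scope.

(** Slicing a region by the values of a coordinate gives an infinite filtration in general. In one
    fixed multidegree [b], however, only the summands of degree [b + edeg S] contribute, and these
    are finite in number. Exactness is therefore stated one multidegree at a time ([region_exact]),
    which is also what allows a complex to be exact in some multidegrees only.

    The regions of [T] can serve on both sides because the free module Hom_K(E, B) is coinduced,
    hence injective, and is also generated freely by its top coordinates, hence projective. Both
    facts rest on splitting linear maps between spaces of arbitrary dimension, which takes Zorn's
    lemma.

    A shift turns equal cohomological degrees into expressions that are only provably equal. Many
    statements thus give each occurrence of a degree its own variable and tie the variables together
    by equations. *)

Lemma dependent_recursion (I : Type) (X : I -> Type) (x0 : forall d, X d)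
    (p : I -> I) (k : I -> nat) (next : forall d, X (p d) -> X d) :
  exists x : forall d, X d, forall d, k d = (k (p d)).+1 -> x d = next d (x (p d)).
Proof.
(* The recursion runs on the fuel [m]. Started with [k d], it keeps step with [p] wherever [k] drops
   by exactly one. It serves to recurse over integer degrees from the bounded end of a complex. *)
pose S := fix S m : forall d, X d :=
  if m is m'.+1 then fun d => next d (S m' (p d)) else x0.
by exists (fun d => S (k d) d) => d ->.
Qed.

(** * Graded homomorphisms; lifting and extension along arbitrary maps *)

Section GradedHoms.
Variables (K : fieldType) (t : nat) (n : 'I_t -> nat).
Implicit Types (M N P : gmod K n).

Definition ghom_id M : ghom M M.
Proof. by exists (fun b m => m). Defined.

Definition ghom_zero M N : ghom M N.
Proof.
exists (fun b _ => 0); first by move=> b c x y; rewrite scaler0 addr0.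
by move=> b b' m x; rewrite act0l.
Defined.

Definition ghom_add M N (f g : ghom M N) : ghom M N.
Proof.
exists (fun b m => f b m + g b m).
- by move=> b c x y; rewrite !linearP scalerDr addrACA.
- by move=> b b' m x; rewrite !happ_act actDl.
Defined.

Definition ghom_sub M N (f g : ghom M N) : ghom M N :=
  ghom_add f (ghomZ (-1) g).

Lemma ghom_subE M N (f g : ghom M N) b m : ghom_sub f g b m = f b m - g b m.
Proof. by rewrite /= scaleN1r. Qed.

Definition ghom_fst M N : ghom (gprod M N) M.
Proof. by exists (fun b m => m.1). Defined.
Definition ghom_snd M N : ghom (gprod M N) N.
Proof. by exists (fun b m => m.2). Defined.

Definition ghom_pair P M N (f : ghom P M) (g : ghom P N) : ghom P (gprod M N).
Proof.
exists (fun b m => (f b m, g b m)).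
- by move=> b c x y; congr pair; rewrite linearP.
- by move=> b b' m x; congr pair; rewrite happ_act.
Defined.

Definition ghom_copair P M N (f : ghom M P) (g : ghom N P) : ghom (gprod M N) P :=
  ghom_add (ghom_comp f (ghom_fst M N)) (ghom_comp g (ghom_snd M N)).

(** Surjectivity is gained by corestricting [f] to its image, through which [u] factors by
    hypothesis. *)
Lemma projective_lift P M N (f : ghom M N) (u : ghom P N) : projective P ->
  (forall b x, exists m, f b m = u b x) ->
  exists h : ghom P M, forall b x, f b (h b x) = u b x.
Proof.
move=> prP hu.
pose Q b (y : N b) := exists m, f b m = y.
have Q0 b : Q b 0 by exists 0; rewrite happ0.
have QP b (c : K) x y : Q b x -> Q b y -> Q b (c *: x + y).
  by move=> [m <-] [m' <-]; exists (c *: m + m'); rewrite linearP.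
pose W b := prop_sub (Q0 b) (@QP b).
have Wact b b' m x : m \in W b -> act N b b' m x \in W b'.
  move=> /prop_subP[m' <-]; apply/prop_subP; exists (act M b b' m' x).
  exact: happ_act.
have hf b m : f b m \in W b by apply/prop_subP; exists m.
have hu' b m : u b m \in W b by apply/prop_subP; exact: hu.
unshelve epose (f' := GHom (M := M) (N := gsub Wact)
  (happ := fun b m => Sub (f b m) (hf b m)) _ _).
- by move=> b c x y; apply: val_inj; rewrite /= linearP.
- by move=> b b' m x; apply: val_inj; rewrite /= happ_act.
unshelve epose (u' := GHom (M := P) (N := gsub Wact)
  (happ := fun b m => Sub (u b m) (hu' b m)) _ _).
- by move=> b c x y; apply: val_inj; rewrite /= linearP.
- by move=> b b' m x; apply: val_inj; rewrite /= happ_act.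
have [|h hh] := prP _ _ f' u'.
  by move=> b [y hy]; have /prop_subP[m hm] := hy; exists m; apply: val_inj.
by exists h => b x; have := congr1 val (hh b x).
Qed.

(** Injectivity is gained by dividing out the kernel of [f], on which [u] vanishes by hypothesis. *)
Lemma injective_extend P M N (f : ghom M N) (u : ghom M P) : injective_mod P ->
  (forall b m, f b m = 0 -> u b m = 0) ->
  exists h : ghom N P, forall b m, h b (f b m) = u b m.
Proof.
move=> inP hu.
pose Q b (m : M b) := f b m = 0.
have Q0 b : Q b 0 by exact: happ0.
have QP b (c : K) x y : Q b x -> Q b y -> Q b (c *: x + y).
  by rewrite /Q happD happZ => -> ->; rewrite scaler0 addr0.
pose W b := prop_sub (Q0 b) (@QP b).
have Wact b b' m x : m \in W b -> act M b b' m x \in W b'.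
  by move=> /prop_subP hm; apply/prop_subP; rewrite /Q happ_act hm act0l.
pose bar (L : gmod K n) (g : ghom M L) b (m : lquot (W b)) : L b :=
  g b (repr (m : ring_quotient.Quotient.quot (subgroup_of (W b)))).
have barE (L : gmod K n) (g : ghom M L) : (forall b m, f b m = 0 -> g b m = 0) ->
    forall b m, bar L g b (lpi (W b) m) = g b m.
  move=> hg b m; apply/eqP; rewrite -subr_eq0 -happB; apply/eqP/hg.
  by apply/(prop_subP (Q0 b) (@QP b))/lpi_eq; rewrite lpi_repr.
have barL (L : gmod K n) (g : ghom M L) : (forall b m, f b m = 0 -> g b m = 0) ->
    exists g' : ghom (gquo Wact) L, forall b m, g' b (lpi (W b) m) = g b m.
  move=> hg; unshelve eexists (GHom (M := gquo Wact) (N := L) (happ := bar L g) _ _).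
  - move=> b c x y; rewrite -[x]lpi_repr -[y]lpi_repr -linearP !barE //.
    by rewrite linearP.
  - move=> b b' m x; rewrite -[m]lpi_repr; move: (repr _) => m'.
    by rewrite [act _ _ _ _ _](gquo_actE Wact) !barE // happ_act.
  - by move=> b m; exact: barE.
have [//|f' hf'] := barL _ f _.
have [//|u' hu'] := barL _ u _.
have [|h hh] := inP _ _ f' u'.
  move=> b x y; rewrite -[x]lpi_repr -[y]lpi_repr !hf' => e; apply/lpi_eq.
  by apply/(prop_subP (Q0 b) (@QP b)); rewrite /Q happB e subrr.
by exists h => b m; rewrite -hf' hh hu'.
Qed.
End GradedHoms.

(** * One degree of a lift or an extension along a quasi-isomorphism *)

Section LiftingSteps.
Variables (K : fieldType) (t : nat) (n : 'I_t -> nat).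
Local Notation cpx := (cpx K n).
Implicit Types (A B C F I : cpx).

Lemma is_boundaryP C d0 d b (x : C d b) : d = d0 + 1 ->
  is_boundary x <-> exists y : C d0 b, cdiff C d0 d b y = x.
Proof.
move=> e; have {e}-> : d0 = d - 1 by rewrite e addrK.
by split=> -[y hy]; exists y.
Qed.

Lemma is_cycleP C d d1 b (x : C d b) : d1 = d + 1 ->
  is_cycle x <-> cdiff C d d1 b x = 0.
Proof. by move=> ->. Qed.

Lemma is_boundaryD C d b (x y : C d b) :
  is_boundary x -> is_boundary y -> is_boundary (x + y).
Proof. by move=> [u <-] [v <-]; exists (u + v); rewrite happD. Qed.

Lemma is_boundaryN C d b (x : C d b) : is_boundary x -> is_boundary (- x).
Proof. by move=> [u <-]; exists (- u); rewrite happN. Qed.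

Lemma is_boundary_map A B (f : cmap A B) d b (x : A d b) :
  is_boundary x -> is_boundary (f d b x).
Proof. by move=> [u <-]; exists (f (d - 1) b u); rewrite cmap_comm. Qed.

Lemma is_cycle_map A B (f : cmap A B) d b (x : A d b) : is_cycle x -> is_cycle (f d b x).
Proof. by rewrite /is_cycle -cmap_comm => ->; rewrite happ0. Qed.

(** Like [cdiff], [h] has a component for every pair of degrees, which avoids transports; only the
    components of degree -1 enter. *)
Definition homotopy A B (f g : cmap A B) (h : forall d d', ghom (A d) (B d')) : Prop :=
  forall d b x, g d b x - f d b x =
    cdiff B (d - 1) d b (h d (d - 1) b x) + h (d + 1) d b (cdiff A d (d + 1) b x).

(** The value [s] of the lift and the homotopy [h] form a single lift of [(u, v)] through [phi],
    which is up to signs the differential of the cone of [f]. That cone is exact, and the hypotheses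
    say that [(u, v)] takes values in its cycles. *)
Lemma lift_step A C (f : cmap A C) (P : gmod K n) d d1
    (u : ghom P (A d1)) (v : ghom P (C d)) : quasi_iso f -> projective P -> d1 = d + 1 ->
  (forall b x, is_cycle (u b x)) ->
  (forall b x, cdiff C d d1 b (v b x) = f d1 b (u b x)) ->
  exists (s : ghom P (A d)) (h : ghom P (C (d - 1))),
    (forall b x, cdiff A d d1 b (s b x) = u b x) /\
    (forall b x, f d b (s b x) + cdiff C (d - 1) d b (h b x) = v b x).
Proof.
move=> qf prP ed cu duv.
pose phi : ghom (gprod (A d) (C (d - 1))) (gprod (A d1) (C d)) :=
  ghom_pair (ghom_comp (cdiff A d d1) (ghom_fst _ _))
            (ghom_copair (f d) (cdiff C (d - 1) d)).
have [|h hh] := projective_lift (f := phi) (u := ghom_pair u v) prP.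
  move=> b x.
  have /(is_boundaryP (u b x) ed)[y hy] : is_boundary (u b x).
    apply: (proj1 (qf d1 b)) => //; apply/(is_boundaryP _ ed).
    by exists (v b x).
  (* Changing [y] by a cycle [z] keeps its differential; surjectivity on cohomology gives a [z] for
     which [v b x - f (y + z)] is a boundary. *)
  have [|z [cz [e he]]] := proj2 (qf d b) (v b x - f d b y).
    by apply/(is_cycleP _ ed); rewrite happB duv -cmap_comm hy subrr.
  exists (y + z, e); congr pair; rewrite /= happD.
    by rewrite hy (proj1 (is_cycleP z ed)) // addr0.
  by rewrite he -[v b x - _ - _]addrA -opprD addrC addNKr.
exists (ghom_comp (ghom_fst _ _) h), (ghom_comp (ghom_snd _ _) h).
by split=> b x; have /(congr1 fst) := hh b x; have /(congr1 snd) := hh b x.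
Qed.

(** Dual to [lift_step]: the pair [(u, v)] extends along the cone differential [phi] because it
    vanishes on the kernel of [phi]. *)
Lemma extend_step A C (f : cmap C A) (J : gmod K n) d0 d
    (u : ghom (A d0) J) (v : ghom (C d) J) : quasi_iso f -> injective_mod J -> d = d0 + 1 ->
  (forall b x, is_boundary x -> u b x = 0) ->
  (forall b x, v b (cdiff C d0 d b x) = u b (f d0 b x)) ->
  exists (s : ghom (A d) J) (h : ghom (C (d + 1)) J),
    (forall b x, s b (cdiff A d0 d b x) = u b x) /\
    (forall b x, s b (f d b x) + h b (cdiff C d (d + 1) b x) = v b x).
Proof.
move=> qf inJ ed cu duv.
pose phi : ghom (gprod (A d0) (C d)) (gprod (A d) (C (d + 1))) :=
  ghom_pair (ghom_copair (cdiff A d0 d) (f d))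
            (ghom_comp (cdiff C d (d + 1)) (ghom_snd _ _)).
have [|h hh] := injective_extend (f := phi) (u := ghom_copair u v) inJ.
  move=> b [y c] e; have /= e1 := congr1 fst e; have /= e2 := congr1 snd e.
  have bfc : is_boundary (f d b c).
    apply/(is_boundaryP _ ed); exists (- y).
    by rewrite happN; apply/eqP; rewrite eq_sym -subr_eq0 opprK addrC e1.
  have /(is_boundaryP _ ed)[x hx] := proj1 (qf d b) c e2 bfc.
  (* The cycle [y + f x] is [f z] plus a boundary; [u] kills the boundary, and [u (f z)] is [v] of
     the differential of the cycle [z]. *)
  have [|z [cz bz]] := proj2 (qf d0 b) (y + f d0 b x).
    by apply/(is_cycleP _ ed); rewrite happD -cmap_comm hx.
  rewrite /= -hx duv -happD -[X in u b X](subrK (f d0 b z)) happD cu // add0r.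
  by rewrite -duv (proj1 (is_cycleP z ed)) // happ0.
pose in1 : ghom (A d) (gprod (A d) (C (d + 1))) :=
  ghom_pair (ghom_id (A d)) (ghom_zero _ _).
pose in2 : ghom (C (d + 1)) (gprod (A d) (C (d + 1))) :=
  ghom_pair (ghom_zero _ _) (ghom_id (C (d + 1))).
exists (ghom_comp h in1), (ghom_comp h in2); split=> b x.
  by have := hh b (x, 0); rewrite /= !happ0 !addr0.
have /= := hh b (0, x); rewrite !happ0 !add0r => <-.
rewrite -happD; congr (h b _); congr pair; rewrite /= ?addr0 ?add0r //.
Qed.
End LiftingSteps.

(** * Lifts and extensions up to homotopy *)

Section HomotopyLifting.
Variables (K : fieldType) (t : nat) (n : 'I_t -> nat).
Local Notation cpx := (cpx K n).
Implicit Types (A B C F I : cpx).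

(** Lift and homotopy are chosen together, downwards from the degree above which [F] vanishes.
    [compat] is what [lift_step] requires, and [good] in degree [d + 1] implies it in degree [d]. *)
Lemma lift_up_to_homotopy F A C (f : cmap A C) (g : cmap F C) :
    (forall d, projective (F d)) -> bounded_above F -> quasi_iso f ->
  exists (a : cmap F A) h, homotopy (cmap_comp f a) g h.
Proof.
move=> prF [N hN] qf.
pose X d := (ghom (F d) (A d) * (forall d', ghom (F d) (C d')))%type.
pose compat d (x : X (d + 1)) := forall b z,
  is_cycle (x.1 b (cdiff F d (d + 1) b z)) /\
  cdiff C d (d + 1) b (g d b z - x.2 d b (cdiff F d (d + 1) b z)) =
  f (d + 1) b (x.1 b (cdiff F d (d + 1) b z)).
pose good d (x : X (d + 1)) (y : X d) := forall b z,
  cdiff A d (d + 1) b (y.1 b z) = x.1 b (cdiff F d (d + 1) b z) /\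
  f d b (y.1 b z) + cdiff C (d - 1) d b (y.2 (d - 1) b z) =
  g d b z - x.2 d b (cdiff F d (d + 1) b z).
pose x0 d : X d := (ghom_zero _ _, fun=> ghom_zero _ _).
(* The implication makes the choice total, as [compat] is only known along the induction below. *)
have step d (x : X (d + 1)) : exists y, compat d x -> good d x y.
  have [cx|ncx] := pselect (compat d x); last by exists (x0 d).
  have [| |s [h [h1 h2]]] := lift_step (u := ghom_comp x.1 (cdiff F d (d + 1)))
    (v := ghom_sub (g d) (ghom_comp (x.2 d) (cdiff F d (d + 1)))) qf (prF d) erefl.
  - by move=> b z; have [] := cx b z.
  - by move=> b z; rewrite ghom_subE; have [] := cx b z.
  exists (s, fun d' => ghom_comp (recast_hom C (d - 1) d') h) => _ b z; split.
    exact: h1.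
  by rewrite /= recast_id h2 ghom_subE.
(* The number of steps down from [N + 1], where the zero maps are a correct start since [F]
   vanishes. *)
pose k d := if (d <= N)%R then `|(N + 1 - d)%R|%N else 0%N.
have [x hx] := dependent_recursion x0 k (fun d y => sval (cid (step d y))).
have gx d : good d (x (d + 1)) (x d).
  have hm (m : nat) : forall d, N - m%:Z < d -> good d (x (d + 1)) (x d).
    elim: m => [|m IH] {}d hd.
      move=> b z; rewrite (hN d b z) ?happ0 ?addr0 ?subr0 //; lia.
    have [dN|Nd] := leP d N; last by apply: IH; lia.
    have kd : k d = (k (d + 1)).+1 by rewrite /k dN; case: ifP; lia.
    rewrite [X in good d _ X](hx d kd); apply: (svalP (cid (step d (x (d + 1))))).
    move=> b z; have g1 := IH (d + 1) _ b (cdiff F d (d + 1) b z).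
    have [|e1 e2] := g1; first lia.
    rewrite !cdiff_sq !happ0 subr0 addrK in e1 e2.
    split; first by rewrite /is_cycle e1.
    rewrite happB -cmap_comm; by apply/eqP; rewrite subr_eq e2.
  by apply: (hm `|(N + 1 - d)%R|%N); lia.
unshelve eexists (CMap (cmap_at := fun d => (x d).1) _); last first.
  exists (fun d d' => (x d).2 d') => d b z /=.
  have [_ e] := gx d b z.
  by apply/eqP; rewrite subr_eq addrC addrA -subr_eq e.
move=> d d' b z; have [->|ne] := eqVneq d' (d + 1).
  by have [-> _] := gx d b z.
by rewrite !cdiff_shape // happ0.
Qed.

Lemma extend_up_to_homotopy I A C (f : cmap C A) (g : cmap C I) :
    (forall d, injective_mod (I d)) -> bounded_below I -> quasi_iso f ->
  exists (a : cmap A I) h, homotopy (cmap_comp a f) g h.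
Proof.
move=> inI [N hN] qf.
pose X d := (ghom (A d) (I d) * (forall e, ghom (C e) (I d)))%type.
pose compat d (x : X (d - 1)) :=
  (forall b z, is_boundary z -> cdiff I (d - 1) d b (x.1 b z) = 0) /\
  (forall b z, g d b (cdiff C (d - 1) d b z) -
     cdiff I (d - 1) d b (x.2 d b (cdiff C (d - 1) d b z)) =
   cdiff I (d - 1) d b (x.1 b (f (d - 1) b z))).
pose good d (x : X (d - 1)) (y : X d) :=
  (forall b z, y.1 b (cdiff A (d - 1) d b z) = cdiff I (d - 1) d b (x.1 b z)) /\
  (forall b z, y.1 b (f d b z) + y.2 (d + 1) b (cdiff C d (d + 1) b z) =
   g d b z - cdiff I (d - 1) d b (x.2 d b z)).
pose x0 d : X d := (ghom_zero _ _, fun=> ghom_zero _ _).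
have step d (x : X (d - 1)) : exists y, compat d x -> good d x y.
  have [cx|ncx] := pselect (compat d x); last by exists (x0 d).
  have [| | |s [h [h1 h2]]] := extend_step (u := ghom_comp (cdiff I (d - 1) d) x.1)
    (v := ghom_sub (g d) (ghom_comp (cdiff I (d - 1) d) (x.2 d))) qf (inI d).
  - by rewrite subrK.
  - by move=> b z hz; have [h _] := cx; apply: h.
  - by move=> b z; rewrite ghom_subE; have [_ h] := cx; apply: h.
  exists (s, fun e => ghom_comp h (recast_hom C e (d + 1))) => _; split=> b z.
    exact: h1.
  by rewrite /= recast_id h2 ghom_subE.
pose k d := if (N <= d)%R then `|(d + 1 - N)%R|%N else 0%N.
have [x hx] := dependent_recursion x0 k (fun d y => sval (cid (step d y))).
have gx d : good d (x (d - 1)) (x d).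
  have hm (m : nat) : forall d, d < N + m%:Z -> good d (x (d - 1)) (x d).
    elim: m => [|m IH] {}d hd.
      have z0 b (z : I d b) : z = 0 by apply: hN; lia.
      by split=> b z; rewrite [LHS]z0 [RHS]z0.
    have [dN|Nd] := leP N d; last by apply: IH; lia.
    have kd : k d = (k (d - 1)).+1 by rewrite /k dN; case: ifP; lia.
    rewrite [X in good d _ X](hx d kd); apply: (svalP (cid (step d (x (d - 1))))).
    have [|e1 e2] := IH (d - 1); first lia.
    split=> b z.
      by move=> [w <-]; rewrite e1 cdiff_sq.
    have := e2 b z; rewrite subrK => /(canRL (addrK _)) ->.
    by rewrite !happB cdiff_sq subr0 cmap_comm.
  by apply: (hm `|(d + 1 - N)%R|%N); lia.
unshelve eexists (CMap (cmap_at := fun d => (x d).1) _); last first.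
  exists (fun d d' => (x d').2 d) => d b z /=.
  have [_ /(_ b z) e] := gx d.
  apply/eqP; rewrite subr_eq -(subrK (cdiff I (d - 1) d b ((x (d - 1)).2 d b z)) (g d b z)) -e.
  by rewrite addrC [X in _ + X]addrC addrA.
move=> d d' b z; have [->|ne] := eqVneq d' (d + 1).
  have [/(_ b) h _] := gx (d + 1).
  have e : d = d + 1 - 1 by rewrite addrK.
  by move: h; rewrite -e => ->.
by rewrite !cdiff_shape // happ0.
Qed.

(** On cycles homotopic maps differ by boundaries, so this is the two-out-of-three property in
    cohomology. *)
Lemma quasi_iso_of_lift A B C (f : cmap A C) (g : cmap B C) (a : cmap B A) h :
  quasi_iso f -> quasi_iso g -> homotopy (cmap_comp f a) g h -> quasi_iso a.
Proof.
move=> qf qg hfg d b.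
have bh d' x : is_cycle x -> is_boundary (g d' b x - f d' b (a d' b x)).
  by move=> cx; rewrite [X in is_boundary X]hfg cx happ0 addr0; eexists.
split=> [x cx bx|y cy].
  apply: (proj1 (qg d b)) => //; rewrite -(subrK (f d b (a d b x)) (g d b x)).
  by apply: is_boundaryD; [exact: bh | exact: is_boundary_map].
have [x [cx bx]] := proj2 (qg d b) _ (is_cycle_map f cy).
exists x; split=> //; apply: (proj1 (qf d b)).
  by rewrite /is_cycle happB cy -cmap_comm cx happ0 subr0.
rewrite happB -(subrK (g d b x) (f d b y)) -addrA.
by apply: is_boundaryD bx (bh _ _ cx).
Qed.

Lemma quasi_iso_of_extension A B C (f : cmap C A) (g : cmap C B) (a : cmap A B) h :
  quasi_iso f -> quasi_iso g -> homotopy (cmap_comp a f) g h -> quasi_iso a.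
Proof.
move=> qf qg hfg d b.
have bh d' x : is_cycle x -> is_boundary (g d' b x - a d' b (f d' b x)).
  by move=> cx; rewrite [X in is_boundary X]hfg cx happ0 addr0; eexists.
split=> [x cx bx|y cy].
  have [z [cz bz]] := proj2 (qf d b) x cx.
  rewrite -(subrK (f d b z) x); apply: is_boundaryD => //; apply: is_boundary_map.
  apply: (proj1 (qg d b)) => //; rewrite -(subrK (a d b (f d b z)) (g d b z)).
  apply: is_boundaryD; first exact: bh.
  rewrite -(subKr x (f d b z)) happB; apply: is_boundaryD => //.
  exact/is_boundaryN/is_boundary_map.
have [x [cx bx]] := proj2 (qg d b) y cy.
exists (f d b x); split; first exact: is_cycle_map.
by rewrite -(subrK (g d b x) y) -addrA; apply: is_boundaryD bx (bh _ _ cx).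
Qed.
End HomotopyLifting.

(** * Nilpotence of the radical *)

Section Radical.
Variables (K : fieldType) (t : nat) (n : 'I_t -> nat).
Implicit Types (M N : gmod K n).

Lemma ext_sum_basis (x : ext K n) : x = \sum_S x S *: ebasis K S.
Proof.
apply/ffunP => U; rewrite sum_ffunE (bigD1 U) //= big1 ?addr0.
  by rewrite !ffunE eqxx /= -[_ *: _]/(_ * _ : K) mulr1.
move=> S nS; rewrite !ffunE [U == S]eq_sym (negbTE nS) -[_ *: _]/(_ * _ : K).
by rewrite mulr0.
Qed.

Lemma act_sum_basis M b b' m (x : ext K n) :
  act M b b' m x = \sum_S x S *: act M b b' m (ebasis K S).
Proof.
rewrite {1}(ext_sum_basis x).
by elim/big_rec2: _ => [|S u v _ <-]; rewrite ?act0r // actDr actZr.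
Qed.

Lemma ehomog_ebasis (S : {set evar n}) : ehomog (edeg S) (ebasis K S).
Proof. by move=> U; rewrite ffunE; case: (eqVneq U S) => [->|_] /eqP. Qed.

Lemma act_ebasis_eq0 M b b' (m : M b) (S : {set evar n}) :
  b' != b + edeg S -> act M b b' m (ebasis K S) = 0.
Proof. exact: (act_degree _ (@ehomog_ebasis S)). Qed.

Definition homog_part (c : mdeg t) (x : ext K n) : ext K n :=
  [ffun S => if edeg S == c then x S else 0].

Lemma ehomog_part c x : ehomog c (homog_part c x).
Proof. by move=> S; rewrite ffunE; case: (eqVneq (edeg S) c) => // _ /eqP. Qed.

(** This makes [act_mul], which asks for a homogeneous first factor, applicable to arbitrary
    elements of [E]. *)
Lemma act_homog_part M b b' m x :
  act M b b' m x = act M b b' m (homog_part (b' - b) x).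
Proof.
rewrite !act_sum_basis; apply: eq_bigr => S _; rewrite ffunE.
case: eqVneq => // ne; rewrite act_ebasis_eq0 ?scaler0 //.
by apply: contra ne => /eqP ->; rewrite addrC addrA addNr add0r.
Qed.

Lemma ebasis_mul (R S : {set evar n}) :
  ebasis K R * ebasis K S = esign K R S *: ebasis K (R :|: S).
Proof.
apply/ffunP => U; rewrite ext_mulE (bigD1 R) //= [X in _ + X]big1 ?addr0; last first.
  by move=> Q nQ; apply: big1 => V _; rewrite ffunE (negbTE nQ) mul0r mulr0 mul0rn.
rewrite (bigD1 S) //= big1 ?addr0; last first.
  by move=> V nV; rewrite [X in _ * (_ * X)]ffunE (negbTE nV) !mulr0 mul0rn.
rewrite !ffunE !eqxx !mulr1 -[_ *: _]/(_ * _ : K) [U == _]eq_sym.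
by case: (_ == _); rewrite ?mulr1 ?mulr0.
Qed.

(** This is M E_+^k, because E_+^k is spanned by the e_S with at least [k] elements in [S]. The
    inductive form replaces the indexed families of [in_radical]. *)
Inductive rad_power M (k : nat) : forall b, M b -> Prop :=
| rad_power0 b : rad_power k (0 : M b)
| rad_powerD b c (u : M c) (x : ext K n) (m : M b) :
    (forall S : {set evar n}, (#|S| < k)%N -> x S = 0) ->
    rad_power k m -> rad_power k (act M c b u x + m).

Lemma rad_power_add M k b (m m' : M b) :
  rad_power k m -> rad_power k m' -> rad_power k (m + m').
Proof.
move=> h; elim: h m' => {b m} [b|b c u x m hx _ IH] m' h'; first by rewrite add0r.
by rewrite -addrA; apply: rad_powerD => //; apply: IH.
Qed.

Lemma rad_power_map M N (g : ghom M N) k b (m : M b) :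
  rad_power k m -> rad_power k (g b m).
Proof.
move=> h; elim: h => {b m} [b|b c u x m hx _ IH]; first by rewrite happ0; apply: rad_power0.
by rewrite happD happ_act; apply: rad_powerD.
Qed.

Lemma in_radical_power M b (m : M b) : in_radical m -> rad_power 1 m.
Proof.
move=> [r [c [u [x [hx ->]]]]]; elim/big_rec: _ => [|k y _ hy].
  exact: rad_power0.
apply: rad_powerD => // S; rewrite ltnS leqn0 cards_eq0 => /eqP ->.
exact: hx.
Qed.

(** A product e_R e_S is nonzero only for disjoint [R] and [S], and then the cardinalities add
    up. *)
Lemma rad_power_act M k b b' (m : M b) (x : ext K n) :
  (forall S : {set evar n}, (#|S| < k)%N -> x S = 0) -> rad_power 1 m ->
  rad_power k.+1 (act M b b' m x).
Proof.
move=> hx h; elim: h => {b m} [b|b c u y m hy _ IH]; first by rewrite act0l; apply: rad_power0.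
rewrite actDl [act M c b u y]act_homog_part act_mul; last exact: ehomog_part.
apply: rad_powerD => // U hU; rewrite ext_mulE big1 // => R _; rewrite big1 // => S _.
have [e|] := eqVneq (R :|: S) U; last by rewrite mulr0n.
have [d|nd] := boolP [disjoint R & S]; last first.
  by rewrite /esign (negbTE nd) mulr0n mul0r mul0rn.
have cU : (#|U| = #|R| + #|S|)%N.
  by rewrite -e -cardsUI; move: d; rewrite -setI_eq0 => /eqP ->; rewrite cards0 addn0.
have [hR|hR] := ltnP #|R| 1.
  by rewrite ffunE hy // if_same mul0r mulr0 mul0rn.
by rewrite [x S]hx ?mulr0 ?mul0rn //; lia.
Qed.

Lemma rad_power_step M (r : ghom M M) k b (m : M b) :
  (forall c (v : M c), rad_power 1 (r c v)) -> rad_power k m -> rad_power k.+1 (r b m).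
Proof.
move=> hr h; elim: h => {b m} [b|b c u x m hx _ IH]; first by rewrite happ0; apply: rad_power0.
by rewrite happD happ_act; apply: rad_power_add => //; apply: rad_power_act.
Qed.

Lemma rad_power_eq0 M k b (m : M b) : (#|evar n| < k)%N -> rad_power k m -> m = 0.
Proof.
move=> hk h; elim: h => {b m} // b c u x m hx _ ->; rewrite addr0.
have -> : x = 0 by apply/ffunP => S; rewrite hx ?ffunE // (leq_ltn_trans _ hk) ?max_card.
exact: act0r.
Qed.

(* [q = 1 - r] with [r] taking values in the radical, which is nilpotent. *)
Lemma bij_of_radical M (q : ghom M M) :
  (forall b m, rad_power 1 (m - q b m)) ->
  forall b, injective (q b) /\ (forall y, exists x, q b x = y).
Proof.
move=> hq.
pose r : ghom M M := ghom_sub (ghom_id M) q.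
have rE c v : r c v = v - q c v by exact: ghom_subE.
have hr c (v : M c) : rad_power 1 (r c v) by rewrite rE.
have h0 b (m : M b) : rad_power 0 m.
  by rewrite -[m]addr0 -[m]act_one; apply: rad_powerD => //; apply: rad_power0.
move=> b; split.
  suff h m : q b m = 0 -> m = 0.
    by move=> x y e; apply/eqP; rewrite -subr_eq0; apply/eqP/h; rewrite happB e subrr.
  move=> qm; apply: (@rad_power_eq0 _ #|evar n|.+1) => //.
  elim: _.+1 => [|k IH]; first exact: h0.
  have -> : m = r b m by rewrite rE qm subr0.
  exact: rad_power_step.
(* Since [y] is [q y + r y], it suffices to hit [r y], which lies one power deeper; [k] counts the
   powers left until everything vanishes. *)
have hs k y : rad_power (#|evar n|.+1 - k)%N y -> exists x, q b x = y.
  elim: k y => [|k IH] y hy.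
    by exists 0; rewrite happ0 (rad_power_eq0 _ hy) // subn0.
  have [|lek] := ltnP #|evar n| k.
    by move=> lt; apply: IH; rewrite (eqP (_ : _ - k == 0)%N) ?subn_eq0 //; apply: h0.
  have [|x hx] := IH (r b y).
    by rewrite subSn //; apply: rad_power_step.
  by exists (y + x); rewrite happD hx rE subrKC.
by move=> y; apply: (hs #|evar n|.+1); rewrite subnn; apply: h0.
Qed.
End Radical.

(** * Uniqueness of minimal resolutions *)

Section MinimalResolutions.
Variables (K : fieldType) (t : nat) (n : 'I_t -> nat).
Local Notation cpx := (cpx K n).
Implicit Types (A B C F I : cpx).

Definition bijective_cmap A B (f : cmap A B) : Prop :=
  forall d b, injective (f d b) /\ (forall y, exists x, f d b x = y).

(** The difference [1 - a] is dh + hd. Both terms lie in the radical: the first because d takes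
    values there, the second because [h] is E-linear and so preserves it. *)
Lemma homotopic_id_bij A (a : cmap A A) h :
  minimal A -> homotopy a (cmap_id A) h -> bijective_cmap a.
Proof.
move=> mA ha d b; apply: (@bij_of_radical _ _ _ (A d) (a d)) => {}b m.
rewrite -[m in m - _]/(cmap_id A d b m) ha; apply: rad_power_add.
  exact/in_radical_power/mA.
exact/rad_power_map/in_radical_power/mA.
Qed.

Lemma quasi_iso_id A : quasi_iso (cmap_id A).
Proof.
move=> d b; split=> // y cy; exists y; split=> //.
by exists 0; rewrite happ0 subrr.
Qed.

Lemma bijective_comp A B C (f : cmap A B) (g : cmap B C) :
  bijective_cmap f -> bijective_cmap (cmap_comp g f) -> bijective_cmap g.
Proof.
move=> bf bgf d b; split=> [x y|z]; last first.
  by have [_ /(_ z)[x <-]] := bgf d b; exists (f d b x).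
have [_ sf] := bf d b; have [u <-] := sf x; have [v <-] := sf y.
by move=> e; have [i _] := bgf d b; rewrite (i u v e).
Qed.

Lemma bijective_mid A B (f : cmap A B) (g : cmap B A) (f' : cmap A B) :
  bijective_cmap (cmap_comp f' g) -> bijective_cmap (cmap_comp g f) -> bijective_cmap g.
Proof.
move=> b1 b2 d b; split=> [x y e|z].
  by have [i _] := b1 d b; apply: i; rewrite /= e.
by have [_ /(_ z)[x <-]] := b2 d b; exists (f d b x).
Qed.

(** Let [w] lift the identity through [v], and [u] the identity through [w]. By minimality [v w] and
    [w u] are bijective, hence so is [w], and then [v]. *)
Lemma minimal_projective_bij F A (v : cmap F A) :
  (forall d, projective (F d)) -> bounded_above F -> minimal F ->
  (forall d, projective (A d)) -> bounded_above A -> minimal A ->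
  quasi_iso v -> bijective_cmap v.
Proof.
move=> prF bF mF prA bA mA qv.
have [w [h hw]] := lift_up_to_homotopy (cmap_id A) prA bA qv.
have qw := quasi_iso_of_lift qv (@quasi_iso_id A) hw.
have [u [k hu]] := lift_up_to_homotopy (cmap_id F) prF bF qw.
have b1 := homotopic_id_bij mA hw; have b2 := homotopic_id_bij mF hu.
exact: bijective_comp (bijective_mid b1 b2) b1.
Qed.

Lemma comp_bijective A B C (f : cmap A B) (g : cmap B C) :
  bijective_cmap g -> bijective_cmap (cmap_comp g f) -> bijective_cmap f.
Proof.
move=> bg bgf d b; split=> [x y e|z].
  by have [i _] := bgf d b; apply: i; rewrite /= e.
have [_ /(_ (g d b z))[x /= hx]] := bgf d b; exists x.
by have [i _] := bg d b; apply: i.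
Qed.

Lemma minimal_injective_bij I A (v : cmap A I) :
  (forall d, injective_mod (I d)) -> bounded_below I -> minimal I ->
  (forall d, injective_mod (A d)) -> bounded_below A -> minimal A ->
  quasi_iso v -> bijective_cmap v.
Proof.
move=> inI bI mI inA bA mA qv.
have [w [h hw]] := extend_up_to_homotopy (cmap_id A) inA bA qv.
have qw := quasi_iso_of_extension qv (@quasi_iso_id A) hw.
have [u [k hu]] := extend_up_to_homotopy (cmap_id I) inI bI qw.
have b1 := homotopic_id_bij mA hw; have b2 := homotopic_id_bij mI hu.
exact: comp_bijective (bijective_mid b2 b1) b1.
Qed.

Lemma min_projective_resolution_unique C F A (f : cmap F C) (g : cmap A C) :
  min_projective_resolution f -> min_projective_resolution g ->
  exists (a : cmap F A) h, bijective_cmap a /\ homotopy (cmap_comp g a) f h.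
Proof.
move=> [prF bF qf mF] [prA bA qg mA].
have [a [h ha]] := lift_up_to_homotopy f prF bF qg.
exists a, h; split=> //; apply: minimal_projective_bij => //.
exact: quasi_iso_of_lift ha.
Qed.

Lemma min_injective_resolution_unique C I A (f : cmap C I) (g : cmap C A) :
  min_injective_resolution f -> min_injective_resolution g ->
  exists (a : cmap I A) h, bijective_cmap a /\ homotopy (cmap_comp a f) g h.
Proof.
move=> [inI bI qf mI] [inA bA qg mA].
have [a [h ha]] := extend_up_to_homotopy g inA bA qf.
exists a, h; split=> //; apply: minimal_injective_bij => //.
exact: quasi_iso_of_extension ha.
Qed.

Lemma bijective_cmap_iso A B (f : cmap A B) : bijective_cmap f -> cpx_iso A B.
Proof.
move=> bf; pose g d b y := sval (cid (proj2 (bf d b) y)).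
have fg d b y : f d b (g d b y) = y by by rewrite /g; case: cid.
have gf d b x : g d b (f d b x) = x by apply: (proj1 (bf d b)); rewrite fg.
have lg d b : linear (g d b).
  by move=> c x y; apply: (proj1 (bf d b)); rewrite happD happZ !fg.
have ag d b b' m x : g d b' (act (B d) b b' m x) = act (A d) b b' (g d b m) x.
  by apply: (proj1 (bf d b')); rewrite happ_act !fg.
exists f; unshelve eexists (CMap (cmap_at := fun d => GHom (@lg d) (@ag d)) _).
  by move=> d d' b x; apply: (proj1 (bf d' b)); rewrite /= cmap_comm !fg.
by split.
Qed.

Lemma cpx_iso_trans B A C : cpx_iso A B -> cpx_iso B C -> cpx_iso A C.
Proof.
move=> [f [g [gf fg]]] [f' [g' [gf' fg']]].
by exists (cmap_comp f' f), (cmap_comp g g'); split=> d b x /=; rewrite ?gf' ?gf ?fg ?fg'.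
Qed.

Lemma cpx_iso_sym A B : cpx_iso A B -> cpx_iso B A.
Proof. by move=> [f [g [gf fg]]]; exists g, f. Qed.
End MinimalResolutions.

(** * Splitting of linear maps over a field *)

(** Zorn's lemma is applied to linear relations between [V] and [U] in which [f x] is related to
    nothing but [x]. Subtracting two values over one point shows that such a relation is
    single-valued. *)
Lemma linear_retraction (K : fieldType) (U V : lmodType K) (f : {linear U -> V}) :
  injective f -> exists g : {linear V -> U}, cancel f g.
Proof.
move=> inf.
pose P (G : classical_sets.set (V * U)) := (forall c x y, G x -> G y -> G (c *: x + y)) /\
  (forall x u, G (f x, u) -> u = x).
have [|A [[Al Af] maxA]] := @classical_sets.Zorn_bigcup _ P.
  move=> F FP tot; split.
    move=> c x y [X FX Xx] [Y FY Yy].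
    have [XY|YX] := tot _ _ FX FY.
      by exists Y => //; apply: (FP _ FY).1 => //; apply: XY.
    by exists X => //; apply: (FP _ FX).1 => //; apply: YX.
  by move=> x u [X FX Xxu]; apply: (FP _ FX).2.
have maxA' B : P B -> (forall x, A x -> B x) -> forall x, B x -> A x.
  move=> PB AB x Bx; apply: contrapT => nAx; apply: (maxA B) => //.
  by split=> // BA; apply/nAx/BA.
(* The empty relation satisfies [P], as the union of the empty chain must, so even [0] has to be
   adjoined by maximality. *)
have A0 : A (0, 0).
  apply: (maxA' (fun p => A p \/ p = 0)); last by right.
    split; last by move=> x u [/Af //|[/eqP]]; rewrite -(linear0 f) (inj_eq inf) => /eqP -> ->.
    move=> c x y [Ax|->] [Ay|->]; rewrite ?scaler0 ?addr0 ?add0r.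
    - by left; apply: Al.
    - left; have -> : c *: x = (c - 1) *: x + x by rewrite scalerBl scale1r subrK.
      exact: Al.
    - by left.
    - by right.
  by move=> x Ax; left.
have Agraph x : A (f x, x).
  apply: (maxA' (fun p => exists q x, A q /\ p = q + (f x, x))).
  - split.
      move=> c _ _ [q [y [Aq ->]]] [q' [y' [Aq' ->]]].
      exists (c *: q + q'), (c *: y + y'); split; first exact: Al.
      rewrite scalerDr addrACA; congr (_ + _).
      by congr pair; rewrite linearP.
    move=> z u [[v w] [y [Aq [e1 ->]]]].
    have -> : w = z - y; last by rewrite subrK.
    by apply: Af; rewrite linearB e1 addrK.
  - by move=> p Ap; exists p, 0; split=> //; rewrite linear0 addr0.
  - by exists (0, 0), x; split=> //; rewrite add0r.
have Atot v : exists u, A (v, u).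
  apply: contrapT => nv.
  suff : A (v, 0) by move=> Av; apply: nv; exists 0.
  (* A point [v] outside the domain can be given the value 0: no relation over the image of [f]
     arises with a nonzero multiple of [v]. *)
  apply: (maxA' (fun p => exists q (c : K), A q /\ p = q + (c *: v, 0))).
  - split.
      move=> c _ _ [q [y [Aq ->]]] [q' [y' [Aq' ->]]].
      exists (c *: q + q'), (c * y + y'); split; first exact: Al.
      rewrite scalerDr addrACA; congr (_ + _).
      by congr pair; rewrite /= ?scaler0 ?addr0 // scalerDl scalerA.
    move=> z u [[w u'] [c [Aq [e ->]]]]; rewrite addr0.
    have [c0|c0] := eqVneq c 0.
      by apply: Af; move: Aq; rewrite e c0 scale0r addr0.
    case: nv; exists (c^-1 *: (z - u')).
    have -> : (v, c^-1 *: (z - u')) = c^-1 *: ((f z, z) - (w, u')).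
      by congr pair; rewrite /= e addrAC subrr add0r scalerA mulVf // scale1r.
    rewrite -[X in A X]addr0; apply: (Al) => //.
    by rewrite addrC -scaleN1r; apply: Al.
  - by move=> p Ap; exists p, 0; split=> //; rewrite scale0r addr0.
  - by exists (0, 0), 1; split=> //; rewrite add0r scale1r.
pose g v := sval (cid (Atot v)).
have Ag v : A (v, g v) by rewrite /g; case: cid.
have Au v u u' : A (v, u) -> A (v, u') -> u = u'.
  move=> Au Au'; apply/eqP; rewrite -subr_eq0; apply/eqP; apply: Af.
  have -> : (f 0, u - u') = -1 *: (v, u') + (v, u).
    by rewrite linear0 scaleN1r; congr pair; rewrite /= addrC // subrr.
  exact: Al.
have gl : linear g.
  move=> c x y; apply: (Au (c *: x + y)) => //.
  by rewrite -[(_, _)]/(c *: (x, g x) + (y, g y)); apply: Al.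
pose gm := GRing.isLinear.Build K V U _ g gl.
pose gL : {linear V -> U} := HB.pack g gm.
by exists gL => x; apply: (Au (f x)).
Qed.

(** A retraction [r] onto the kernel corrects an arbitrary choice [s] of preimages: [x - r x]
    depends only on [f x], which makes [g] linear. *)
Lemma linear_section (K : fieldType) (U V : lmodType K) (f : {linear U -> V}) :
  (forall y, exists x, f x = y) -> exists g : {linear V -> U}, cancel g f.
Proof.
move=> sf.
pose Q (x : U) := f x = 0.
have Q0 : Q 0 by exact: linear0.
have QP (c : K) x y : Q x -> Q y -> Q (c *: x + y).
  by rewrite /Q linearP => -> ->; rewrite scaler0 addr0.
pose W := prop_sub Q0 QP.
pose incl := (fun x : lsub W => val x).
have il : linear incl by [].
pose im := GRing.isLinear.Build K (lsub W) U _ incl il.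
pose iL : {linear lsub W -> U} := HB.pack incl im.
have [|r hr] := @linear_retraction _ _ _ iL; first exact: val_inj.
pose s y := sval (cid (sf y)).
have fs y : f (s y) = y by rewrite /s; case: cid.
pose g y := s y - incl (r (s y)).
have fr x : f (incl (r x)) = 0 by have /prop_subP := valP (r x).
have fg y : f (g y) = y by rewrite /g linearB fr subr0.
have gu x y : f x = f y -> x - incl (r x) = y - incl (r y).
  move=> e; have hxy : x - y \in W by apply/prop_subP; rewrite /Q linearB e subrr.
  have h : r (x - y) = Sub (x - y) hxy by exact: (hr (Sub (x - y) hxy)).
  have /eqP : incl (r x) - incl (r y) = x - y.
    by rewrite -[LHS]/(incl (r x - r y)) -linearB h.
  by rewrite subr_eq => /eqP ->; rewrite opprD opprB addrA subrKC.
have gl : linear g.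
  move=> c x y; rewrite /g.
  transitivity ((c *: s x + s y) - incl (r (c *: s x + s y))).
    by apply: gu; rewrite linearP !fs.
  by rewrite linearP [incl _]il scalerBr opprD addrACA.
pose gm := GRing.isLinear.Build K V U _ g gl.
pose gL : {linear V -> U} := HB.pack g gm.
by exists gL.
Qed.

(** * Free modules are injective and projective *)

Section FreeModules.
Variables (K : fieldType) (t : nat) (n : 'I_t -> nat).
Implicit Types (M N : gmod K n) (B : mdeg t -> lmodType K).

Lemma act_sum_l M b b' (J : Type) (r : seq J) (P : pred J) (F : J -> M b) x :
  act M b b' (\sum_(k <- r | P k) F k) x = \sum_(k <- r | P k) act M b b' (F k) x.
Proof.
by elim/big_rec2: _ => [|k u v _ <-]; rewrite ?act0l ?actDl.
Qed.

Lemma free_act_ebasisE B b b' (f : freemod n B b) (R S : {set evar n}) :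
  (act (freemod n B) b b' f (ebasis K R) : freemod n B b') S =
  esign K R S *: recast B (b + edeg (R :|: S)) (b' + edeg S) (f (R :|: S)).
Proof. by rewrite -[ebasis K R]scale1r act_ebasis mulr1. Qed.

Lemma ghom_of_basis M N (h : forall b, {linear M b -> N b}) :
  (forall b b' m (S : {set evar n}),
     h b' (act M b b' m (ebasis K S)) = act N b b' (h b m) (ebasis K S)) ->
  exists g : ghom M N, forall b m, g b m = h b m.
Proof.
move=> hb; unshelve eexists (GHom (happ := fun b m => h b m) _ _) => //.
  by move=> b c x y; rewrite linearP.
move=> b b' m x; rewrite act_sum_basis [RHS]act_sum_basis linear_sum.
by apply: eq_bigr => S _; rewrite linearZ /= hb.
Qed.

Lemma esign_eq0 (R S : {set evar n}) : ~~ [disjoint R & S] -> esign K R S = 0.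
Proof. by rewrite /esign => /negbTE ->. Qed.

Lemma esign_sqr (R S : {set evar n}) : [disjoint R & S] -> esign K R S * esign K R S = 1.
Proof. by rewrite /esign => ->; rewrite -expr2 mulr1n sqrr_sign. Qed.

Lemma recast_act_target M b (m : M b) x a a' :
  a = a' -> recast M a a' (act M b a m x) = act M b a' m x.
Proof. by move=> e; case: _ / e; rewrite recast_id. Qed.

(** Maps into the coinduced module Hom_K(E, B) correspond to linear maps to B by evaluation at 1,
    the coordinate at [set0]. So only the linear map [mu] must be extended, and [h] sends [y] to the
    family of all [mu (y e_S)]. *)
Lemma freemod_injective B : injective_mod (freemod n B).
Proof.
move=> M N f g inf.
have ret b : exists r : {linear N b -> M b}, cancel (f b) r.
  exact: (linear_retraction (inf b)).
pose r b := sval (cid (ret b)).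
have rf b : cancel (f b) (r b) by rewrite /r; case: cid.
pose mu b (y : N b) : B b := recast B (b + edeg set0) b ((g b (r b y) : freemod n B b) set0).
have mul b : linear (mu b).
  by move=> c x y; rewrite /mu !linearP /= dprodDE dprodZE linearP.
pose muL b : {linear N b -> B b} := HB.pack (mu b) (GRing.isLinear.Build K _ _ _ (mu b) (mul b)).
pose h b (y : N b) : freemod n B b :=
  finfun (fun S : {set evar n} => muL _ (act N b (b + edeg S) y (ebasis K S))).
have hE b (y : N b) S : h b y S = muL _ (act N b (b + edeg S) y (ebasis K S)).
  by rewrite ffunE.
have hl b : linear (h b).
  by move=> c x y; apply: dprodP => S; rewrite dprodDE dprodZE !hE actDl actZl linearP.
pose hL b : {linear N b -> freemod n B b} :=
  HB.pack (h b) (GRing.isLinear.Build K _ _ _ (h b) (hl b)).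
have [|H HE] := @ghom_of_basis N (freemod n B) hL.
  move=> b b' y R; apply: dprodP => S; rewrite free_act_ebasisE !hE.
  have [d|nd] := boolP [disjoint R & S]; last first.
    rewrite esign_eq0 // scale0r; have [->|ne] := eqVneq b' (b + edeg R); last first.
      by rewrite [act N b b' y _]act_ebasis_eq0 // act0l linear0.
    rewrite act_mul; last by rewrite addrAC subrr add0r; exact: ehomog_ebasis.
    by rewrite ebasis_mul esign_eq0 // scale0r act0r linear0.
  have [->|ne] := eqVneq b' (b + edeg R); last first.
    rewrite [act N b b' y _]act_ebasis_eq0 // act0l linear0 recast_neq ?scaler0 // edegU // addrA.
    by apply: contra ne => /eqP/addIr ->.
  rewrite act_mul; last by rewrite addrAC subrr add0r; exact: ehomog_ebasis.
  rewrite ebasis_mul actZr linearZ recast_map recast_act_target //.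
  by rewrite edegU // addrA.
exists H => b m; rewrite HE; apply: dprodP => S; rewrite hE /= /mu.
rewrite -happ_act rf happ_act free_act_ebasisE esign0r scale1r.
rewrite recast_recast; last by rewrite -addrA -edegU // disjoint_sym disjoints_subset sub0set.
rewrite (recast_dep (u := fun S => b + edeg S) (g b m) _ (setU0 S)).
exact: recast_id.
Qed.

(** The top coordinates are free generators: the basis vector at [S] is the generator times e_(~:
    S), up to the sign [esign (~: S) S]. Lifting the generators linearly prescribes [h], and its
    E-linearity comes down to an identity of signs. *)
Lemma freemod_projective B : projective (freemod n B).
Proof.
move=> M N f g sf.
have sec b : exists s : {linear N b -> M b}, cancel s (f b).
  exact: (linear_section (sf b)).
pose s b := sval (cid (sec b)).
have fs b : cancel (s b) (f b) by rewrite /s; case: cid.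
pose top (a : mdeg t) : mdeg t := a - edeg [set: evar n].
have topE a : top a + edeg [set: evar n] = a by rewrite subrK.
pose e (a : mdeg t) (v : B a) : freemod n B (top a) :=
  @free_single _ _ _ B (top a) [set: evar n] (recast B a (top a + edeg [set: evar n]) v).
have el a : linear (@e a).
  move=> c x y; apply: dprodP => S; rewrite dprodDE dprodZE !ffunE.
  by rewrite linearP -[RHS](linearP (recast (fun V => B (top a + edeg V)) _ _)).
pose u (a : mdeg t) (v : B a) : M (top a) := s (top a) (g (top a) (e a v)).
have ul a : linear (@u a).
  by move=> c x y; rewrite /u el !linearP.
pose uL a : {linear B a -> M (top a)} :=
  HB.pack (@u a) (GRing.isLinear.Build K _ _ _ (@u a) (@ul a)).
have uZ a c (v : B a) : u a (c *: v) = c *: u a v.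
  exact: (linearZ_LR (uL a)).
have u0 a : u a 0 = 0 by rewrite -(scale0r 0) uZ scale0r.
have act_recast b' a a' (v : B a) R : a = a' ->
    act M (top a') b' (u a' (recast B a a' v)) R = act M (top a) b' (u a v) R.
  by move=> E; case: _ / E; rewrite recast_id.
have topC b (S : {set evar n}) : b - top (b + edeg S) = edeg (~: S).
  rewrite /top -(setUCr S) edegU; last by rewrite disjoints_subset setCK.
  by rewrite [- (edeg S + _)]opprD addrA addrK subKr.
pose h b (x : freemod n B b) : M b :=
  \sum_(S : {set evar n}) esign K (~: S) S *: act M _ b (u _ (x S)) (ebasis K (~: S)).
have hl b : linear (h b).
  move=> c x y; rewrite /h scaler_sumr -big_split; apply: eq_bigr => S _ /=.
  rewrite dprodDE dprodZE ul actDl actZl scalerDr !scalerA [c * _]mulrC //.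
pose hL b : {linear freemod n B b -> M b} :=
  HB.pack (h b) (GRing.isLinear.Build K _ _ _ (h b) (hl b)).
have [|H HE] := @ghom_of_basis (freemod n B) M hL.
  move=> b b' x R; rewrite /= /h act_sum_l.
  have [->|ne] := eqVneq b' (b + edeg R); last first.
    rewrite [RHS]big1 ?[LHS]big1 // => S _; last first.
      by rewrite actZl [act M b b' _ _]act_ebasis_eq0 ?scaler0.
    rewrite free_act_ebasisE; have [d|nd] := boolP [disjoint R & S]; last first.
      by rewrite (esign_eq0 nd) scale0r u0 act0l scaler0.
    rewrite recast_neq ?scaler0 ?u0 ?act0l ?scaler0 // edegU // addrA.
    by apply: contra ne => /eqP/addIr ->.
  pose G (U S : {set evar n}) :=
    act M (top (b + edeg U)) (b + edeg R) (u _ (x U)) (ebasis K (~: S)).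
  (* One side becomes a sum over the [S] disjoint from [R], the other over the [U] containing [R];
     they are matched by [U = R :|: S]. *)
  transitivity (\sum_(S : {set evar n} | [disjoint R & S])
      (esign K (~: S) S * esign K R S) *: G (R :|: S) S).
    rewrite [RHS]big_mkcond; apply: eq_bigr => S _ /=; rewrite free_act_ebasisE.
    case: ifP => [d|/negbT nd]; last first.
      by rewrite (esign_eq0 nd) scale0r u0 act0l scaler0.
    rewrite uZ actZl scalerA; congr (_ *: _).
    by apply: act_recast; rewrite edegU // addrA.
  transitivity (\sum_(U : {set evar n} | R \subset U)
      (esign K (~: U) U * esign K (~: U) R) *: G U (U :\: R)); last first.
    rewrite big_mkcond; apply: eq_bigr => U _ /=.
    rewrite actZl act_mul; last by rewrite topC; exact: ehomog_ebasis.
    rewrite ebasis_mul actZr scalerA; case: ifP => [sRU|/negbT nsRU].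
      by congr (_ *: act _ _ _ _ (ebasis K _)); apply/setP => v; rewrite !inE negb_and negbK orbC.
    by rewrite (@esign_eq0 (~: U) R) ?mulr0 ?scale0r // disjoints_subset setCS.
  have RU (U : {set evar n}) : R \subset U -> R :|: (U :\: R) = U.
    by move=> /setIidPr E; rewrite -{1}E setID.
  rewrite (reindex_onto (fun U => U :\: R) (fun S => R :|: S)) /=.
    apply: eq_big => U.
      apply/andP/idP => [[_ /eqP <-]|sRU]; first exact: subsetUl.
      rewrite RU // eqxx; split=> //.
      by rewrite -setI_eq0; apply/eqP/setP => v; rewrite !inE; case: (v \in R).
    move=> /andP[d /eqP eU]; rewrite eU; congr (_ *: _).
    have sRU : R \subset U by rewrite -eU subsetUl.
    have dU : [disjoint ~: U & U] by rewrite disjoint_sym disjoints_subset setCK.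
    have dR : [disjoint ~: U & R] by rewrite disjoints_subset setCS.
    have := esignA K (~: U) R (U :\: R); rewrite eU.
    have -> : ~: U :|: R = ~: (U :\: R).
      by apply/setP => v; rewrite !inE negb_and negbK orbC.
    set a := esign K (~: U) R; set p := esign K (~: (U :\: R)) _.
    set q := esign K R _; set r := esign K (~: U) U => E.
    rewrite -[LHS]mul1r -(esign_sqr dR) -/a.
    have -> : a * a * (p * q) = a * q * (a * p) by ring.
    have -> : a * q * (a * p) = r * a * (q * q) by rewrite E; ring.
    by rewrite /q (esign_sqr d) mulr1.
  move=> S d; apply/setP => v; rewrite !inE; case: (boolP (v \in R)) => //= vR.
  by rewrite (disjointFr d vR).
exists H => b x; rewrite HE /= /h happ_sum.
rewrite [in RHS](free_sum_single x) happ_sum; apply: eq_bigr => S _.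
rewrite happZ happ_act fs -happ_act -happZ; congr (g b _).
apply: dprodP => U; rewrite dprodZE free_act_ebasisE !ffunE.
have dS : [disjoint ~: S & S] by rewrite disjoint_sym disjoints_subset setCK.
have [<-|nU] := eqVneq S U.
  rewrite scalerA esign_sqr // scale1r recast_id.
  rewrite (recast_dep (u := fun V => top (b + edeg S) + edeg V)
    (fun V => recast (fun V => B (top (b + edeg S) + edeg V)) [set: evar n] V _) _
    (etrans (setUC _ _) (setUCr S))).
  by rewrite recast_id recast_recast // recast_id.
rewrite [RHS]recast_neq //; have [d|nd] := boolP [disjoint ~: S & U]; last first.
  by rewrite (esign_eq0 nd) scale0r scaler0.
have ne : [set: evar n] != ~: S :|: U.
  apply: contra nU => /eqP eq; rewrite eqEsubset; apply/andP; split.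
    apply/subsetP => v hv; have : v \in [set: evar n] by [].
    by rewrite eq !inE hv.
  by rewrite disjoint_sym disjoints_subset setCK in d.
by rewrite (recast_neq (B := fun V => B (top (b + edeg S) + edeg V)) _ ne) linear0 !scaler0.
Qed.
End FreeModules.

(** * Regions of summands as idempotents on the terms of a free complex *)

Section Cuts.
Variables (K : fieldType) (t : nat) (n : 'I_t -> nat).

Section Cut.
Variable B : mdeg t -> lmodType K.

(** An idempotent on the full term keeps all regions in one type, whereas [restr] gives each region
    its own. *)
Definition cut (R : pred (mdeg t)) : ghom (freemod n B) (freemod n B) :=
  ghom_comp (restr_incl n B R) (restr_proj n B R).

Lemma cutE R b (f : freemod n B b) S :
  (cut R b f : freemod n B b) S = (f : freemod n B b) S *+ R (b + edeg S).
Proof. exact: restr_incl_proj. Qed.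

Lemma restr_projK R b (w : freemod n (restr B R) b) :
  restr_proj n B R b (restr_incl n B R b w) = w.
Proof. by apply: dprodP => S; rewrite !free_mapE /= to_of_restr. Qed.

Lemma cut_incl R b (w : freemod n (restr B R) b) :
  cut R b (restr_incl n B R b w) = restr_incl n B R b w.
Proof. by rewrite /cut ghom_compE restr_projK. Qed.

Lemma restr_incl_inj R b : injective (restr_incl n B R b).
Proof. by move=> x y e; rewrite -[x]restr_projK e restr_projK. Qed.

Lemma cut_cut R R' b f : cut R b (cut R' b f) = cut (fun a => R a && R' a) b f.
Proof. by apply: dprodP => S; rewrite !cutE -mulrnA mulnb andbC. Qed.

Lemma cutK R b f : cut R b (cut R b f) = cut R b f.
Proof. by apply: dprodP => S; rewrite !cutE -mulrnA mulnb andbb. Qed.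

Lemma cut_ext R R' b f : (forall S : {set evar n}, R (b + edeg S) = R' (b + edeg S)) ->
  cut R b f = cut R' b f.
Proof. by move=> e; apply: dprodP => S; rewrite !cutE e. Qed.

Lemma cut_eq0 R b f : (forall S : {set evar n}, ~~ R (b + edeg S)) -> cut R b f = 0.
Proof. by move=> e; apply: dprodP => S; rewrite cutE dprod0E (negbTE (e S)). Qed.
End Cut.
Local Arguments cut {B} R.

Variable T : fcpx K n.
Local Notation D := (fdiff T).

Lemma incl_subq_diff R R' d d' b x :
  restr_incl n _ R' b (subq_diff T R R' d d' b x) =
  cut R' b (D d d' b (restr_incl n _ R b x)).
Proof. by []. Qed.

(** Morphisms of free modules only raise the degrees of summands. *)
Lemma cut_diff_cut_eq0 (R1 R2 : pred (mdeg t)) d d' b f :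
  (forall a e, R1 a -> R2 e -> ~~ mle a e) -> cut R2 b (D d d' b (cut R1 b f)) = 0.
Proof.
move=> up; apply: dprodP => S; rewrite cutE dprod0E.
case R2S : (R2 _); last by rewrite mulr0n.
rewrite mulr1n; apply: free_hom_support => S' sS; rewrite cutE.
case R1S : (R1 _); last by rewrite mulr0n.
by have := up _ _ R1S R2S; rewrite edeg_mle.
Qed.

Lemma cut_diff_sq R d d' d'' b y : convex R -> cut R b y = y ->
  cut R b (D d' d'' b (cut R b (D d d' b y))) = 0.
Proof.
move=> cR Ry.
have := subq_diff_sq d' d'' (restr_proj n (fgen T d) R b y) cR (fun _ h => h) (fun _ h => h).
move=> /(congr1 (restr_incl n _ R b)); rewrite happ0 !incl_subq_diff.
by rewrite -[restr_incl _ _ _ _ (restr_proj _ _ _ _ _)]/(cut R b y) Ry.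
Qed.

Definition region_exact (R : pred (mdeg t)) (b : mdeg t) : Prop :=
  forall d (x : freemod n (fgen T d) b), cut R b x = x -> cut R b (D d (d + 1) b x) = 0 ->
  exists y : freemod n (fgen T (d - 1)) b, cut R b y = y /\ cut R b (D (d - 1) d b y) = x.

Lemma region_exact_ext R R' b : (forall S : {set evar n}, R (b + edeg S) = R' (b + edeg S)) ->
  region_exact R b -> region_exact R' b.
Proof.
move=> e ex d x; rewrite -!(cut_ext _ e) => h1 h2.
by have [y [h3 h4]] := ex d x h1 h2; exists y; rewrite -!(cut_ext _ e).
Qed.

Lemma region_exact0 R b : (forall S : {set evar n}, ~~ R (b + edeg S)) -> region_exact R b.
Proof. by move=> e d x; rewrite cut_eq0 // => <- _; exists 0; rewrite !happ0. Qed.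

Lemma region_exact_subq R (cR : convex R) b :
  (forall d (x : Defs.subq T cR d b), is_cycle x -> is_boundary x) -> region_exact R b.
Proof.
move=> ex d x Rx cx.
have ix : restr_incl n _ R b (restr_proj n _ R b x) = x by [].
have [|y hy] := ex d (restr_proj n _ R b x).
  apply: (@restr_incl_inj _ R); rewrite happ0 [LHS]incl_subq_diff ix //.
exists (restr_incl n _ R b y); split; first exact: cut_incl.
by rewrite -incl_subq_diff -[subq_diff _ _ _ _ _ _ _]/(cdiff (Defs.subq T cR) (d - 1) d b y) hy.
Qed.

(** * A region split into a subcomplex [R1] and a quotient [R2] *)

Section Split.
Variables (R R1 R2 : pred (mdeg t)) (b : mdeg t).
Hypothesis cR : convex R.
Hypothesis hR : forall a, (R a = R2 a + R1 a :> nat)%N.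
Hypothesis up : forall a e, R1 a -> R2 e -> ~~ mle a e.

Lemma split_sub a : (R1 a -> R a) * (R2 a -> R a) * (R1 a -> R2 a = false).
Proof. by move: (hR a); case: (R a); case: (R1 a); case: (R2 a). Qed.

Lemma cut_split d (f : freemod n (fgen T d) b) : cut R b f = cut R2 b f + cut R1 b f.
Proof. by rewrite /cut !ghom_compE (restr_incl_proj_add _ hR). Qed.

Lemma cut1_cut d (f : freemod n (fgen T d) b) : cut R1 b (cut R b f) = cut R1 b f.
Proof.
rewrite cut_cut; apply: cut_ext => S; case R1S: (R1 _) => //=.
by rewrite (split_sub (b + edeg S)).1.1.
Qed.
Lemma cut2_cut d (f : freemod n (fgen T d) b) : cut R2 b (cut R b f) = cut R2 b f.
Proof.
rewrite cut_cut; apply: cut_ext => S; case R2S: (R2 _) => //=.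
by rewrite (split_sub (b + edeg S)).1.2.
Qed.
Lemma cut_cut1 d (f : freemod n (fgen T d) b) : cut R b (cut R1 b f) = cut R1 b f.
Proof.
rewrite cut_cut; apply: cut_ext => S; rewrite andbC; case R1S: (R1 _) => //=.
by rewrite (split_sub (b + edeg S)).1.1.
Qed.
Lemma cut_cut2 d (f : freemod n (fgen T d) b) : cut R b (cut R2 b f) = cut R2 b f.
Proof.
rewrite cut_cut; apply: cut_ext => S; rewrite andbC; case R2S: (R2 _) => //=.
by rewrite (split_sub (b + edeg S)).1.2.
Qed.
Lemma cut2_cut1 d (f : freemod n (fgen T d) b) : cut R2 b (cut R1 b f) = 0.
Proof.
rewrite cut_cut; apply: cut_eq0 => S; rewrite andbC; case R1S: (R1 _) => //=.
by rewrite (split_sub (b + edeg S)).2.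
Qed.
Lemma cut1_cut2 d (f : freemod n (fgen T d) b) : cut R1 b (cut R2 b f) = 0.
Proof.
rewrite cut_cut; apply: cut_eq0 => S; case R1S: (R1 _) => //=.
by rewrite (split_sub (b + edeg S)).2.
Qed.
Lemma cut2_diff1 d d' (f : freemod n (fgen T d) b) : cut R2 b (D d d' b (cut R1 b f)) = 0.
Proof. exact: cut_diff_cut_eq0 up. Qed.

(** A preimage of the [R2] part of a cycle is subtracted first; what remains is a cycle inside
    [R1]. *)
Lemma region_exact_split : region_exact R1 b -> region_exact R2 b -> region_exact R b.
Proof.
move=> ex1 ex2 d x Rx cx.
have x12 : x = cut R2 b x + cut R1 b x by rewrite -cut_split.
have [||y2 [Ry2 hy2]] := ex2 d (cut R2 b x).
- exact: cutK.
- have : cut R2 b (D d (d + 1) b x) = 0 by rewrite -cut2_cut cx happ0.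
  by rewrite {1}x12 !happD cut2_diff1 addr0.
pose x' := x - cut R b (D (d - 1) d b y2).
have Ry2' : cut R b y2 = y2 by rewrite -Ry2 cut_cut2.
have Rx' : cut R b x' = x' by rewrite happB Rx cutK.
have R1x' : cut R1 b x' = x'.
  have e : cut R2 b x' = 0 by rewrite happB cut2_cut hy2 subrr.
  by rewrite -[RHS]Rx' cut_split e add0r.
have [||y1 [Ry1 hy1]] := ex1 d x'; first by [].
  rewrite -cut1_cut [X in cut R1 b X](_ : _ = 0) ?happ0 //.
  by rewrite !happB cx cut_diff_sq // subrr.
exists (y1 + y2); split; first by rewrite happD Ry2' -Ry1 cut_cut1.
rewrite !happD [cut R b (D _ _ _ y1)]cut_split hy1 -Ry1 cut2_diff1 add0r.
by rewrite subrK.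
Qed.

Hypothesis exR : region_exact R b.

(** If the connecting map sends [x] to the boundary of [w], then [x - w] is a cycle of the exact
    middle complex, and the [R2] part of a preimage bounds [x]. *)
Lemma connecting_injective (d0 d d1 : int) (x : freemod n (restr (fgen T d) R2) b)
    (w : freemod n (restr (fgen T d) R1) b) : d = d0 + 1 -> d1 = d + 1 ->
  subq_diff T R2 R2 d d1 b x = 0 ->
  subq_diff T R1 R1 d d1 b w = subq_diff T R2 R1 d d1 b x ->
  exists y, subq_diff T R2 R2 d0 d b y = x.
Proof.
move=> ed -> /(congr1 (restr_incl n _ R2 b)); rewrite incl_subq_diff happ0 => cX.
move=> /(congr1 (restr_incl n _ R1 b)); rewrite !incl_subq_diff => cW.
set X := restr_incl _ _ _ _ x in cX cW; set W := restr_incl _ _ _ _ w in cW.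
have R2X : cut R2 b X = X by exact: cut_incl.
have R1W : cut R1 b W = W by exact: cut_incl.
have [||y [Ry hy]] := @exR d (X - W).
- by rewrite happB -R2X -R1W cut_cut2 cut_cut1.
- rewrite cut_split !happB cX -cW subrr addr0 sub0r.
  by rewrite -R1W cut2_diff1 oppr0.
have {ed} ed : d - 1 = d0 by rewrite ed addrK.
case: _ / ed => //; exists (restr_proj n _ R2 b y).
apply: (@restr_incl_inj _ R2); rewrite incl_subq_diff -/X.
rewrite -[restr_incl _ _ _ _ (restr_proj _ _ _ _ _)]/(cut R2 b y).
have -> : cut R2 b y = y - cut R1 b y by rewrite -{2}Ry cut_split addrK.
rewrite !happB cut2_diff1 subr0 -cut2_cut hy happB R2X -R1W cut2_cut1 subr0 //.
Qed.

(** The cycle [w] bounds some [y] in the middle complex. The [R2] part of [y] is a cycle that hits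
    [w] up to the boundary of the [R1] part. *)
Lemma connecting_surjective (d0 d d1 : int) (w : freemod n (restr (fgen T d) R1) b) :
  d = d0 + 1 -> d1 = d + 1 -> subq_diff T R1 R1 d d1 b w = 0 ->
  exists x v, subq_diff T R2 R2 d0 d b x = 0 /\
    subq_diff T R1 R1 d0 d b v = w - subq_diff T R2 R1 d0 d b x.
Proof.
move=> ed -> /(congr1 (restr_incl n _ R1 b)); rewrite incl_subq_diff happ0.
set W := restr_incl _ _ _ _ w => cW.
have R1W : cut R1 b W = W by exact: cut_incl.
have [||y [Ry hy]] := @exR d W.
- by rewrite -R1W cut_cut1.
- by rewrite cut_split cW -R1W cut2_diff1 addr0.
have {ed} ed : d - 1 = d0 by rewrite ed addrK.
case: _ / ed => //; exists (restr_proj n _ R2 b y), (restr_proj n _ R1 b y).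
have y12 : y = cut R2 b y + cut R1 b y by rewrite -cut_split.
split.
  apply: (@restr_incl_inj _ R2); rewrite incl_subq_diff happ0.
  rewrite -[restr_incl _ _ _ _ (restr_proj _ _ _ _ _)]/(cut R2 b y).
  have -> : cut R2 b y = y - cut R1 b y by rewrite {2}y12 addrK.
  by rewrite !happB cut2_diff1 subr0 -cut2_cut hy -R1W cut2_cut1.
apply: (@restr_incl_inj _ R1); rewrite happB !incl_subq_diff -/W.
apply/eqP; rewrite eq_sym subr_eq eq_sym addrC -!happD.
rewrite -[restr_incl _ _ R2 _ _]/(cut R2 b y) -[restr_incl _ _ R1 _ _]/(cut R1 b y).
by rewrite -y12 -cut1_cut hy R1W.
Qed.
End Split.
End Cuts.
Arguments cut {K t n B} R.

(** * Exactness of regions from exactness of strands *)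

Section RegionExactness.
Variables (K : fieldType) (t : nat) (n : 'I_t -> nat) (T : fcpx K n).

Lemma edeg_bounds (b : mdeg t) (S : {set evar n}) i :
  b i - #|evar n|%:Z <= (b + edeg S) i <= b i.
Proof.
rewrite !ffunE lerD2l lerN2 lez_nat max_card /= gerDl oppr_le0 //.
Qed.

Lemma region_exact_peel (R : pred (mdeg t)) i b : convex R ->
  (forall v, region_exact T (fun a => R a && (a i == v)) b) -> region_exact T R b.
Proof.
move=> cR exv.
(* All relevant [a i] lie between [b i - #|evar n|] and [b i]. So [m = 0] gives the empty region,
   each step adds the slice [a i = b i - m] as a quotient, and [#|evar n|.+1] steps reach all of
   [R]. *)
have hm (m : nat) : region_exact T (fun a => R a && (b i + 1 - m%:Z <= a i)) b.
  elim: m => [|m IH].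
    apply: region_exact0 => S; have := edeg_bounds b S i.
    move: ((b + edeg S) i) => x h; rewrite negb_and; apply/orP; right; lia.
  apply: (region_exact_split (R1 := fun a => R a && (b i + 1 - m%:Z <= a i))
    (R2 := fun a => R a && (a i == b i + 1 - m.+1%:Z))) => //.
  - move=> a e c ae ec /andP[Ra ha] /andP[Rc hc].
    rewrite (cR _ _ _ ae ec Ra Rc); apply: le_trans ha _.
    by move/forallP: ae; apply.
  - by move=> a; case: (R a) => //=; lia.
  - move=> a e /andP[_ ha] /andP[_ he]; apply/negP => /forallP /(_ i); lia.
apply: region_exact_ext (hm (#|evar n|).+1) => S; have := edeg_bounds b S i.
by case: (R _) => //=; lia.
Qed.

Lemma region_exact_fix (s : seq 'I_t) (R : pred (mdeg t)) b : uniq s -> convex R ->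
  (forall c : mdeg t, region_exact T (fun a => R a && all (fun i => a i == c i) s) b) ->
  region_exact T R b.
Proof.
elim: s R => [|i s IH] R.
  by move=> _ _ /(_ 0); apply: region_exact_ext => S; rewrite /= andbT.
move=> /= /andP[nis us] cR ex; apply: (@region_exact_peel _ i) => // v.
apply: IH => //.
  move=> a e c ae ec /andP[Ra /eqP ha] /andP[Rc /eqP hc].
  rewrite (cR _ _ _ ae ec Ra Rc) /= eq_le -{1}hc -ha.
  by move/forallP: ae => ->; move/forallP: ec => ->.
move=> c; pose c' : mdeg t := [ffun k => if k == i then v else c k].
apply: region_exact_ext (ex c') => S; rewrite /= [c' i]ffunE eqxx andbA; congr (_ && _).
apply: eq_in_all => k ks; rewrite [c' k]ffunE; case: (eqVneq k i) => // ek.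
by rewrite -ek ks in nis.
Qed.

(* Fixing the coordinates other than [k] one at a time cuts [R] into strands. *)
Lemma region_exact_free_coordinate (R : pred (mdeg t)) k b :
  (forall c (J : {set 'I_t}), J \proper [set: 'I_t] -> exact_cpx (strand T c J)) ->
  convex R -> (forall a e : mdeg t, (forall i, i != k -> a i = e i) -> R a = R e) ->
  region_exact T R b.
Proof.
move=> exT cR Rk.
apply: (@region_exact_fix [seq i <- enum 'I_t | i != k]) => //.
  by rewrite filter_uniq ?enum_uniq.
move=> c; have allP a : reflect (forall i, i != k -> a i = c i)
    (all (fun i => a i == c i) [seq i <- enum 'I_t | i != k]).
  apply: (iffP allP) => h i.
    by move=> ik; apply/eqP/h; rewrite mem_filter ik mem_enum.
  by rewrite mem_filter => /andP[ik _]; apply/eqP/h.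
(* As [R] ignores coordinate [k], the slice through [c] is either empty or a full strand, with [J]
   the complement of [k]. *)
case Rc: (R c); last first.
  apply: region_exact0 => S; apply/negP => /andP[Ra /allP h].
  by rewrite (Rk _ _ h) Rc in Ra.
have pJ : ~: [set k] \proper [set: 'I_t].
  by rewrite properT; apply/eqP => /setP /(_ k); rewrite !inE eqxx.
have exc := region_exact_subq (cR := @region_convex t c set0 (~: [set k]) set0)
  (fun d x => exT c _ pJ d b x).
apply: region_exact_ext exc => S.
set a := b + edeg S; apply/forallP/andP => [h|[_ /allP h] i]; last first.
  by rewrite !inE /= andbT; apply/implyP => /h ->.
have ha : forall i, i != k -> a i = c i.
  by move=> i ik; have := h i; rewrite !inE ik /= andbT => /eqP.
by split; [rewrite (Rk _ _ ha) | apply/allP].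
Qed.
End RegionExactness.

(** * Quasi-isomorphisms and shifts *)

Section ShiftQuasiIso.
Variables (K : fieldType) (t : nat) (n : 'I_t -> nat).
Implicit Types (A B C : cpx K n).

Lemma shift_cycle C k d b (x : shift k C d b) :
  is_cycle x <-> cdiff C (k + d) (k + (d + 1)) b x = 0.
Proof.
rewrite /is_cycle /=; split=> [/eqP|->]; last by rewrite scaler0.
by rewrite scaler_eq0 signr_eq0 => /eqP.
Qed.

Lemma shift_boundary C k d b (x : shift k C d b) :
  is_boundary x <-> exists y, cdiff C (k + (d - 1)) (k + d) b y = x.
Proof.
have sgn (V : lmodType K) (v : V) : (-1) ^+ `|k|%N *: ((-1) ^+ `|k|%N *: v) = v.
  by rewrite scalerA -expr2 sqrr_sign scale1r.
split=> -[y hy]; exists ((-1) ^+ `|k|%N *: y).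
  by rewrite happZ; exact: hy.
by rewrite /= happZ sgn.
Qed.

Lemma bijective_quasi_iso A B (f : cmap A B) : bijective_cmap f -> quasi_iso f.
Proof.
move=> bf d b; split=> [x cx [y hy]|y cy].
  have [_ /(_ y)[z hz]] := bf (d - 1) b; exists z.
  by have [i _] := bf d b; apply: i; rewrite cmap_comm hz.
have [_ /(_ y)[x hx]] := bf d b; exists x; split.
  by have [i _] := bf (d + 1) b; apply: i; rewrite cmap_comm hx happ0.
by exists 0; rewrite happ0 hx subrr.
Qed.

Lemma quasi_iso_comp A B C (f : cmap A B) (g : cmap B C) :
  quasi_iso f -> quasi_iso g -> quasi_iso (cmap_comp g f).
Proof.
move=> qf qg d b; split=> [x cx bx|z cz].
  by apply: (proj1 (qf d b)) => //; apply: (proj1 (qg d b)) => //; apply: is_cycle_map.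
have [y [cy by_]] := proj2 (qg d b) z cz.
have [x [cx bx]] := proj2 (qf d b) y cy.
exists x; split=> //; rewrite -(subrK (g d b y) z) -addrA.
by apply: is_boundaryD by_ _; rewrite -happB; apply: is_boundary_map.
Qed.

Lemma quasi_iso_shift0 C : quasi_iso (shift0 C).
Proof.
apply: bijective_quasi_iso => d b; split=> [x y|y].
  move/(congr1 (recast (fun d => C d b) d (0 + d))).
  by rewrite !recast_recast ?add0r // !recast_id.
exists (recast (fun d => C d b) d (0 + d) y).
by rewrite /= recast_recast ?add0r // recast_id.
Qed.
End ShiftQuasiIso.

(** * The corner map is a quasi-isomorphism *)

Section CornerMap.
Variables (K : fieldType) (t : nat) (n : 'I_t -> nat) (T : fcpx K n) (c : mdeg t).
Hypothesis exT : forall c (J : {set 'I_t}), J \proper [set: 'I_t] -> exact_cpx (strand T c J).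

(** The two shifts of a corner step name one degree of [T] in different ways; the extra variables
    let both names occur. *)
Lemma connecting_injective_at (R R1 R2 : pred (mdeg t)) b (d0 d d1 dw e : int)
    (x : freemod n (restr (fgen T d) R2) b) (w : freemod n (restr (fgen T dw) R1) b) :
  (forall a, (R a = R2 a + R1 a :> nat)%N) ->
  (forall a e, R1 a -> R2 e -> ~~ mle a e) -> region_exact T R b ->
  d = d0 + 1 -> d1 = d + 1 -> dw = d -> e = d + 1 ->
  subq_diff T R2 R2 d d1 b x = 0 ->
  subq_diff T R1 R1 dw e b w = subq_diff T R2 R1 d e b x ->
  exists y, subq_diff T R2 R2 d0 d b y = x.
Proof.
move=> hR up ex ed ed1 edw ee h1 h2; subst dw e d1.
exact: (connecting_injective hR up ex ed (erefl _) h1 h2).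
Qed.

Lemma connecting_surjective_at (R R1 R2 : pred (mdeg t)) b (d0 d d1 d2 dv : int)
    (w : freemod n (restr (fgen T d) R1) b) :
  (forall a, (R a = R2 a + R1 a :> nat)%N) ->
  (forall a e, R1 a -> R2 e -> ~~ mle a e) -> region_exact T R b ->
  d = d0 + 1 -> d1 = d + 1 -> d2 = d -> dv = d0 ->
  subq_diff T R1 R1 d d1 b w = 0 ->
  exists x (v : freemod n (restr (fgen T dv) R1) b), subq_diff T R2 R2 d0 d2 b x = 0 /\
    subq_diff T R1 R1 dv d b v = w - subq_diff T R2 R1 d0 d b x.
Proof.
move=> hR up ex ed ed1 ed2 edv h1; subst dv d2.
exact: (connecting_surjective hR up ex ed ed1 h1).
Qed.

Lemma below_step k a e : (k < t)%N -> region c (below t k) set0 (~: below t k) a ->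
  region c (below t k.+1) set0 (~: below t k.+1) e -> ~~ mle a e.
Proof.
move=> hk /forallP ha /forallP he; apply/negP => /forallP ae.
pose i := Ordinal hk; have := ha i; have := he i; have := ae i.
rewrite !inE /= ltnn ltnSn /= andbT => h1 h2 h3.
by have := le_lt_trans (le_trans h3 h1) h2; rewrite ltxx.
Qed.

(** Coordinate [k] lies neither in [below k] nor in the complement of [below k.+1], so the region
    does not constrain it. *)
Lemma middle_region_exact k b : (k < t)%N ->
  region_exact T (region c (below t k) set0 (~: below t k.+1)) b.
Proof.
move=> hk; apply: (@region_exact_free_coordinate _ _ _ _ _ (Ordinal hk)) => //.
  exact: region_convex.
move=> a e ae; apply: eq_forallb => i.
have [->|ne] := eqVneq i (Ordinal hk); first by rewrite !inE /= ltnn ltnSn.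
by rewrite ae.
Qed.

Lemma quasi_iso_corner_step k (hk : (k < t)%N) : quasi_iso (corner_step T c hk).
Proof.
pose R j := region c (below t j) set0 (~: below t j).
have ex b : region_exact T _ b := @middle_region_exact k b hk.
have up a e : R k a -> R k.+1 e -> ~~ mle a e by exact: below_step.
have hR a := region_step c a hk.
move=> d b; split=> [x /shift_cycle cx /shift_boundary [w hw]|w /shift_cycle cw].
  apply/shift_boundary.
  apply: (connecting_injective_at hR up (ex b) _ _ _ _ cx hw); lia.
have [||||x [v [hx hv]]] := connecting_surjective_at (d0 := - k.+1%:Z + d)
  (d2 := - k.+1%:Z + (d + 1)) (dv := - k%:Z + (d - 1)) hR up (ex b) _ _ _ _ cw; try lia.
exists x; split; first exact/shift_cycle.
by apply/shift_boundary; exists v.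
Qed.

Lemma quasi_iso_corner_comp k (hk : (k <= t)%N) : quasi_iso (corner_comp T c hk).
Proof.
elim: k hk => [|k IH] hk; first exact: quasi_iso_shift0.
apply: quasi_iso_comp; last exact: IH.
exact: quasi_iso_corner_step.
Qed.

Lemma quasi_iso_corner_map : quasi_iso (corner_map T c).
Proof. exact: quasi_iso_corner_comp. Qed.
End CornerMap.

(** * Shifts, quotients and minimality under maps; socle and top of free modules *)

Section Functoriality.
Variables (K : fieldType) (t : nat) (n : 'I_t -> nat).
Implicit Types (A B C D : cpx K n).

Definition shift_map k A B (f : cmap A B) : cmap (shift k A) (shift k B).
Proof.
exists (fun d => f (k + d)) => d d' b x.
by rewrite /= happZ cmap_comm.
Defined.

Lemma quasi_iso_shift_map k A B (f : cmap A B) : quasi_iso f -> quasi_iso (shift_map k f).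
Proof.
move=> qf d b; have e1 : k + d = k + (d - 1) + 1 by rewrite addrA subrK.
have e2 : k + (d + 1) = k + d + 1 by rewrite addrA.
split=> [x /shift_cycle /(is_cycleP _ e2) cx /shift_boundary /(is_boundaryP _ e1) bx|].
  apply/shift_boundary/(is_boundaryP _ e1).
  exact: (proj1 (qf (k + d) b)).
move=> y /shift_cycle /(is_cycleP _ e2) cy.
have [x [cx bx]] := proj2 (qf (k + d) b) y cy; exists x; split.
  exact/shift_cycle/(is_cycleP _ e2).
exact/shift_boundary/(is_boundaryP _ e1).
Qed.

Lemma cdiff_recast C i j d e b (x : C d b) : d = i -> e = j ->
  recast (fun d => C d b) e j (cdiff C d e b x) = cdiff C i j b (recast (fun d => C d b) d i x).
Proof. by move=> ei ej; subst i j; rewrite !recast_id. Qed.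

Definition shift_shiftN k C : cmap C (shift k (shift (- k) C)).
Proof.
exists (fun d => recast_hom C d (- k + (k + d))) => d d' b x.
rewrite /= abszN scalerA -expr2 sqrr_sign scale1r.
by apply: cdiff_recast; rewrite addKr.
Defined.

Lemma shift_shiftN_bij k C : bijective_cmap (shift_shiftN k C).
Proof.
move=> d b; have e : - k + (k + d) = d by rewrite addKr.
split=> [x y|y].
  move/(congr1 (recast (fun d => C d b) (- k + (k + d)) d)).
  by rewrite !recast_recast // !recast_id.
exists (recast (fun d => C d b) (- k + (k + d)) d y).
by rewrite /= recast_recast // recast_id.
Qed.

Lemma quo_factor C (W : subcpx C) D (g : cmap C D) :
  (forall d b x, x \in W d b -> g d b x = 0) ->
  exists h : cmap (quo_cpx W) D, forall d b x, h d b (quo_proj W d b x) = g d b x.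
Proof.
move=> gW.
pose h d b (m : lquot (W d b)) : D d b :=
  g d b (repr (m : ring_quotient.Quotient.quot (subgroup_of (W d b)))).
have hE d b x : h d b (lpi (W d b) x) = g d b x.
  apply/eqP; rewrite -subr_eq0 -happB; apply/eqP/gW/lpi_eq.
  by rewrite lpi_repr.
unshelve eexists (CMap (A := quo_cpx W) (B := D) (cmap_at := fun d =>
  GHom (M := quo_cpx W d) (N := D d) (happ := h d) _ _) _).
- by move=> b c x y; rewrite -[x]lpi_repr -[y]lpi_repr -linearP !hE linearP.
- move=> b b' m x; rewrite -[m]lpi_repr; move: (repr _) => m'.
  by rewrite [act _ _ _ _ _](gquo_actE (@subcpx_act _ _ _ _ W d)) !hE happ_act.
- move=> d d' b m; rewrite -[m]lpi_repr; move: (repr _) => m'.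
  by rewrite /= quo_diffE !hE cmap_comm.
- by move=> d b x; exact: hE.
Qed.

Lemma in_radical_map (M N : gmod K n) (g : ghom M N) b (m : M b) :
  in_radical m -> in_radical (g b m).
Proof.
move=> [r [c [u [x [hx ->]]]]]; exists r, c, (fun k => g _ (u k)), x; split=> //.
by rewrite happ_sum; apply: eq_bigr => k _; rewrite happ_act.
Qed.

Lemma minimal_shift k C : minimal C -> minimal (shift k C).
Proof.
move=> mC d d' b x; rewrite /= -happZ; exact: mC.
Qed.

Lemma minimal_subq (T : fcpx K n) R (cR : convex R) : minimal T -> minimal (Defs.subq T cR).
Proof.
move=> mT d d' b x.
rewrite -[cdiff _ _ _ _ _]/(restr_proj n _ R b (cdiff T d d' b (restr_incl n _ R b x))).
exact/in_radical_map/mT.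
Qed.

(** The coordinate at the full set is the class modulo E_+: a nonempty [R] is never disjoint from
    the full set. *)
Lemma in_radical_top (B : mdeg t -> lmodType K) b (f : freemod n B b) :
  in_radical f -> (f : freemod n B b) [set: evar n] = 0.
Proof.
move=> [r [c [u [x [hx ->]]]]]; rewrite dprod_sumE big1 // => k _.
rewrite free_actE big1 // => R _; have [->|/set0Pn[v vR]] := eqVneq R set0.
  by rewrite hx mulr0 scale0r.
rewrite esign_eq0 ?mul0r ?scale0r //; apply/pred0Pn; exists v.
by rewrite /= vR inE.
Qed.

(* The socle element [free_single v] is a multiple of [e_S] for [S] the full set
   of variables, and radical elements are killed by that [e_S]. *)
Lemma minimal_socle (T : fcpx K n) d d' b (v : fgen T d (b + edeg (set0 : {set evar n}))) :
  minimal T -> fdiff T d d' b (free_single v) = 0.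
Proof.
move=> mT; have [b' [g [c ->]]] := free_single_act v.
rewrite happ_act; apply: dprodP => S; rewrite act_ebasis dprod0E.
have [->|/set0Pn[w wS]] := eqVneq S set0; last first.
  by rewrite esign_eq0 ?mul0r ?scale0r //; apply/pred0Pn; exists w; rewrite /= wS !inE.
have e : ~: set0 :|: set0 = [set: evar n] by rewrite setU0 setC0.
rewrite (recast_dep (u := fun S => b' + edeg S) (fdiff T d d' b' g) _ e).
by rewrite (in_radical_top (mT d d' b' g)) linear0 scaler0.
Qed.

Lemma sum_edeg (S : {set evar n}) : \sum_i (edeg S : mdeg t) i = - #|S|%:Z.
Proof.
rewrite -sum1_card (partition_big (fun v : evar n => tag v) predT) //=.
rewrite -[Posz _]natz natr_sum -sumrN; apply: eq_bigr => i _.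
rewrite !ffunE; congr (- _); rewrite natz; congr Posz.
by rewrite -sum1_card; apply: eq_bigl => v; rewrite !inE.
Qed.

Lemma edeg_ge (S : {set evar n}) i : - (n i).+1%:Z <= (edeg S : mdeg t) i.
Proof.
rewrite !ffunE lerN2 lez_nat.
have -> : (n i).+1 = #|[set: 'I_(n i).+1]| by rewrite cardsT card_ord.
apply: leq_trans (leq_imset_card (fun j => Tagged (fun i => 'I_(n i).+1) j) _).
apply: subset_leq_card; apply/subsetP => -[k j]; rewrite !inE => /andP[_ /eqP /= ek].
by move: j; rewrite ek => j; apply/imsetP; exists j; rewrite ?inE.
Qed.
End Functoriality.

(** * The negative, positive and outer regions *)

Section Regions.
Variables (K : fieldType) (t : nat) (n : 'I_t -> nat).

(** Written with [below], so that [qT T (ones t) t] is by definition the subquotient of this region,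
    and [qT T (ones t) 0] that of the next. *)
Definition negative_region : pred (mdeg t) :=
  region (ones t) (below t t) set0 (~: below t t).
Definition positive_region : pred (mdeg t) :=
  region (ones t) (below t 0) set0 (~: below t 0).
Definition outer_region : pred (mdeg t) :=
  fun a => negative_region a && ~~ window n a.

Lemma negative_regionP (a : mdeg t) : reflect (forall i, a i <= 0) (negative_region a).
Proof.
apply: (iffP forallP) => h i; have := h i; rewrite !inE ltn_ord ffunE /= ?andbT; lia.
Qed.

Lemma positive_regionP (a : mdeg t) : reflect (forall i, 1 <= a i) (positive_region a).
Proof.
apply: (iffP forallP) => h i; have := h i; rewrite !inE ffunE //=.
Qed.

Lemma windowP (a : mdeg t) : reflect (forall i, - (n i)%:Z <= a i <= 0) (window n a).
Proof. exact: forallP. Qed.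

Lemma window_negative a : window n a -> negative_region a.
Proof. by move=> /windowP h; apply/negative_regionP => i; have /andP[] := h i. Qed.

Lemma outer_region_add a : (negative_region a = outer_region a + window n a :> nat)%N.
Proof.
rewrite /outer_region; case Wa: (window n a); first by rewrite window_negative.
by rewrite andbT addn0.
Qed.

(** Hence the window is a subcomplex of the negative part, with the outer summands as quotient. *)
Lemma window_outer a e : window n a -> outer_region e -> ~~ mle a e.
Proof.
move=> /windowP ha /andP[/negative_regionP he nW]; apply: contra nW => /forallP ae.
apply/windowP => i; rewrite he andbT; apply: le_trans (ae i).
by have /andP[] := ha i.
Qed.

Lemma outer_region_convex : convex outer_region.
Proof.
move=> a e c ae ec /andP[na _] /andP[nc nWc]; apply/andP; split.
  exact: (@region_convex _ _ _ _ _ a e c ae ec na nc).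
apply/negP => We; have oc : outer_region c by apply/andP.
by have := window_outer We oc; rewrite ec.
Qed.

Lemma positive_degree (b : mdeg t) (S : {set evar n}) :
  ~~ mle (ones t) b -> ~~ positive_region (b + edeg S).
Proof.
apply: contra => /positive_regionP h; apply/forallP => i; rewrite ffunE.
apply: le_trans (h i) _; rewrite ffunE gerDl ffunE oppr_le0 //.
Qed.

(** There are [n i + 1] variables in V_i, so from [b i >= 1] the coordinate [b i + edeg S i] is at
    least [- n i]: this is the origin of the lower end of the window. *)
Lemma outer_degree (b : mdeg t) (S : {set evar n}) :
  mle (ones t) b -> ~~ outer_region (b + edeg S).
Proof.
move=> /forallP hb; rewrite negb_and negbK; case: negative_regionP => //= hn.
apply/windowP => i; rewrite hn andbT ffunE.
have := hb i; rewrite ffunE; have := edeg_ge S i.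
by move: (edeg S i) (b i) => x y; lia.
Qed.

Lemma restr_degree_eq0 (B : mdeg t -> lmodType K) (R : pred (mdeg t)) b
    (x : freemod n (restr B R) b) : (forall S : {set evar n}, ~~ R (b + edeg S)) -> x = 0.
Proof. by move=> h; apply: dprodP => S; rewrite dprod0E; apply: restr_eq0. Qed.
End Regions.

(** * P(BW) and the map from the outer summands *)

Section BeilinsonWindow.
Variables (K : fieldType) (t : nat) (n : 'I_t -> nat) (T : fcpx K n).

Lemma in_PBW d b (x : BW T d b) : ~~ mle (ones t) b -> x \in PBW T d b.
Proof. by move=> hb; apply/asboolP => W; apply. Qed.

(** As [E] acts by lowering degrees, the components in multidegrees not [>= 1^t] already form a
    subcomplex, so generating adds nothing elsewhere. *)
Lemma PBW_eq0 d b (x : BW T d b) : mle (ones t) b -> x \in PBW T d b -> x = 0.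
Proof.
pose Q d b (x : BW T d b) := mle (ones t) b -> x = 0.
have Q0 d' b' : Q d' b' 0 by [].
have QP d' b' (c : K) x' y : Q d' b' x' -> Q d' b' y -> Q d' b' (c *: x' + y).
  by move=> hx hy hb; rewrite hx // hy // scaler0 addr0.
unshelve epose (W := @SubCpx K t n (BW T) (fun d b => prop_sub (Q0 d b) (@QP d b)) _ _).
- move=> d' c c' m y /prop_subP hm; apply/prop_subP => hc'.
  rewrite act_sum_basis big1 // => S _; have [e|ne] := eqVneq c' (c + edeg S).
    rewrite hm ?act0l ?scaler0 //; apply/forallP => i.
    have /forallP/(_ i) := hc'; move/le_trans; apply.
    by rewrite e ffunE gerDl ffunE oppr_le0.
  by rewrite act_ebasis_eq0 ?scaler0.
- move=> d' d'' c m /prop_subP hm; apply/prop_subP => hc.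
  by rewrite hm // happ0.
move=> hb /asboolP /(_ W) h; have /prop_subP : x \in W d b; last exact.
by apply: h => d' c y hc; apply/prop_subP => hc'; rewrite hc' in hc.
Qed.

(** The outer-to-window component of d d = 0 has two terms, one through each region. Their opposite
    signs are absorbed by the shift by -1 in [outer_cpx]. *)
Lemma outer_square d m m' e b (x : freemod n (restr (fgen T d) (outer_region n)) b) : m = m' ->
  subq_diff T (outer_region n) (window n) m e b
    (subq_diff T (outer_region n) (outer_region n) d m b x) =
  - subq_diff T (window n) (window n) m' e b
    (subq_diff T (outer_region n) (window n) d m' b x).
Proof.
move=> <-; apply/eqP; rewrite -addr_eq0; apply/eqP.
have := subq_diff_sq (R := @negative_region t) (R1 := outer_region n) (R2 := window n) m e x.
rewrite /subq_diff !ghom_compE => <-.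
- by rewrite (restr_incl_proj_add _ (@outer_region_add t n)) !happD.
- exact: region_convex.
- by move=> a /andP[].
- exact: window_negative.
Qed.

Definition outer_cpx : cpx K n := shift (-1) (Defs.subq T (@outer_region_convex t n)).

Lemma outer_in_PBW d b (x : outer_cpx d b) :
  (subq_diff T (outer_region n) (window n) (-1 + d) d b x : BW T d b) \in PBW T d b.
Proof.
have [hb|nb] := boolP (mle (ones t) b); last exact: in_PBW.
rewrite (restr_degree_eq0 x) ?happ0 ?rpred0 // => S.
exact: outer_degree.
Qed.

Definition outer_map_at d : ghom (outer_cpx d) (sub_cpx (PBW T) d).
Proof.
exists (fun b (x : outer_cpx d b) =>
  (Sub (subq_diff T (outer_region n) (window n) (-1 + d) d b x) (outer_in_PBW x)
     : lsub (PBW T d b))).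
- by move=> b c x y; apply: val_inj; rewrite [LHS]linearP.
- by move=> b b' m x; apply: val_inj; rewrite [LHS]happ_act.
Defined.

Definition outer_map : cmap outer_cpx (sub_cpx (PBW T)).
Proof.
exists outer_map_at.
move=> d d' b x; apply: val_inj.
rewrite -[LHS]/(subq_diff T (outer_region n) (window n) (-1 + d') d' b
  ((-1) ^+ `|(-1 : int)|%N *:
     subq_diff T (outer_region n) (outer_region n) (-1 + d) (-1 + d') b x)).
rewrite -[RHS]/(subq_diff T (window n) (window n) d d' b
  (subq_diff T (outer_region n) (window n) (-1 + d) d b x)).
rewrite expr1 scaleN1r happN.
have [e|ne] := eqVneq d' (d + 1).
  by rewrite (@outer_square _ _ d) ?opprK // e; ring.
rewrite [RHS]subq_diff_shape //.
rewrite [subq_diff T (outer_region n) (outer_region n) _ _ _ _]subq_diff_shape.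
  by rewrite happ0 oppr0.
by apply: contra ne => /eqP; rewrite -addrA => /addrI ->.
Defined.
End BeilinsonWindow.

(** * The window as a subcomplex of the negative part *)

Section WindowInclusion.
Variables (K : fieldType) (t : nat) (n : 'I_t -> nat) (T : fcpx K n).
Local Notation Rx := (@negative_region t).
Local Notation Rd := (outer_region n).
Local Notation W := (window n).
Local Notation X := (qT T (ones t) t).

Lemma cut_negative_window d b (x : freemod n (restr (fgen T d) W) b) :
  cut Rx b (restr_incl n _ W b x) = restr_incl n _ W b x.
Proof. by rewrite -[in RHS]cut_incl -(cut_cut1 (@outer_region_add t n)) cut_incl. Qed.

Definition window_incl_at d : ghom (BW T d) (X d) :=
  ghom_comp (restr_proj n (fgen T d) Rx) (restr_incl n (fgen T d) W).

Lemma incl_window_incl d b (x : BW T d b) :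
  restr_incl n _ Rx b (window_incl_at d b x) = restr_incl n _ W b x.
Proof. exact: cut_negative_window. Qed.

Lemma window_incl_comm d d' b (x : BW T d b) :
  window_incl_at d' b (cdiff (BW T) d d' b x) = cdiff X d d' b (window_incl_at d b x).
Proof.
apply: (@restr_incl_inj _ _ _ _ Rx); rewrite incl_window_incl.
rewrite -[cdiff X _ _ _ _]/(subq_diff T Rx Rx d d' b (window_incl_at d b x)).
rewrite -[cdiff (BW T) _ _ _ _]/(subq_diff T W W d d' b x).
rewrite !incl_subq_diff incl_window_incl (cut_split (@outer_region_add t n)).
by rewrite -[X in cut Rd _ (fdiff _ _ _ _ X)]cut_incl cut2_diff1 ?add0r //; exact: window_outer.
Qed.

Definition window_incl : cmap (BW T) X := CMap window_incl_comm.

Lemma window_incl_inj d b : injective (window_incl d b).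
Proof.
move=> x y /(congr1 (restr_incl n _ Rx b)).
by rewrite !incl_window_incl => /restr_incl_inj.
Qed.

Lemma window_incl_surj d b (y : X d b) : mle (ones t) b -> exists x, window_incl d b x = y.
Proof.
move=> hb; exists (restr_proj n _ W b (restr_incl n _ Rx b y)).
apply: (@restr_incl_inj _ _ _ _ Rx); rewrite incl_window_incl.
rewrite -[LHS]/(cut W b _) -[RHS]cut_incl (cut_split (@outer_region_add t n)).
by rewrite [cut Rd b _]cut_eq0 ?add0r // => S; exact: outer_degree.
Qed.
End WindowInclusion.

(** * The two resolutions as quasi-isomorphisms *)

Section Resolutions.
Variables (K : fieldType) (t : nat) (n : 'I_t -> nat) (T : fcpx K n).
Hypothesis T_tate : tate_resolution T.
Local Notation Rx := (@negative_region t).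
Local Notation R0 := (@positive_region t).
Local Notation Rd := (outer_region n).
Local Notation W := (window n).
Local Notation X := (qT T (ones t) t).

Definition positive_cpx : cpx K n := shift t%:Z (qT T (ones t) 0).

Definition shifted_corner_map : cmap X positive_cpx :=
  cmap_comp (shift_map t%:Z (corner_map T (ones t))) (shift_shiftN t%:Z X).

Lemma quasi_iso_shifted_corner_map : quasi_iso shifted_corner_map.
Proof.
apply: quasi_iso_comp; first exact/bijective_quasi_iso/shift_shiftN_bij.
apply/quasi_iso_shift_map/quasi_iso_corner_map => c J.
exact: T_tate.2.
Qed.

Lemma positive_cpx_eq0 d b (y : positive_cpx d b) : ~~ mle (ones t) b -> y = 0.
Proof. by move=> hb; apply: restr_degree_eq0 => S; apply: positive_degree. Qed.

Lemma outer_cpx_eq0 d b (y : outer_cpx T d b) : mle (ones t) b -> y = 0.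
Proof. by move=> hb; apply: restr_degree_eq0 => S; apply: outer_degree. Qed.

(** The target of the quasi-isomorphism [shifted_corner_map] vanishes in these multidegrees. *)
Lemma negative_region_exact b : ~~ mle (ones t) b -> region_exact T Rx b.
Proof.
move=> hb.
apply: (region_exact_subq (cR := @region_convex t (ones t) (below t t) set0 (~: below t t))) => d x cx; apply: (proj1 (quasi_iso_shifted_corner_map d b)) => //.
by exists 0; rewrite happ0 [RHS]positive_cpx_eq0.
Qed.

(** Both sides vanish in multidegrees [>= 1^t]. In the others, [outer_map] is the connecting map of
    the exact negative region, split into window and outer summands. *)
Lemma quasi_iso_outer_map : quasi_iso (outer_map T).
Proof.
move=> d b; have [hb|nb] := boolP (mle (ones t) b).
  split=> [x _ _|y _]; first by exists 0; rewrite happ0 [RHS]outer_cpx_eq0.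
  exists 0; split; first by rewrite /is_cycle happ0.
  exists 0; rewrite !happ0 subr0; apply: val_inj.
  by rewrite (PBW_eq0 hb (valP y)).
have ex : region_exact T Rx b := negative_region_exact nb.
split=> [x /shift_cycle cx [w hw]|w cw].
  apply/shift_boundary; have := congr1 val hw => hw'.
  apply: (connecting_injective_at (@outer_region_add t n) (@window_outer t n)
    ex _ _ _ _ cx hw'); lia.
have cw' := congr1 val cw.
have [||||x [v [hx hv]]] := connecting_surjective_at (d0 := -1 + d)
  (d2 := -1 + (d + 1)) (dv := d - 1) (@outer_region_add t n) (@window_outer t n)
  ex _ _ _ _ cw'; try lia.
exists x; split; first exact/shift_cycle.
by exists (Sub v (in_PBW v nb)); apply: val_inj.
Qed.

Lemma window_corner_PBW d b (x : BW T d b) : x \in PBW T d b ->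
  cmap_comp shifted_corner_map (window_incl T) d b x = 0.
Proof.
have [hb|nb] := boolP (mle (ones t) b); last by move=> _; apply: positive_cpx_eq0.
by move/(PBW_eq0 hb) ->; exact: happ0.
Qed.

(** In multidegrees [>= 1^t] the quotient, the window and the negative part coincide, so [j] is the
    shifted corner map there; in the others both sides vanish. *)
Lemma quasi_iso_quotient (j : cmap (quo_cpx (PBW T)) positive_cpx) :
  (forall d b x, j d b (quo_proj (PBW T) d b x) =
     cmap_comp shifted_corner_map (window_incl T) d b x) -> quasi_iso j.
Proof.
move=> hj d b.
have piE e (x : quo_cpx (PBW T) e b) : exists x', x = quo_proj (PBW T) e b x'.
  exists (repr (x : ring_quotient.Quotient.quot (subgroup_of (PBW T e b)))).
  by rewrite [RHS]lpi_repr.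
have [hb|nb] := boolP (mle (ones t) b); last first.
  split=> [x _ _|y _]; last first.
    exists 0; split; first by rewrite /is_cycle happ0.
    by exists 0; rewrite !happ0 subr0 [RHS]positive_cpx_eq0.
  exists 0; rewrite happ0; have [x' ->] := piE _ x.
  rewrite -(happ0 (quo_proj (PBW T) d) b); apply/lpi_eq.
  exact: in_PBW.
split=> [x cx bx|y cy].
  have [x' ex] := piE _ x; subst x.
  have cx' : is_cycle x'.
    have /lpi_eq : lpi (PBW T (d + 1) b) (cdiff (BW T) d (d + 1) b x') = lpi _ 0.
      by rewrite -quo_diffE linear0; exact: cx.
    by rewrite subr0 => /(PBW_eq0 hb).
  rewrite hj in bx.
  have [z hz] := proj1 (quasi_iso_shifted_corner_map d b) _ (is_cycle_map (window_incl T) cx') bx.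
  have [z' hz'] := window_incl_surj z hb.
  exists (quo_proj (PBW T) (d - 1) b z'); rewrite -cmap_comm; congr (quo_proj _ _ _ _).
  by apply: window_incl_inj; rewrite cmap_comm hz'.
have [x [cx bx]] := proj2 (quasi_iso_shifted_corner_map d b) y cy.
have [x' hx'] := window_incl_surj x hb.
exists (quo_proj (PBW T) d b x'); split.
  apply: is_cycle_map; apply: (@window_incl_inj _ _ _ T).
  by rewrite cmap_comm hx' cx happ0.
by rewrite hj -[cmap_comp _ _ _ _ _]/(shifted_corner_map d b (window_incl T d b x')) hx'.
Qed.
End Resolutions.

(** * Boundedness of the resolutions *)

Section Boundedness.
Variables (K : fieldType) (t : nat) (n : 'I_t -> nat) (T : fcpx K n).
Hypothesis T_tate : tate_resolution T.
Hypothesis T_min : minimal T.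
Local Notation R0 := (@positive_region t).
Local Notation Rd := (outer_region n).
Local Notation W := (window n).

Lemma edeg0 : edeg (set0 : {set evar n}) = 0.
Proof.
apply/ffunP => i; rewrite !ffunE (_ : [set v in set0 | _] = set0) ?cards0 ?oppr0 //.
by apply/setP => v; rewrite !inE.
Qed.

Lemma free_single_id (B : mdeg t -> lmodType K) b (S : {set evar n}) (v : B (b + edeg S)) :
  (free_single v : freemod n B b) S = v.
Proof. by rewrite ffunE recast_id. Qed.

Lemma free_single_neq (B : mdeg t -> lmodType K) b (S U : {set evar n}) (v : B (b + edeg S)) :
  S != U -> (free_single v : freemod n B b) U = 0.
Proof. by move=> ne; rewrite ffunE recast_neq. Qed.

Lemma recast_eq0 (B : mdeg t -> lmodType K) a a' (v : B a) :
  a = a' -> recast B a a' v = 0 -> v = 0.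
Proof. by move=> e; subst a'; rewrite recast_id. Qed.

Lemma subq_eq0 d (R : pred (mdeg t)) b (x : freemod n (restr (fgen T d) R) b) :
  (forall S : {set evar n}, R (b + edeg S) -> forall v : fgen T d (b + edeg S), v = 0) -> x = 0.
Proof.
move=> h; apply: dprodP => S; rewrite dprod0E.
have [RS|nRS] := boolP (R (b + edeg S)); last exact: restr_eq0.
by rewrite -[LHS]to_of_restr (h S RS (of_restr _)) linear0.
Qed.

(** The window contains finitely many degrees, and by local finiteness each of them occurs in
    finitely many cohomological degrees. *)
Lemma window_bound : exists N : nat, forall d a (v : fgen T d a), W a -> (N < `|d|)%N -> v = 0.
Proof.
pose M := \max_i n i.
(* A family over a finite type that covers the window; a generator of degree [a] is visible in
   multidegree [a] as the coordinate at [set0]. *)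
pose a_ (h : {ffun 'I_t -> 'I_M.+1}) : mdeg t := [ffun i => - (h i)%:Z].
pose s h := sval (cid (proj2 (T_tate.1 (a_ h)))).
have sP h d (x : T d (a_ h)) : d \notin s h -> x = 0.
  by rewrite /s; case: cid => /= r; apply.
exists (\max_h \max_(d <- s h) `|d|%N)%N => d a v /windowP Wa hd.
pose h : {ffun 'I_t -> 'I_M.+1} := [ffun i => inord `|a i|%N].
have e : a = a_ h.
  apply/ffunP => i; rewrite !ffunE inordK; first by move: (a i) (Wa i) => x; lia.
  by rewrite ltnS (leq_trans _ (leq_bigmax i)) //; move: (a i) (Wa i) => x; lia.
move: v; rewrite e => v; have ds : d \notin s h.
  apply/negP => dS; move: hd; rewrite ltnNge => /negP; apply.
  apply: leq_trans (leq_bigmax h); rewrite (big_rem d) //=; exact: leq_maxl.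
have e0 : a_ h = a_ h + edeg (set0 : {set evar n}) by rewrite edeg0 addr0.
apply: (recast_eq0 e0); rewrite -[LHS](@free_single_id (fgen T d)).
by rewrite (sP h d (free_single _) ds) dprod0E.
Qed.

Section Bound.
Variable N : nat.
Hypothesis hN : forall d a (v : fgen T d a), W a -> (N < `|d|)%N -> v = 0.

Lemma BW_eq0 d b (x : BW T d b) : (N < `|d|)%N -> x = 0.
Proof. by move=> hd; apply: subq_eq0 => S WS v; apply: hN. Qed.

Lemma positive_exact e b (y : positive_cpx T e b) : e < - N%:Z -> is_cycle y -> is_boundary y.
Proof.
move=> he cy; have [hb|nb] := boolP (mle (ones t) b); last first.
  by exists 0; rewrite happ0 [RHS]positive_cpx_eq0.
have [x [_ bx]] := proj2 (quasi_iso_shifted_corner_map T_tate e b) y cy.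
have [x' hx'] := window_incl_surj x hb.
move: bx; rewrite -hx' (BW_eq0 x') ?happ0 ?subr0 //; lia.
Qed.

Lemma outer_exact e b (x : outer_cpx T e b) : N%:Z < e -> is_cycle x -> is_boundary x.
Proof.
move=> he cx; apply: (proj1 (quasi_iso_outer_map T_tate e b)) => //.
exists 0; rewrite happ0; apply: val_inj => /=.
rewrite -[RHS]/(val (outer_map T e b x)) [RHS](BW_eq0 (d := e)) //; lia.
Qed.

(* A generator of degree [a] gives a socle element of degree [a], which is a
   cycle by minimality, hence a boundary, so that a generator of strictly
   smaller degree occurs one cohomological degree lower. *)
Lemma positive_gen_eq0 (m : nat) : forall a, R0 a -> \sum_i a i < m%:Z ->
  forall e, e < - N%:Z -> forall v : fgen T (t%:Z + e) a, v = 0.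
Proof.
elim: m => [|m IH] a Ra sa e he v.
  suff : 0 <= \sum_i a i by lia.
  by apply: sumr_ge0 => i _; have /positive_regionP/(_ i) := Ra; lia.
have e0 : a = a + edeg (set0 : {set evar n}) by rewrite edeg0 addr0.
apply: (recast_eq0 e0); set w := recast _ _ _ v.
pose x := free_single w : freemod n (fgen T (t%:Z + e)) a.
have cx : cut R0 a x = x.
  apply: dprodP => S; rewrite cutE; have [<-|ne] := eqVneq set0 S.
    by rewrite (_ : R0 (a + edeg (set0 : {set evar n}))) // -e0.
  by rewrite free_single_neq // mul0rn.
have [|y] := proj1 (@shift_boundary _ _ _ (qT T (ones t) 0) t%:Z e a (restr_proj n _ R0 a x)).
  apply: positive_exact => //; apply/shift_cycle.
  rewrite -[LHS]/(restr_proj n _ R0 a (fdiff T _ _ a (cut R0 a x))) cx.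
  by rewrite minimal_socle // happ0.
rewrite -[LHS]/(restr_proj n _ R0 a (fdiff T _ _ a (restr_incl n _ R0 a y))).
set Y := restr_incl _ _ _ _ y.
(* The other coordinates of the preimage belong to generators of smaller degree sum, which vanish by
   induction. So [Y] is itself a socle element, and its differential is zero. *)
have -> : Y = free_single ((Y : freemod n _ a) set0).
  rewrite [LHS]free_sum_single (bigD1 set0) //= big1 ?addr0 // => S nS.
  rewrite (_ : (Y : freemod n _ a) S = 0).
    by apply: dprodP => U; rewrite ffunE linear0 dprod0E.
  have [RS|nRS] := boolP (R0 (a + edeg S)); last exact: restr_incl_eq0.
  apply: (IH (a + edeg S) RS _ (e - 1)); last by lia.
  under eq_bigr do rewrite ffunE.
  rewrite big_split /= sum_edeg; have : (0 < #|S|)%N by rewrite card_gt0.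
  by move: (\sum_i a i) sa => s; lia.
rewrite minimal_socle // happ0 => /(congr1 (restr_incl n _ R0 a)).
rewrite happ0 -[RHS]/(cut R0 a x) cx => x0.
by rewrite -(@free_single_id (fgen T (t%:Z + e)) a set0 w) -/x -x0 dprod0E.
Qed.

(** Dual to the previous lemma, with top coordinates instead of the socle. If no generator of larger
    degree occurs one step up, a generator is a cycle by minimality, hence a boundary, hence in the
    radical, where the top coordinate vanishes. Degree sums now increase and are bounded by 0. *)
Lemma outer_gen_eq0 (m : nat) : forall a, Rd a -> - (\sum_i a i) < m%:Z ->
  forall e, N%:Z < e -> forall v : fgen T (-1 + e) a, v = 0.
Proof.
elim: m => [|m IH] a Ra sa e he v.
  suff : 0 <= - \sum_i a i by lia.
  rewrite -sumrN; apply: sumr_ge0 => i _; rewrite oppr_ge0.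
  by have /andP[/negative_regionP/(_ i)] := Ra.
pose b : mdeg t := a - edeg [set: evar n].
have e0 : a = b + edeg [set: evar n] by rewrite subrK.
apply: (recast_eq0 e0); set w := recast _ _ _ v.
pose x := free_single w : freemod n (fgen T (-1 + e)) b.
have /(outer_exact he) [y hy] : is_cycle (restr_proj n _ Rd b x : outer_cpx T e b).
  apply/shift_cycle; rewrite -[LHS]/(restr_proj n _ Rd b (fdiff T _ _ b (cut Rd b x))).
  apply: dprodP => S; rewrite dprod0E.
  have [RS|nRS] := boolP (Rd (b + edeg S)); last exact: restr_eq0.
  rewrite free_mapE; have [->|nS] := eqVneq S [set: evar n].
    have rad : (fdiff T (-1 + e) (-1 + (e + 1)) b (cut Rd b x) : freemod n _ b) [set: evar n] = 0.
      exact: in_radical_top (@T_min (-1 + e) (-1 + (e + 1)) b (cut Rd b x)).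
    by rewrite rad linear0.
  suff -> : (fdiff T (-1 + e) (-1 + (e + 1)) b (cut Rd b x) : freemod n _ b) S = 0.
    by rewrite linear0.
  apply: (IH (b + edeg S) RS _ (e + 1)); last by lia.
  have sS : (#|S| < #|[set: evar n]|)%N.
    by apply: proper_card; rewrite properT.
  move: sa; rewrite {1}e0; under eq_bigr do rewrite ffunE.
  rewrite big_split /= sum_edeg => sa; under eq_bigr do rewrite ffunE.
  rewrite big_split /= sum_edeg.
  by move: (\sum_i b i) sa => s; lia.
have mo : minimal (outer_cpx T) by exact/minimal_shift/minimal_subq.
have := in_radical_top (mo (e - 1) e b y); rewrite hy free_mapE.
move/(congr1 (@of_restr _ _ _ _ _)); rewrite of_to_restr linear0.
have Rb : Rd (b + edeg [set: evar n]) by rewrite -e0.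
by rewrite Rb mulr1n -[x]/(free_single w) free_single_id.
Qed.

Lemma positive_cpx_bounded : bounded_below (positive_cpx T).
Proof.
exists (- N%:Z) => d b x hd; apply: subq_eq0 => S RS v.
pose s : int := \sum_i (b + edeg S) i.
apply: (@positive_gen_eq0 (absz s).+1 _ RS _ d hd).
by rewrite -/s; lia.
Qed.

Lemma outer_cpx_bounded : bounded_above (outer_cpx T).
Proof.
exists N%:Z => d b x hd; apply: subq_eq0 => S RS v.
pose s : int := \sum_i (b + edeg S) i.
apply: (@outer_gen_eq0 (absz s).+1 _ RS _ d hd).
by rewrite -/s; lia.
Qed.
End Bound.

Lemma min_projective_resolution_outer : min_projective_resolution (outer_map T).
Proof.
have [N hN] := window_bound; split.
- by move=> d; apply: freemod_projective.
- exact: outer_cpx_bounded hN.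
- exact: quasi_iso_outer_map.
- exact/minimal_shift/minimal_subq.
Qed.

Lemma min_injective_resolution_positive :
  exists j : cmap (quo_cpx (PBW T)) (positive_cpx T), min_injective_resolution j /\
    forall d b x, j d b (quo_proj (PBW T) d b x) =
      cmap_comp (shifted_corner_map T) (window_incl T) d b x.
Proof.
have [N hN] := window_bound.
have [j hj] := quo_factor (@window_corner_PBW _ _ _ T).
exists j; split=> //; split.
- by move=> d; apply: freemod_injective.
- exact: positive_cpx_bounded hN.
- exact: quasi_iso_quotient.
- exact/minimal_shift/minimal_subq.
Qed.
End Boundedness.

(** * Maps and shifts of cones *)

Section Cones.
Variables (K : fieldType) (t : nat) (n : 'I_t -> nat).
Implicit Types (A B C : cpx K n).

Lemma homotopyP A B (f g : cmap A B) h d0 d d1 b x : homotopy f g h ->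
  d = d0 + 1 -> d1 = d + 1 ->
  g d b x - f d b x = cdiff B d0 d b (h d d0 b x) + h d1 d b (cdiff A d d1 b x).
Proof.
by move=> hfg e ->; have -> : d0 = d - 1 by rewrite e addrK.
Qed.

(** A square that commutes up to homotopy gives a triangular map of cones with the homotopy as
    off-diagonal entry; it is bijective when its diagonal is. *)
Lemma cone_map A B A0 B0 (phi : cmap A B) (phi0 : cmap A0 B0)
    (al : cmap A A0) (be : cmap B B0) (s : forall d d', ghom (A d) (B0 d')) :
  homotopy (cmap_comp phi0 al) (cmap_comp be phi) s ->
  exists m : cmap (cone phi) (cone phi0),
    (forall d b x, m d b x = (be d b x.1 + s (1 + d) d b x.2, al (1 + d) b x.2)) /\
    (bijective_cmap al -> bijective_cmap be -> bijective_cmap m).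
Proof.
move=> hs.
pose m d : ghom (cone phi d) (cone phi0 d) :=
  ghom_pair (ghom_copair (be d) (s (1 + d) d)) (ghom_comp (al (1 + d)) (ghom_snd _ _)).
have mc d d' b (x : cone phi d b) :
    m d' b (cdiff (cone phi) d d' b x) = cdiff (cone phi0) d d' b (m d b x).
  congr pair; last first.
    by rewrite /= happZ cmap_comm.
  rewrite [LHS]/= [RHS]/= happZ expr1 scaleN1r.
  have [e|ne] := eqVneq d' (1 + d); last first.
    rewrite !recast_neq 1?eq_sym // [cdiff A _ _ _ _]cdiff_shape; last first.
      by apply: contra ne => /eqP; rewrite -addrA => /addrI ->; rewrite addrC.
    rewrite !addr0 !cdiff_shape ?happ0 ?subr0 // addrC //.
  subst d'; rewrite !recast_id !happD -!cmap_comm -!addrA; congr (_ + _).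
  have /= e := homotopyP (d0 := d) (d1 := 1 + (1 + d)) (x.2 : A (1 + d) b) hs
    (addrC _ _) (addrC _ _).
  by apply/eqP; rewrite subr_eq addrAC -e subrK.
exists (CMap mc); split=> // ba bb d b; split=> [[y x] [y' x']|[y x]].
  move=> [e1 e2]; have {}e2 := proj1 (ba _ _) _ _ e2.
  by move: e1; rewrite e2 => /addIr /(proj1 (bb _ _)) ->.
have [_ /(_ x)[x' hx]] := ba (1 + d) b.
have [_ /(_ (y - s (1 + d) d b x'))[y' hy]] := bb d b.
by exists (y', x'); rewrite /= hx hy subrK.
Qed.

Definition zero_homotopy A B d d' : ghom (A d) (B d') := ghom_zero _ _.

Lemma homotopy_eq A B (f g : cmap A B) : (forall d b x, f d b x = g d b x) ->
  homotopy f g (@zero_homotopy A B).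
Proof. by move=> e d b x; rewrite e subrr happ0 addr0. Qed.

Lemma recast_shift C k i j b (x : C (k + i) b) : i = j ->
  recast (fun d => C (k + d) b) i j x = recast (fun d => C d b) (k + i) (k + j) x.
Proof. by move=> e; subst j; rewrite !recast_id. Qed.

Lemma bijective_id A : bijective_cmap (cmap_id A).
Proof. by move=> d b; split=> // y; exists y. Qed.

(** Shifting the cone by [k] also multiplies its component [phi] by the sign (-1)^k, which shifting
    [phi] itself does not; rescaling the source summand by this sign compensates. *)
Lemma cone_shift_iso k C B (phi : cmap (shift (- k) C) B) :
  cpx_iso (cone (cmap_comp (shift_map k phi) (shift_shiftN k C))) (shift k (cone phi)).
Proof.
set psi := cmap_comp _ _.
have sg (V : lmodType K) (v : V) : (-1) ^+ `|k|%N *: ((-1) ^+ `|k|%N *: v) = v.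
  by rewrite scalerA -expr2 sqrr_sign scale1r.
have ei d : 1 + d = - k + (1 + (k + d)) by ring.
pose m d : ghom (cone psi d) (shift k (cone phi) d) :=
  ghom_pair (M := B (k + d)) (N := C (- k + (1 + (k + d)))) (ghom_fst _ _)
    (ghomZ ((-1) ^+ `|k|%N)
      (ghom_comp (recast_hom C (1 + d) (- k + (1 + (k + d)))) (ghom_snd _ _))).
have mc d d' b (x : cone psi d b) : m d' b (cdiff (cone psi) d d' b x) =
    cdiff (shift k (cone phi)) d d' b (m d b x).
  congr pair; rewrite [LHS]/= [RHS]/=; last first.
    set y : C (1 + d) b := x.2; set r := fun i j => recast (fun d => C d b) i j.
    have e : r (1 + d') (- k + (1 + (k + d'))) (cdiff C (1 + d) (1 + d') b y) =
        cdiff C (- k + (1 + (k + d))) _ b (r (1 + d) (- k + (1 + (k + d))) y).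
      exact: cdiff_recast.
    rewrite !expr1 !scaleN1r abszN happZ sg /r linearN.
    by congr (_ *: - _).
  rewrite scalerDr; congr (_ + _).
  have [e|ne] := eqVneq (1 + d) d'; last first.
    rewrite !recast_neq ?scaler0 //; apply: contra ne => /eqP.
    by rewrite addrCA => /addrI ->.
  subst d'; rewrite recast_id happZ linearZ sg /=.
  rewrite (recast_map (fun e => phi e b)); congr (phi _ _ _).
  have e : 1 + (k + d) = k + (1 + d) by rewrite addrCA.
  rewrite [RHS](recast_shift (C := C) (k := - k) _ e).
  by rewrite recast_recast // -ei.
apply: (@bijective_cmap_iso _ _ _ _ _ (CMap mc)) => d b; split=> [[y x] [y' x']|[y x]].
  move=> [-> /(congr1 ( *:%R ((-1) ^+ `|k|%N)))]; rewrite !sg.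
  move/(congr1 (recast (fun d => C d b) _ (1 + d))).
  rewrite recast_recast; last exact: ei.
  rewrite recast_recast; last exact: ei.
  by rewrite !recast_id => ->.
exists (y, (-1) ^+ `|k|%N *: recast (fun d => C d b) _ (1 + d) x).
congr pair; rewrite /= linearZ sg /= recast_recast; last exact/esym/ei.
exact: (@recast_id K int (fun e : int => C e b) (- k + (1 + (k + d))) x).
Qed.
End Cones.

(** * The negative part as the cone of outer summands over the window *)

Section Comparison.
Variables (K : fieldType) (t : nat) (n : 'I_t -> nat) (T : fcpx K n).
Local Notation Rx := (@negative_region t).
Local Notation Rd := (outer_region n).
Local Notation W := (window n).
Local Notation X := (qT T (ones t) t).

Definition outer_incl_at d : ghom (freemod n (restr (fgen T d) Rd)) (X d) :=
  ghom_comp (restr_proj n (fgen T d) Rx) (restr_incl n (fgen T d) Rd).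

Lemma incl_outer_incl d b x : restr_incl n _ Rx b (outer_incl_at d b x) = restr_incl n _ Rd b x.
Proof.
rewrite -[LHS]/(cut Rx b (restr_incl n _ Rd b x)) -[in RHS]cut_incl.
by rewrite -(cut_cut2 (@outer_region_add t n)) cut_incl.
Qed.

Lemma outer_incl_diff d d' b (x : freemod n (restr (fgen T d) Rd) b) :
  cdiff X d d' b (outer_incl_at d b x) =
  window_incl T d' b (subq_diff T Rd W d d' b x) + outer_incl_at d' b (subq_diff T Rd Rd d d' b x).
Proof.
apply: (@restr_incl_inj _ _ _ _ Rx); rewrite happD incl_window_incl incl_outer_incl.
rewrite -[cdiff X _ _ _ _]/(subq_diff T Rx Rx d d' b _) !incl_subq_diff incl_outer_incl.
by rewrite (cut_split (@outer_region_add t n)) addrC.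
Qed.

Lemma window_outer_sum d b (y : X d b) :
  window_incl T d b (restr_proj n _ W b (restr_incl n _ Rx b y)) +
  outer_incl_at d b (restr_proj n _ Rd b (restr_incl n _ Rx b y)) = y.
Proof.
apply: (@restr_incl_inj _ _ _ _ Rx); rewrite happD incl_window_incl incl_outer_incl.
by rewrite addrC -[RHS]cut_incl (cut_split (@outer_region_add t n)).
Qed.

Lemma window_outer_inj d b (w : BW T d b) z :
  window_incl T d b w + outer_incl_at d b z = 0 -> w = 0 /\ z = 0.
Proof.
move=> /(congr1 (restr_incl n _ Rx b)); rewrite happD incl_window_incl incl_outer_incl happ0 => e.
split; apply: restr_incl_inj; rewrite happ0 -cut_incl.
  move/(congr1 (cut W b)): e; rewrite happD happ0 -[X in _ + cut W b X]cut_incl.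
  by rewrite (cut1_cut2 (@outer_region_add t n)) addr0.
move/(congr1 (cut Rd b)): e; rewrite happD happ0 -[X in cut Rd b X + _]cut_incl.
by rewrite (cut2_cut1 (@outer_region_add t n)) add0r.
Qed.

Lemma outer_incl_recast (d d' e e' : int) b (x : freemod n (restr (fgen T e) Rd) b) :
  e = d -> e' = d' ->
  cdiff X d d' b (recast (fun i => X i b) e d (outer_incl_at e b x)) =
  window_incl T d' b (subq_diff T Rd W e d' b x) +
  recast (fun i => X i b) e' d' (outer_incl_at e' b (subq_diff T Rd Rd e e' b x)).
Proof. by move=> ee ee'; subst d d'; rewrite !recast_id outer_incl_diff. Qed.

Lemma window_outer_inj_recast (d e : int) b (w : BW T d b)
    (z : freemod n (restr (fgen T e) Rd) b) :
  e = d -> window_incl T d b w + recast (fun i => X i b) e d (outer_incl_at e b z) = 0 ->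
  w = 0 /\ z = 0.
Proof. by move=> ee; subst e; rewrite recast_id; apply: window_outer_inj. Qed.

Lemma window_outer_sum_recast (d e : int) b (y : X d b) : e = d ->
  exists w (z : freemod n (restr (fgen T e) Rd) b),
    window_incl T d b w + recast (fun i => X i b) e d (outer_incl_at e b z) = y.
Proof.
move=> ee; subst e; eexists; eexists; rewrite recast_id; exact: window_outer_sum.
Qed.

(** The shifts by -1 in [outer_cpx] and by 1 in the cone cancel, signs included. The second clause
    says that the outer part of an element is invisible in the multidegrees where the positive part
    lives. *)
Lemma window_cone_bij : exists s : cmap (cone (F_to_BW (outer_map T))) X,
  bijective_cmap s /\ forall d b (x : cone (F_to_BW (outer_map T)) d b),
    exists z, s d b x = window_incl T d b x.1 + z /\ (mle (ones t) b -> z = 0).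
Proof.
set C := cone _.
pose u (d : int) : ghom (outer_cpx T (1 + d)) (X d) :=
  ghom_comp (recast_hom X (-1 + (1 + d)) d) (outer_incl_at (-1 + (1 + d))).
have ei (d : int) : -1 + (1 + d) = d by rewrite addKr.
pose s (d : int) : ghom (C d) (X d) := ghom_copair (window_incl T d) (u d).
have uE (d : int) b x : u d b x =
    recast (fun i => X i b) (-1 + (1 + d)) d (outer_incl_at (-1 + (1 + d)) b x).
  by [].
have rf (d d' : int) b (x : outer_cpx T (1 + d) b) :
    recast (fun e => BW T e b) (1 + d) d' (F_to_BW (outer_map T) (1 + d) b x) =
    subq_diff T Rd W (-1 + (1 + d)) d' b x.
  have [e|ne] := eqVneq (1 + d) d'; first by subst d'; rewrite recast_id.
  by rewrite recast_neq // subq_diff_shape // ei addrC eq_sym.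
have sc (d d' : int) b (x : C d b) : s d' b (cdiff C d d' b x) = cdiff X d d' b (s d b x).
  rewrite -[s d b x]/(window_incl T d b x.1 + u d b x.2) happD -cmap_comm.
  rewrite uE (@outer_incl_recast _ _ _ (-1 + (1 + d'))) //.
  rewrite -[LHS]/(window_incl T d' b (cdiff (BW T) d d' b x.1 +
      recast (fun e => BW T e b) (1 + d) d' (F_to_BW (outer_map T) (1 + d) b x.2)) +
    u d' b ((-1) ^+ `|(1 : int)|%N *: ((-1) ^+ `|(-1 : int)|%N *:
      subq_diff T Rd Rd (-1 + (1 + d)) (-1 + (1 + d')) b x.2))).
  by rewrite rf happD !expr1 scalerA mulrNN mulr1 scale1r -addrA uE.
exists (CMap sc); split=> [d b|d b x]; last first.
  exists (u d b x.2); split=> // hb.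
  by rewrite (outer_cpx_eq0 x.2 hb) happ0.
split=> [x y /eqP|y].
  rewrite -subr_eq0 -happB => /eqP; set z := x - y => hz.
  suff : z = 0 by move/eqP; rewrite subr_eq0 => /eqP.
  have [] := window_outer_inj_recast (w := z.1) (z := z.2) (ei d) hz.
  by case: (z) => z1 z2 /= -> ->.
have [w [z <-]] := window_outer_sum_recast y (ei d).
by exists (w, z).
Qed.
End Comparison.

(** * Assembly of the iterated cone *)

Section Main.
Variables (K : fieldType) (t : nat) (n : 'I_t -> nat) (T : fcpx K n).

Lemma beilinson_cone_homotopy (F I F0 I0 : cpx K n) (f : cmap F (sub_cpx (PBW T)))
    (j : cmap (quo_cpx (PBW T)) I) (f0 : cmap F0 (sub_cpx (PBW T)))
    (j0 : cmap (quo_cpx (PBW T)) I0) (a : cmap F F0) (b : cmap I I0) h k :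
  bijective_cmap a -> homotopy (cmap_comp f0 a) f h ->
  bijective_cmap b -> homotopy (cmap_comp b j) j0 k ->
  cpx_iso (beilinson_cone f j) (beilinson_cone f0 j0).
Proof.
move=> ba ha bb hb.
have h1 : homotopy (cmap_comp (F_to_BW f0) a) (cmap_comp (cmap_id (BW T)) (F_to_BW f))
    (fun d d' => ghom_comp (sub_incl (PBW T) d') (h d d')).
  move=> d c x.
  have /(congr1 (sub_incl (PBW T) d c)) := ha d c x.
  by rewrite happB happD [X in _ = X + _](cmap_comm (sub_incl (PBW T))).
have [m [mE /(_ ba (@bijective_id _ _ _ _)) bm]] := cone_map h1.
(* The projection modulo P(BW) kills the off-diagonal entry of [m], so only [k] contributes; its
   sign is -1 because the two maps are compared in the opposite order. *)
have h2 : homotopy (cmap_comp (cone_desc (BW_to_I_F f0 j0)) m)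
    (cmap_comp b (cone_desc (BW_to_I_F f j)))
    (fun d d' => ghomZ (-1) (ghom_comp (k d d') (ghom_comp (quo_proj (PBW T) d) (ghom_fst _ _)))).
  move=> d c x; set pi := quo_proj (PBW T).
  have pi0 e (v : F e c) e' :
      pi e' c (recast (fun i => BW T i c) e e' (F_to_BW f e c v)) = 0.
    have z : pi e c (F_to_BW f e c v) = 0 by exact: quo_proj_incl.
    transitivity (recast (fun i => quo_cpx (PBW T) i c) e e' (pi e c (F_to_BW f e c v))).
      by symmetry; apply: (recast_map (fun i => pi i c)).
    by rewrite z linear0.
  have E1 : pi d c (m d c x).1 = pi d c x.1.
    by rewrite mE happD [X in _ + X](_ : _ = 0) ?addr0 //; exact: quo_proj_incl.
  have E2 : pi (d + 1) c (cdiff (cone (F_to_BW f)) d (d + 1) c x).1 =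
      cdiff (quo_cpx (PBW T)) d (d + 1) c (pi d c x.1).
    by rewrite happD pi0 addr0 cmap_comm.
  rewrite -[LHS]/(b d c (j d c (pi d c x.1)) - j0 d c (pi d c (m d c x).1)) E1.
  rewrite -[RHS]/(cdiff I0 (d - 1) d c (-1 *: k d (d - 1) c (pi d c x.1)) +
    -1 *: k (d + 1) d c (pi (d + 1) c (cdiff (cone (F_to_BW f)) d (d + 1) c x).1)) E2.
  rewrite happZ -scalerDr scaleN1r; have <- := hb d c (pi d c x.1).
  by rewrite opprB.
have [m' [_ /(_ bm bb) bm']] := cone_map h2.
exact: bijective_cmap_iso bm'.
Qed.

(** Through [s], the map from the inner cone becomes the shifted corner map exactly: on the window
    by the choice of [j], and on the outer summands because these vanish wherever the target does
    not. *)
Lemma beilinson_cone_corner (j : cmap (quo_cpx (PBW T)) (positive_cpx T)) :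
  (forall d b x, j d b (quo_proj (PBW T) d b x) =
    cmap_comp (shifted_corner_map T) (window_incl T) d b x) ->
  cpx_iso (beilinson_cone (outer_map T) j) (shift t%:Z (corner_cpx T (ones t))).
Proof.
move=> hj; have [s [bs hs]] := window_cone_bij T.
have h : homotopy (cmap_comp (shifted_corner_map T) s)
    (cmap_comp (cmap_id _) (cone_desc (BW_to_I_F (outer_map T) j))) (@zero_homotopy _ _ _ _ _).
  apply: homotopy_eq => d b x.
  have [z [sE hz]] := hs d b x.
  rewrite -[RHS]/(j d b (quo_proj (PBW T) d b x.1)) hj.
  rewrite -[LHS]/(shifted_corner_map T d b (s d b x)) sE happD.
  have [hb|nb] := boolP (mle (ones t) b); first by rewrite hz // happ0 addr0.
  by rewrite [LHS]positive_cpx_eq0 // [RHS]positive_cpx_eq0.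
have [m [_ /(_ bs (@bijective_id _ _ _ _)) bm]] := cone_map h.
apply: (cpx_iso_trans (B := cone (shifted_corner_map T))).
  exact: bijective_cmap_iso bm.
exact: cone_shift_iso.
Qed.

(** The cone of the corner map restricted to the window is a subcomplex of the corner complex;
    dividing it by its target summand leaves the window, shifted back to its place. *)
Lemma BW_subquotient : is_subquotient (BW T) (shift (t%:Z - 1) (corner_cpx T (ones t))).
Proof.
pose phi := cmap_comp (corner_map T (ones t)) (shift_map (- t%:Z) (window_incl T)).
have [m [mE _]] := cone_map (phi := phi) (phi0 := corner_map T (ones t))
  (al := shift_map (- t%:Z) (window_incl T)) (be := cmap_id _)
  (homotopy_eq (fun d b x => erefl)).
have ei (d : int) : - t%:Z + (1 + (t%:Z - 1 + d)) = d by ring.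
pose p (d : int) : ghom (shift (t%:Z - 1) (cone phi) d) (BW T d) :=
  ghom_comp (recast_hom (BW T) (- t%:Z + (1 + (t%:Z - 1 + d))) d) (ghom_snd _ _).
have pc (d d' : int) b (x : shift (t%:Z - 1) (cone phi) d b) :
    p d' b (cdiff (shift (t%:Z - 1) (cone phi)) d d' b x) = cdiff (BW T) d d' b (p d b x).
  rewrite -[LHS]/(recast (fun e => BW T e b) (- t%:Z + (1 + (t%:Z - 1 + d'))) d'
    ((-1) ^+ `|t%:Z - 1|%N *: ((-1) ^+ `|(1 : int)|%N *: ((-1) ^+ `|- t%:Z|%N *:
      cdiff (BW T) (- t%:Z + (1 + (t%:Z - 1 + d))) (- t%:Z + (1 + (t%:Z - 1 + d'))) b x.2)))).
  rewrite !scalerA [X in X *: _](_ : _ = 1) ?scale1r; first exact: cdiff_recast.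
  (* The three shifts contribute (-1)^(t - 1), -1 and (-1)^t, with product 1. The case [t = 0] is
     separate because the exponent is the absolute value of [t - 1]. *)
  rewrite abszN expr1; case: (t) => [|k]; first by rewrite !mulrN1 !expr1 opprK mulr1.
  have -> : k.+1%:Z - 1 = k%:Z by rewrite intS addrC addKr.
  by rewrite !absz_nat exprS mulrN1 mulN1r mulrNN -expr2 sqrr_sign.
exists (shift (t%:Z - 1) (cone phi)), (shift_map (t%:Z - 1) m), (CMap pc); split.
  move=> d b [y x] [y' x']; rewrite /= !mE /= => -[].
  rewrite !addr0 => -> /(@window_incl_inj _ _ _ T _ _ _ _) -> //.
move=> d b y; exists (0, recast (fun e => BW T e b) d (- t%:Z + (1 + (t%:Z - 1 + d))) y).
rewrite /= recast_recast ?recast_id //; exact/esym/ei.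
Qed.
End Main.

Theorem theorem6p2 (K : fieldType) (t : nat) (n : 'I_t -> nat) (T : fcpx K n)
    (T_tate : tate_resolution T) (T_min : minimal T)
    (F I : cpx K n) (f : cmap F (sub_cpx (PBW T)))
    (j : cmap (quo_cpx (PBW T)) I)
    (hf : min_projective_resolution f) (hj : min_injective_resolution j) :
  cpx_iso (shift t%:Z (corner_cpx T (ones t))) (beilinson_cone f j) /\
  is_subquotient (BW T) (shift (t%:Z - 1) (corner_cpx T (ones t))).
Proof.
split; last exact: BW_subquotient.
have [j0 [hj0 j0E]] := min_injective_resolution_positive T_tate T_min.
have hf0 := min_projective_resolution_outer T_tate T_min.
have [a [h [ba ha]]] := min_projective_resolution_unique hf hf0.
have [b [k [bb hb]]] := min_injective_resolution_unique hj hj0.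
apply/cpx_iso_sym/(cpx_iso_trans (beilinson_cone_homotopy ba ha bb hb)).
exact: beilinson_cone_corner.
Qed.
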